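(* Assume the Riemann hypothesis. Let $\sigma_1$ and $\sigma_2$ be fixed with $1/2<\sigma_1<\sigma_2<1$. Then there is a constant $C$ depending on $\sigma_1$ and $\sigma_2$ such that for every critical point $\rho'=\beta'+i\gamma'$ of the Riemann zeta function with $\sigma_1<\beta'<\sigma_2$ (and $\gamma'$ sufficiently large), $$\log|\zeta(\rho')|\ge -C\,\frac{(\log\gamma')^{2-2\beta'}}{\log\log\gamma'}.$$
   Context: $\zeta$ denotes the Riemann zeta function; a critical point of $\zeta$ is a point $\rho'$ with $\zeta'(\rho')=0$, written $\rho'=\beta'+i\gamma'$. *)

(* Defs.v *)
From Stdlib Require Import Reals.
From Coquelicot Require Import Coquelicot.
Open Scope R_scope.

Definition Cexp (z : C) : C :=
  (exp (Re z) * cos (Im z), exp (Re z) * sin (Im z)).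

(* The term of index [n], counted from 0, is (n+1)^(-s). *)
Definition dirichlet_term (s : C) (n : nat) : C :=
  Cexp (Copp s * RtoC (ln (INR (S n))))%C.

(* By the identity theorem these two conditions determine [zeta] on C \ {1};
   the value at the pole 1 is arbitrary.  [ex_derive] and [is_derive] on
   functions C -> C are complex differentiability, over [C_AbsRing]. *)
Definition is_riemann_zeta (zeta : C -> C) : Prop :=
  (forall s : C, s <> RtoC 1 -> ex_derive zeta s) /\
  (forall s : C, 1 < Re s -> is_series (dirichlet_term s) (zeta s)).

Definition riemann_hypothesis (zeta : C -> C) : Prop :=
  forall s : C, 0 < Re s < 1 -> zeta s = RtoC 0 -> Re s = 1 / 2.

Definition critical_point (f : C -> C) (rho : C) : Prop :=
  is_derive f rho (RtoC 0).

(* Main.v *)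
(* Put L = log t and c = log L, and expand log zeta about c + i t, where under the
   Riemann hypothesis it is analytic up to distance c - 1/2; s = sigma + i t is at
   distance c - sigma.  Two bounds are available for the n-th Taylor coefficient.
   - log zeta is a limit of Dirichlet polynomials with nonnegative coefficients, so
     the coefficient is at most the one at the real point c in absolute value; there
     the pole and the absence of zeros of (s - 1) zeta(s) in Re s > 1/2 give
     about 1 / (n (c - 1)^n).
   - Dividing the zeros out of a slightly larger disc by a Blaschke product, and
     applying the Borel-Caratheodory inequality to the cofactor, bounds it by
     (2 / n) * sum_rho |c + i t - rho|^(-n) plus a smaller term.  For n >= 2 c^2 this
     is O(L / (n (c - 1/2)^n)), because the value of the Blaschke product at 3 + i t
     shows sum_rho 1 / (1 + (t - Im rho)^2) = O(L).
   The first bound is used for n <= 2 c^2 and the second one beyond.  Letting the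
   centre tend to infinity with t is what makes the exponent exactly 2 - 2 sigma. *)
Require Import Defs.
From Stdlib Require Import Reals Lra Lia Psatz List Factorial.
From Stdlib Require Import Classical ClassicalEpsilon FunctionalExtensionality.
From Coquelicot Require Import Coquelicot.
Open Scope R_scope.

(** The saving 1 / log log t arises as follows: near n = 2 c^2 the factor 1 / n is of size 1 / c^2,
    while the geometric series dominating the terms on either side have ratios within O(1 / c) of 1,
    so each sums to O(c) times its largest term. The same cut-off governs the zeros: with y = t - Im
    rho one has |c + i t - rho|^2 = (c - 1/2)^2 + y^2, and for n >= 2 c^2 the power n / 2 turns the
    excess y^2 into a factor 1 + y^2. The coefficients of the cofactor carry no 1 / n; expanding it
    to a fixed distance beyond the critical line gains a factor exp (- c / 8) instead. Since zeta is
    given only by its Dirichlet series and its differentiability, its polynomial growth to the left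
    of Re s = 1 has to come from an explicit continuation and the identity theorem. No complex
    logarithm is ever chosen: a logarithm is a sequence of Taylor coefficients with an exponential
    identity, and the Euler product appears as closeness of zeta(s) exp (- P(s)) to 1. *)

(** * Moduli, real and imaginary parts *)

Lemma Cmod_minus_sym (a b : C) : Cmod (a - b)%C = Cmod (b - a)%C.
Proof. replace (a - b)%C with (- (b - a))%C by ring. apply Cmod_opp. Qed.

Lemma Cmod_triangle_minus (a b : C) : Cmod (a - b)%C <= Cmod a + Cmod b.
Proof.
  unfold Cminus. eapply Rle_trans; [apply Cmod_triangle|]. rewrite Cmod_opp; lra.
Qed.

Lemma Cmod_ge_minus (a b : C) : Cmod a - Cmod b <= Cmod (a - b)%C.
Proof.
  assert (H := Cmod_triangle (a - b)%C b).
  replace (a - b + b)%C with a in H by ring. lra.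
Qed.

Lemma Cmod_dist_triangle (a b c : C) : Cmod (a - c)%C <= Cmod (a - b)%C + Cmod (b - c)%C.
Proof.
  replace (a - c)%C with ((a - b) + (b - c))%C by ring. apply Cmod_triangle.
Qed.

Lemma im_le_Cmod (z : C) : Rabs (Im z) <= Cmod z.
Proof.
  eapply Rle_trans; [|apply Rmax_Cmod]. apply Rmax_r.
Qed.

Lemma Cmod_le_ReIm (z : C) : Cmod z <= Rabs (Re z) + Rabs (Im z).
Proof.
  destruct z as [x y].
  replace (x, y) with (RtoC x + Ci * RtoC y)%C
    by (unfold RtoC, Ci, Cplus, Cmult; simpl; f_equal; ring).
  eapply Rle_trans; [apply Cmod_triangle|].
  rewrite Cmod_mult, Cmod_Ci, !Cmod_R. unfold Re, Im, RtoC, Ci, Cplus, Cmult; simpl.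
  replace (x + (0 * y - 1 * 0)) with x by ring.
  replace (0 + (0 * 0 + 1 * y)) with y by ring. lra.
Qed.

Lemma Cmod_neq0 (z : C) : 0 < Cmod z -> z <> 0.
Proof. intros H E; rewrite E, Cmod_0 in H; lra. Qed.

Lemma Cminus_neq0 (a b : C) : a <> b -> (a - b)%C <> 0.
Proof. intros H E; apply H. replace a with ((a - b) + b)%C by ring. rewrite E; ring. Qed.

Lemma RtoC_neq0 (x : R) : x <> 0 -> RtoC x <> 0.
Proof. intros H E. apply H, RtoC_inj, E. Qed.

Lemma ratio_bounds (x r : R) : 0 <= x < r -> 0 <= x / r < 1.
Proof.
  intros H. split; [apply Rdiv_le_0_compat; lra|].
  apply Rmult_lt_reg_r with r; [lra|]. unfold Rdiv. rewrite Rmult_assoc, Rinv_l; lra.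
Qed.

Lemma Re_plus (a b : C) : Re (a + b)%C = Re a + Re b.
Proof. reflexivity. Qed.
Lemma Im_plus (a b : C) : Im (a + b)%C = Im a + Im b.
Proof. reflexivity. Qed.
Lemma Re_minus (a b : C) : Re (a - b)%C = Re a - Re b.
Proof. reflexivity. Qed.
Lemma Im_minus (a b : C) : Im (a - b)%C = Im a - Im b.
Proof. reflexivity. Qed.
Lemma Re_opp (a : C) : Re (- a)%C = - Re a.
Proof. reflexivity. Qed.
Lemma Im_opp (a : C) : Im (- a)%C = - Im a.
Proof. reflexivity. Qed.
Lemma Re_mult (a b : C) : Re (a * b)%C = Re a * Re b - Im a * Im b.
Proof. reflexivity. Qed.
Lemma Im_mult (a b : C) : Im (a * b)%C = Re a * Im b + Im a * Re b.
Proof. reflexivity. Qed.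

Lemma C_eq (a b : C) : Re a = Re b -> Im a = Im b -> a = b.
Proof. destruct a, b; unfold Re, Im; simpl; intros; subst; auto. Qed.

(** * Complex derivatives *)

(** The non-strict inequality includes [w = z], so the remainder is estimated without forming a
    quotient. *)
Definition Cderiv (f : C -> C) (z l : C) :=
  forall eps, 0 < eps -> exists d, 0 < d /\ forall w, Cmod (w - z)%C < d ->
    Cmod (f w - f z - l * (w - z))%C <= eps * Cmod (w - z)%C.

Definition holo (D : C -> Prop) (f : C -> C) := forall z, D z -> exists l, Cderiv f z l.

Lemma Cderiv_is_derive (f : C -> C) (z l : C) :
  Cderiv f z l <-> is_derive (K := C_AbsRing) (V := AbsRing_NormedModule C_AbsRing) f z l.
Proof.
  split.
  - intros H. split; [apply is_linear_scal_l|]. intros x Hx eps.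
    rewrite <- (is_filter_lim_locally_unique (K := C_AbsRing) (V := AbsRing_NormedModule C_AbsRing) z x Hx).
    destruct (H eps (cond_pos eps)) as [d [Hd H1]]. exists (mkposreal d Hd). intros w Hw.
    specialize (H1 w Hw).
    replace (f w - f z - l * (w - z))%C with (f w - f z - (w - z) * l)%C in H1 by ring.
    exact H1.
  - intros [_ H] eps He.
    destruct (H z (fun P HP => HP) (mkposreal eps He)) as [d Hd]. exists d; split; [apply cond_pos|].
    intros w Hw. specialize (Hd w Hw).
    replace (f w - f z - l * (w - z))%C with (f w - f z - (w - z) * l)%C by ring. exact Hd.
Qed.

(* [C_NormedModule] and [AbsRing_NormedModule C_AbsRing] are not convertible; the
   definition of [is_riemann_zeta] uses the former. *)
Lemma is_derive_Cderiv (f : C -> C) (z l : C) :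
  is_derive (K := C_AbsRing) (V := C_NormedModule) f z l -> Cderiv f z l.
Proof.
  intros [_ H] eps He.
  assert (Hz : is_filter_lim (locally (T := AbsRing_UniformSpace C_AbsRing) z) z)
    by (intros P HP; exact HP).
  specialize (H z Hz (mkposreal eps He)).
  destruct H as [d Hd]. exists d; split; [apply cond_pos|].
  intros w Hw. specialize (Hd w Hw).
  replace (f w - f z - l * (w - z))%C with (f w - f z - (w - z) * l)%C by ring.
  exact Hd.
Qed.

Lemma ex_derive_Cderiv (f : C -> C) (z : C) :
  ex_derive (K := C_AbsRing) (V := C_NormedModule) f z -> exists l, Cderiv f z l.
Proof. intros [l H]; exists l; apply is_derive_Cderiv; exact H. Qed.

Lemma Cderiv_ext_loc (f g : C -> C) (z l : C) (r : R) : 0 < r ->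
  (forall w, Cmod (w - z)%C < r -> f w = g w) -> Cderiv f z l -> Cderiv g z l.
Proof.
  intros Hr E H eps He. destruct (H eps He) as [d [Hd H1]].
  exists (Rmin d r); split; [apply Rmin_pos; auto|].
  intros w Hw.
  assert (Cmod (w - z)%C < d) by (eapply Rlt_le_trans; [exact Hw|apply Rmin_l]).
  assert (Cmod (w - z)%C < r) by (eapply Rlt_le_trans; [exact Hw|apply Rmin_r]).
  rewrite <- E by auto. rewrite <- (E z).
  - apply H1; auto.
  - replace (z - z)%C with (RtoC 0) by ring. rewrite Cmod_0; auto.
Qed.

Lemma Cderiv_ext (f g : C -> C) (z l : C) :
  (forall w, f w = g w) -> Cderiv f z l -> Cderiv g z l.
Proof. intros E; apply (Cderiv_ext_loc f g z l 1); auto; lra. Qed.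

Lemma Cderiv_eq (f : C -> C) (z l l' : C) : Cderiv f z l -> l = l' -> Cderiv f z l'.
Proof. intros; subst; auto. Qed.

Lemma Cderiv_lip (f : C -> C) (z l : C) : Cderiv f z l ->
  exists d, 0 < d /\ forall w, Cmod (w - z)%C < d ->
    Cmod (f w - f z)%C <= (Cmod l + 1) * Cmod (w - z)%C.
Proof.
  intros H. destruct (H 1 Rlt_0_1) as [d [Hd H1]]. exists d; split; auto.
  intros w Hw. specialize (H1 w Hw).
  replace (f w - f z)%C with ((f w - f z - l * (w - z)) + l * (w - z))%C by ring.
  eapply Rle_trans; [apply Cmod_triangle|]. rewrite Cmod_mult. lra.
Qed.

Definition Ccont (f : C -> C) (z : C) := forall eps, 0 < eps -> exists d, 0 < d /\
  forall w, Cmod (w - z)%C < d -> Cmod (f w - f z)%C < eps.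

Lemma Cderiv_cont (f : C -> C) (z l : C) : Cderiv f z l -> Ccont f z.
Proof.
  intros H eps He. destruct (Cderiv_lip f z l H) as [d [Hd H1]].
  assert (0 < Cmod l + 1) by (assert (G := Cmod_ge_0 l); lra).
  exists (Rmin d (eps / (Cmod l + 1))); split.
  - apply Rmin_pos; auto. apply Rdiv_lt_0_compat; auto.
  - intros w Hw.
    assert (Cmod (w - z)%C < d) by (eapply Rlt_le_trans; [exact Hw|apply Rmin_l]).
    assert (Cmod (w - z)%C < eps / (Cmod l + 1))
      by (eapply Rlt_le_trans; [exact Hw|apply Rmin_r]).
    eapply Rle_lt_trans; [apply H1; auto|].
    apply Rlt_le_trans with ((Cmod l + 1) * (eps / (Cmod l + 1))).
    + apply Rmult_lt_compat_l; auto.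
    + right; field; lra.
Qed.

Lemma Cderiv_const (c z : C) : Cderiv (fun _ => c) z 0.
Proof.
  apply Cderiv_is_derive, (is_derive_const (K := C_AbsRing) (V := AbsRing_NormedModule C_AbsRing)).
Qed.

Lemma Cderiv_id (z : C) : Cderiv (fun w => w) z 1.
Proof. apply Cderiv_is_derive, (is_derive_id (K := C_AbsRing)). Qed.

Lemma Cderiv_plus (f g : C -> C) (z l m : C) : Cderiv f z l -> Cderiv g z m ->
  Cderiv (fun w => f w + g w)%C z (l + m)%C.
Proof.
  rewrite !Cderiv_is_derive.
  apply (is_derive_plus (K := C_AbsRing) (V := AbsRing_NormedModule C_AbsRing)).
Qed.

Lemma Cderiv_mult (f g : C -> C) (z l m : C) : Cderiv f z l -> Cderiv g z m ->
  Cderiv (fun w => f w * g w)%C z (l * g z + f z * m)%C.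
Proof.
  rewrite !Cderiv_is_derive. intros Hf Hg.
  apply (is_derive_mult (K := C_AbsRing) f g z l m Hf Hg Cmult_comm).
Qed.

Lemma Cderiv_comp (f g : C -> C) (z l m : C) : Cderiv f z l -> Cderiv g (f z) m ->
  Cderiv (fun w => g (f w)) z (m * l)%C.
Proof.
  rewrite !Cderiv_is_derive. intros Hf Hg. rewrite Cmult_comm.
  apply (is_derive_comp (K := C_AbsRing) (V := AbsRing_NormedModule C_AbsRing) g f z m l Hg Hf).
Qed.

Lemma Cderiv_inv0 (z : C) : z <> 0 -> Cderiv (fun w => / w)%C z (- / (z * z))%C.
Proof.
  intros Hz eps He. assert (P : 0 < Cmod z) by (apply Cmod_gt_0; auto).
  (* The remainder is (w - z)^2 / (z^2 w), and |w| >= |z| / 2 on this disc; hence the cube. *)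
  set (d := Rmin (Cmod z / 2) (eps * (Cmod z ^ 3) / 2)).
  assert (Hd : 0 < d).
  { apply Rmin_pos; [lra|]. apply Rdiv_lt_0_compat; [|lra].
    apply Rmult_lt_0_compat; auto. apply pow_lt; auto. }
  exists d; split; auto. intros w Hw.
  assert (W1 := Rlt_le_trans _ _ _ Hw (Rmin_l _ _)).
  assert (W2 := Rlt_le_trans _ _ _ Hw (Rmin_r _ _)).
  assert (Mw : Cmod z / 2 <= Cmod w).
  { assert (X := Cmod_triangle (z - w)%C w).
    replace (z - w + w)%C with z in X by ring. rewrite Cmod_minus_sym in X. lra. }
  assert (Hw0 : w <> 0) by (apply Cmod_neq0; lra).
  replace (/ w - / z - - / (z * z) * (w - z))%C
    with ((w - z) * ((w - z) / (z * z * w)))%C by (field; auto).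
  assert (Hzz : (z * z * w)%C <> 0) by (repeat apply Cmult_neq_0; auto).
  rewrite Cmod_mult, Cmod_div, !Cmod_mult by auto.
  rewrite Rmult_comm. apply Rmult_le_compat_r; [apply Cmod_ge_0|].
  apply Rmult_le_reg_r with (Cmod z * Cmod z * Cmod w).
  { repeat apply Rmult_lt_0_compat; auto; lra. }
  unfold Rdiv. rewrite Rmult_assoc, Rinv_l, Rmult_1_r.
  2:{ apply Rgt_not_eq. repeat apply Rmult_lt_0_compat; auto; lra. }
  eapply Rle_trans; [left; exact W2|].
  apply Rle_trans with (eps * (Cmod z * Cmod z * (Cmod z / 2))); [right; field|].
  apply Rmult_le_compat_l; [lra|]. apply Rmult_le_compat_l; auto. nra.
Qed.

Lemma Cderiv_inv (f : C -> C) (z l : C) : f z <> 0 -> Cderiv f z l ->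
  Cderiv (fun w => / f w)%C z (- / (f z * f z) * l)%C.
Proof. intros Hz H. apply (Cderiv_comp f (fun w => / w)%C); auto. apply Cderiv_inv0; auto. Qed.

Lemma Cderiv_scal (c : C) (f : C -> C) (z l : C) : Cderiv f z l ->
  Cderiv (fun w => c * f w)%C z (c * l)%C.
Proof.
  intros H. eapply Cderiv_eq; [apply Cderiv_mult; [apply Cderiv_const|exact H]|].
  simpl; ring.
Qed.

Lemma Cderiv_minus (f g : C -> C) (z l m : C) : Cderiv f z l -> Cderiv g z m ->
  Cderiv (fun w => f w - g w)%C z (l - m)%C.
Proof.
  intros Hf Hg. apply Cderiv_ext with (fun w => f w + (-(1)) * g w)%C; [intros; ring|].
  eapply Cderiv_eq; [apply Cderiv_plus; [exact Hf|apply Cderiv_scal; exact Hg]|]. ring.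
Qed.

Lemma Cderiv_div (f g : C -> C) (z l m : C) : g z <> 0 -> Cderiv f z l -> Cderiv g z m ->
  Cderiv (fun w => f w / g w)%C z ((l * g z - f z * m) / (g z * g z))%C.
Proof.
  intros H0 Hf Hg. eapply Cderiv_eq.
  - apply (Cderiv_mult f (fun w => / g w)%C); [exact Hf|apply Cderiv_inv; [auto|exact Hg]].
  - field; auto.
Qed.

Lemma Cderiv_shift (f : C -> C) (a z l : C) : Cderiv f (a + z)%C l ->
  Cderiv (fun w => f (a + w)%C) z l.
Proof.
  intros H. eapply Cderiv_eq.
  - apply (Cderiv_comp (fun w => a + w)%C f z 1 l); [|exact H].
    eapply Cderiv_eq; [apply Cderiv_plus; [apply Cderiv_const|apply Cderiv_id]|ring].
  - ring.
Qed.

Lemma Cderiv_pow (n : nat) (f : C -> C) (z l : C) : Cderiv f z l ->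
  Cderiv (fun w => f w ^ n)%C z (INR n * (f z ^ (pred n)) * l)%C.
Proof.
  intros H. induction n as [|n IH].
  - simpl. eapply Cderiv_eq; [apply Cderiv_const|]. rewrite Cmult_0_l. ring.
  - eapply Cderiv_ext; [intros w; symmetry; apply Cpow_S|].
    eapply Cderiv_eq; [apply Cderiv_mult; [exact H|exact IH]|].
    simpl pred. destruct n as [|n].
    + simpl. ring.
    + simpl pred. rewrite (S_INR (S n)), RtoC_plus. rewrite !Cpow_S. ring.
Qed.

(** * The complex exponential *)

Lemma Cmod_Cexp (z : C) : Cmod (Cexp z) = exp (Re z).
Proof.
  unfold Cmod, Cexp; simpl.
  replace (exp (Re z) * cos (Im z) * (exp (Re z) * cos (Im z) * 1) +
           exp (Re z) * sin (Im z) * (exp (Re z) * sin (Im z) * 1))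
    with ((exp (Re z)) * exp (Re z) * (Rsqr (sin (Im z)) + Rsqr (cos (Im z))))
    by (unfold Rsqr; ring).
  rewrite sin2_cos2, Rmult_1_r. apply sqrt_square. left; apply exp_pos.
Qed.

Lemma Cexp_plus (a b : C) : Cexp (a + b)%C = (Cexp a * Cexp b)%C.
Proof.
  apply C_eq; unfold Cexp, Cmult; rewrite Re_plus, Im_plus, exp_plus; simpl;
    rewrite ?cos_plus, ?sin_plus; ring.
Qed.

Lemma Cexp_0 : Cexp 0 = 1.
Proof. apply C_eq; unfold Cexp; simpl; rewrite exp_0, ?cos_0, ?sin_0; ring. Qed.

Lemma Cexp_neq0 (z : C) : Cexp z <> 0.
Proof. apply Cmod_neq0. rewrite Cmod_Cexp. apply exp_pos. Qed.

Lemma Cexp_opp (a : C) : Cexp (- a)%C = (/ Cexp a)%C.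
Proof.
  assert (H : (Cexp (- a) * Cexp a)%C = 1).
  { rewrite <- Cexp_plus. replace (- a + a)%C with (RtoC 0) by ring. apply Cexp_0. }
  assert (X := Cexp_neq0 a).
  replace (/ Cexp a)%C with (Cexp (- a) * Cexp a * / Cexp a)%C
    by (rewrite H; ring). field; auto.
Qed.

Lemma Cexp_minus (a b : C) : Cexp (a - b)%C = (Cexp a / Cexp b)%C.
Proof. unfold Cminus. rewrite Cexp_plus, Cexp_opp. reflexivity. Qed.

Lemma Cexp_RtoC (x : R) : Cexp (RtoC x) = RtoC (exp x).
Proof. apply C_eq; unfold Cexp; simpl; rewrite ?cos_0, ?sin_0; ring. Qed.

Lemma exp_quad (x : R) : Rabs x <= 1 / 2 -> 0 <= exp x - 1 - x <= 2 * x ^ 2.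
Proof.
  intros H. apply Rabs_le_between in H.
  assert (H1 := exp_ineq1_le x). assert (H2 := exp_ineq1_le (- x)).
  assert (E : exp x * exp (- x) = 1) by (rewrite <- exp_plus, Rplus_opp_r; apply exp_0).
  assert (P := exp_pos x). assert (P2 := exp_pos (- x)). split; [lra|].
  (* From [exp (- x) >= 1 - x]; then 1 / (1 - x) <= 1 + x + 2 x^2 because x <= 1/2. *)
  assert (exp x * (1 - x) <= 1) by nra. nra.
Qed.

Lemma exp_minus_1 (x : R) : Rabs x <= 1 / 2 -> Rabs (exp x - 1) <= 2 * Rabs x.
Proof.
  intros H. assert (Q := exp_quad x H).
  assert (H0 := Rabs_pos x). rewrite <- pow2_abs in Q.
  replace (exp x - 1) with ((exp x - 1 - x) + x) by ring.
  eapply Rle_trans; [apply Rabs_triang|]. rewrite Rabs_pos_eq by lra. nra.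
Qed.

Lemma cos_quad (y : R) : 0 <= 1 - cos y <= y ^ 2 / 2.
Proof.
  assert (H := COS_bound y). split; [lra|].
  assert (E : 1 - cos y = 2 * (sin (y / 2)) ^ 2).
  { replace y with (2 * (y / 2)) at 1 by field. rewrite cos_2a_sin. ring. }
  rewrite E. assert (S : Rabs (sin (y / 2)) <= Rabs (y / 2)).
  { destruct (MVT_gen sin 0 (y / 2) cos) as [c [_ Hc]].
    - intros; auto_derive; auto; ring.
    - intros; apply continuity_sin.
    - rewrite sin_0, !Rminus_0_r in Hc. rewrite Hc, Rabs_mult.
      assert (B := COS_bound c). assert (Rabs (cos c) <= 1) by (apply Rabs_le; lra).
      assert (P := Rabs_pos (y / 2)). nra. }
  assert (P := Rabs_pos (sin (y / 2))).
  rewrite <- (pow2_abs (sin (y / 2))).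
  assert (E2 : y ^ 2 / 2 = 2 * (Rabs (y / 2)) ^ 2) by (rewrite pow2_abs; field).
  rewrite E2. apply Rmult_le_compat_l; [lra|]. apply pow_incr; lra.
Qed.

Lemma sin_cubic (y : R) : Rabs (sin y - y) <= Rabs y * y ^ 2 / 2.
Proof.
  destruct (MVT_gen (fun x => sin x - x) 0 y (fun x => cos x - 1)) as [c [Hc E]].
  - intros; auto_derive; auto; ring.
  - intros x _. apply (continuity_pt_minus sin id); [apply continuity_sin|apply derivable_continuous_pt, derivable_pt_id].
  - rewrite sin_0, !Rminus_0_r in E. rewrite E, Rabs_mult.
    assert (Q := cos_quad c).
    rewrite (Rabs_left1 (cos c - 1)) by lra.
    assert (C : c ^ 2 <= y ^ 2).
    { rewrite <- (pow2_abs c), <- (pow2_abs y). apply pow_incr. split; [apply Rabs_pos|].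
      revert Hc. unfold Rmin, Rmax. destruct (Rle_dec 0 y); intros [? ?].
      - rewrite !Rabs_pos_eq; lra.
      - rewrite !Rabs_left1; lra. }
    assert (P := Rabs_pos y). nra.
Qed.

(** This quadratic remainder is the estimate behind both the complex differentiability of [Cexp] and
    its injectivity near 0. *)
Lemma Cexp_quad (w : C) : Cmod w <= 1 / 2 -> Cmod (Cexp w - 1 - w)%C <= 4 * Cmod w ^ 2.
Proof.
  intros H. destruct w as [x y].
  assert (Hx := re_le_Cmod (x, y)). assert (Hy := im_le_Cmod (x, y)).
  rewrite Cmod2_alt. unfold Re, Im in *; simpl fst in *; simpl snd in *.
  eapply Rle_trans; [apply Cmod_le_ReIm|].
  assert (E1 : Re (Cexp (x, y) - 1 - (x, y))%C = (exp x - 1 - x) - exp x * (1 - cos y))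
    by (unfold Cexp, Re, Im; simpl; ring).
  assert (E2 : Im (Cexp (x, y) - 1 - (x, y))%C = (exp x - 1) * sin y + (sin y - y))
    by (unfold Cexp, Re, Im; simpl; ring).
  rewrite E1, E2. change (Re (x, y)) with x. change (Im (x, y)) with y.
  assert (Qx := exp_quad x ltac:(lra)). assert (Qc := cos_quad y). assert (Qs := sin_cubic y).
  assert (Q1 := exp_minus_1 x ltac:(lra)). assert (P := exp_pos x).
  assert (Bx : exp x <= 2).
  { apply Rabs_le_between in Q1. assert (Rabs x <= 1/2) by lra. lra. }
  assert (Hs : Rabs (sin y) <= Rabs y + Rabs y * y ^ 2 / 2).
  { replace (sin y) with ((sin y - y) + y) by ring.
    eapply Rle_trans; [apply Rabs_triang|lra]. }
  assert (R1 : Rabs (exp x - 1 - x - exp x * (1 - cos y)) <= 2 * x ^ 2 + y ^ 2).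
  { apply Rabs_le. nra. }
  assert (Px := Rabs_pos x). assert (Py := Rabs_pos y).
  rewrite <- (pow2_abs x) in R1 |- *. rewrite <- (pow2_abs y) in *.
  set (a := Rabs x) in *. set (b := Rabs y) in *.
  assert (Hb0 : b <= 1 / 2) by lra. assert (Sb0 := pow2_ge_0 b).
  assert (b * b ^ 2 / 2 <= b ^ 2 / 4) by nra.
  assert (R2 : Rabs ((exp x - 1) * sin y + (sin y - y)) <= 2 * a * (b + b ^ 2 / 4) + b ^ 2 / 4).
  { eapply Rle_trans; [apply Rabs_triang|]. rewrite Rabs_mult.
    apply Rplus_le_compat; [|lra]. apply Rmult_le_compat; auto using Rabs_pos. lra. }
  assert (Ha : a <= 1 / 2) by lra. assert (Hb : b <= 1 / 2) by lra.
  assert (Sb := pow2_ge_0 b). assert (a * b ^ 2 <= b ^ 2 / 2) by nra.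
  assert (Sab := pow2_ge_0 (a - b)). assert (Sa := pow2_ge_0 a).
  assert (2 * a * (b + b ^ 2 / 4) <= a ^ 2 + b ^ 2 + b ^ 2 / 4) by lra.
  lra.
Qed.

Lemma Cexp_minus_1 (w : C) : Cmod w <= 1 / 2 -> Cmod (Cexp w - 1)%C <= 3 * Cmod w.
Proof.
  intros H. assert (Q := Cexp_quad w H). assert (P := Cmod_ge_0 w).
  replace (Cexp w - 1)%C with ((Cexp w - 1 - w) + w)%C by ring.
  eapply Rle_trans; [apply Cmod_triangle|]. nra.
Qed.

Lemma Cderiv_Cexp (z : C) : Cderiv Cexp z (Cexp z).
Proof.
  intros eps He. assert (P : 0 < Cmod (Cexp z)) by (rewrite Cmod_Cexp; apply exp_pos).
  exists (Rmin (1 / 2) (eps / (4 * Cmod (Cexp z)))); split.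
  { apply Rmin_pos; [lra|apply Rdiv_lt_0_compat; lra]. }
  intros w Hw.
  assert (W1 := Rlt_le_trans _ _ _ Hw (Rmin_l _ _)).
  assert (W2 := Rlt_le_trans _ _ _ Hw (Rmin_r _ _)).
  replace (Cexp w) with (Cexp z * Cexp (w - z))%C
    by (rewrite <- Cexp_plus; f_equal; ring).
  replace (Cexp z * Cexp (w - z) - Cexp z - Cexp z * (w - z))%C
    with (Cexp z * (Cexp (w - z) - 1 - (w - z)))%C by ring.
  rewrite Cmod_mult. assert (Q := Cexp_quad (w - z)%C ltac:(lra)).
  assert (H0 := Cmod_ge_0 (w - z)%C). set (h := Cmod (w - z)%C) in *.
  apply Rle_trans with (Cmod (Cexp z) * (4 * h ^ 2)).
  - apply Rmult_le_compat_l; lra.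
  - replace (Cmod (Cexp z) * (4 * h ^ 2)) with ((4 * Cmod (Cexp z) * h) * h) by ring.
    apply Rmult_le_compat_r; auto.
    apply Rle_trans with (4 * Cmod (Cexp z) * (eps / (4 * Cmod (Cexp z)))).
    + apply Rmult_le_compat_l; lra.
    + right; field; lra.
Qed.

Lemma Cderiv_exp_comp (f : C -> C) (z l : C) : Cderiv f z l ->
  Cderiv (fun w => Cexp (f w)) z (Cexp (f z) * l)%C.
Proof. intros H; apply (Cderiv_comp f Cexp); auto. apply Cderiv_Cexp. Qed.

(** The quadratic remainder gives |z| <= 4 |z|^2, so a nonzero solution has modulus at least 1/4.
    Hence a continuous function with exponential 1 that vanishes at a point vanishes nearby. *)
Lemma Cexp_inj_small (z : C) : Cmod z <= 1 / 5 -> Cexp z = 1 -> z = 0.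
Proof.
  intros H E. assert (Q := Cexp_quad z ltac:(lra)). rewrite E in Q.
  replace (1 - 1 - z)%C with (- z)%C in Q by ring. rewrite Cmod_opp in Q.
  assert (P := Cmod_ge_0 z). apply Cmod_eq_0. nra.
Qed.

(** * Series of complex numbers and power series *)

Fixpoint csum (a : nat -> C) (n : nat) : C :=
  match n with O => 0 | S k => (csum a k + a k)%C end.

Fixpoint rsum (a : nat -> R) (n : nat) : R :=
  match n with O => 0 | S k => rsum a k + a k end.

Definition Cser (a : nat -> C) (l : C) := forall eps, 0 < eps ->
  exists N, forall n, (N <= n)%nat -> Cmod (csum a n - l)%C < eps.

Lemma csum_ext (a b : nat -> C) n : (forall k, (k < n)%nat -> a k = b k) -> csum a n = csum b n.
Proof. induction n; simpl; intros H; auto. rewrite IHn, H; auto. Qed.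

Lemma csum_zero (a : nat -> C) n : (forall k, (k < n)%nat -> a k = 0) -> csum a n = 0.
Proof. induction n; simpl; intros H; auto. rewrite IHn, H by auto. ring. Qed.

Lemma csum_plus a b n : csum (fun k => a k + b k)%C n = (csum a n + csum b n)%C.
Proof. induction n; simpl; [|rewrite IHn]; ring. Qed.

Lemma csum_minus a b n : csum (fun k => a k - b k)%C n = (csum a n - csum b n)%C.
Proof. induction n; simpl; [|rewrite IHn]; ring. Qed.

Lemma csum_scal c a n : csum (fun k => c * a k)%C n = (c * csum a n)%C.
Proof. induction n; simpl; [|rewrite IHn]; ring. Qed.

Lemma csum_shift a n : csum a (S n) = (a O + csum (fun k => a (S k)) n)%C.
Proof. induction n; simpl in *; [ring|]. rewrite IHn. ring. Qed.

Lemma csum_add a n m : csum a (n + m) = (csum a n + csum (fun k => a (n + k)%nat) m)%C.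
Proof.
  induction m; simpl; [rewrite Nat.add_0_r; ring|].
  rewrite Nat.add_succ_r; simpl. rewrite IHm; ring.
Qed.

Lemma rsum_le a b n : (forall k, (k < n)%nat -> a k <= b k) -> rsum a n <= rsum b n.
Proof.
  induction n; simpl; intros H; [lra|]. apply Rplus_le_compat; auto.
Qed.

Lemma rsum_scal c a n : rsum (fun k => c * a k) n = c * rsum a n.
Proof. induction n; simpl; [|rewrite IHn]; ring. Qed.

Lemma rsum_plus a b n : rsum (fun k => a k + b k) n = rsum a n + rsum b n.
Proof. induction n; simpl; [|rewrite IHn]; ring. Qed.

Lemma rsum_const c n : rsum (fun _ => c) n = INR n * c.
Proof. induction n; [simpl; ring|]. rewrite S_INR; simpl rsum. rewrite IHn; ring. Qed.

Lemma rsum_add a n m : rsum a (n + m) = rsum a n + rsum (fun k => a (n + k)%nat) m.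
Proof.
  induction m; simpl; [rewrite Nat.add_0_r; ring|].
  rewrite Nat.add_succ_r; simpl. rewrite IHm; ring.
Qed.

Lemma rsum_mono a n m : (forall k, 0 <= a k) -> (n <= m)%nat -> rsum a n <= rsum a m.
Proof.
  intros H L. induction L; [lra|]. simpl. specialize (H m). lra.
Qed.

Lemma Cmod_csum a n : Cmod (csum a n) <= rsum (fun k => Cmod (a k)) n.
Proof.
  induction n; simpl; [rewrite Cmod_0; lra|].
  eapply Rle_trans; [apply Cmod_triangle|]. lra.
Qed.

Lemma csum_diff_le a b n m : (forall k, Cmod (a k) <= b k) -> (n <= m)%nat ->
  Cmod (csum a m - csum a n)%C <= rsum b m - rsum b n.
Proof.
  intros H L. induction L.
  - replace (csum a n - csum a n)%C with (RtoC 0) by ring. rewrite Cmod_0; lra.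
  - simpl. replace (csum a m + a m - csum a n)%C with ((csum a m - csum a n) + a m)%C by ring.
    eapply Rle_trans; [apply Cmod_triangle|]. specialize (H m). lra.
Qed.

Lemma Cser_unique a l l' : Cser a l -> Cser a l' -> l = l'.
Proof.
  intros H H'. destruct (classic (l = l')) as [|N]; auto. exfalso.
  assert (P : 0 < Cmod (l - l')%C) by (apply Cmod_gt_0, Cminus_neq0; auto).
  destruct (H (Cmod (l - l')%C / 2)) as [n1 H1]; [lra|].
  destruct (H' (Cmod (l - l')%C / 2)) as [n2 H2]; [lra|].
  specialize (H1 (n1 + n2)%nat ltac:(lia)). specialize (H2 (n1 + n2)%nat ltac:(lia)).
  assert (T := Cmod_dist_triangle l (csum a (n1 + n2)) l').
  rewrite (Cmod_minus_sym l (csum a _)) in T. lra.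
Qed.

Lemma Cser_ext a b l : (forall n, a n = b n) -> Cser a l -> Cser b l.
Proof.
  intros E H eps He. destruct (H eps He) as [N HN]. exists N; intros n Hn.
  rewrite <- (csum_ext a b) by auto. auto.
Qed.

Lemma Cser_zero (a : nat -> C) : (forall n, a n = 0) -> Cser a 0.
Proof.
  intros H eps He. exists O. intros n _. rewrite csum_zero by auto.
  replace (0 - 0)%C with (RtoC 0) by ring. rewrite Cmod_0; auto.
Qed.

Lemma Cser_eq a l l' : Cser a l -> l = l' -> Cser a l'.
Proof. intros; subst; auto. Qed.

Lemma Cser_plus a b l m : Cser a l -> Cser b m -> Cser (fun n => a n + b n)%C (l + m)%C.
Proof.
  intros H1 H2 eps He.
  destruct (H1 (eps / 2)) as [n1 N1]; [lra|]. destruct (H2 (eps / 2)) as [n2 N2]; [lra|].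
  exists (n1 + n2)%nat; intros n Hn. rewrite csum_plus.
  replace (csum a n + csum b n - (l + m))%C with ((csum a n - l) + (csum b n - m))%C by ring.
  eapply Rle_lt_trans; [apply Cmod_triangle|].
  specialize (N1 n ltac:(lia)). specialize (N2 n ltac:(lia)). lra.
Qed.

Lemma Cser_scal c a l : Cser a l -> Cser (fun n => c * a n)%C (c * l)%C.
Proof.
  intros H eps He. assert (P := Cmod_ge_0 c).
  destruct (H (eps / (Cmod c + 1))) as [N HN]; [apply Rdiv_lt_0_compat; lra|].
  exists N; intros n Hn. rewrite csum_scal.
  replace (c * csum a n - c * l)%C with (c * (csum a n - l))%C by ring.
  rewrite Cmod_mult. specialize (HN n Hn). assert (Q := Cmod_ge_0 (csum a n - l)%C).
  apply Rle_lt_trans with ((Cmod c + 1) * Cmod (csum a n - l)%C); [nra|].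
  apply Rlt_le_trans with ((Cmod c + 1) * (eps / (Cmod c + 1))).
  - apply Rmult_lt_compat_l; lra.
  - right; field; lra.
Qed.

Lemma Cser_minus a b l m : Cser a l -> Cser b m -> Cser (fun n => a n - b n)%C (l - m)%C.
Proof.
  intros H1 H2. apply Cser_ext with (fun n => a n + (-(1)) * b n)%C; [intros; ring|].
  eapply Cser_eq; [apply Cser_plus; [exact H1|apply Cser_scal; exact H2]|ring].
Qed.

Lemma Cser_shift a l : Cser a l -> Cser (fun n => a (S n)) (l - a O)%C.
Proof.
  intros H eps He. destruct (H eps He) as [N HN]. exists N; intros n Hn.
  specialize (HN (S n) ltac:(lia)). rewrite csum_shift in HN.
  replace (csum (fun k => a (S k)) n - (l - a O))%C
    with (a O + csum (fun k => a (S k)) n - l)%C by ring. exact HN.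
Qed.

Lemma Cser_unshift a l : Cser (fun n => a (S n)) l -> Cser a (l + a O)%C.
Proof.
  intros H eps He. destruct (H eps He) as [N HN]. exists (S N); intros n Hn.
  destruct n as [|n]; [lia|]. specialize (HN n ltac:(lia)). rewrite csum_shift.
  replace (a O + csum (fun k => a (S k)) n - (l + a O))%C
    with (csum (fun k => a (S k)) n - l)%C by ring. exact HN.
Qed.

Lemma Cser_le a l z B : Cser a l -> (forall n, Cmod (csum a n - z)%C <= B) -> Cmod (l - z)%C <= B.
Proof.
  intros H HB. apply le_epsilon. intros eps He. destruct (H eps He) as [N HN].
  specialize (HN N ltac:(lia)). specialize (HB N).
  assert (T := Cmod_dist_triangle l (csum a N) z). rewrite (Cmod_minus_sym l (csum _ _)) in T. lra.
Qed.

Lemma Cser_le_tail a l z B N : Cser a l ->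
  (forall n, (N <= n)%nat -> Cmod (csum a n - z)%C <= B) -> Cmod (l - z)%C <= B.
Proof.
  intros H HB. apply le_epsilon. intros eps He. destruct (H eps He) as [M HM].
  specialize (HM (M + N)%nat ltac:(lia)). specialize (HB (M + N)%nat ltac:(lia)).
  assert (T := Cmod_dist_triangle l (csum a (M + N)) z). rewrite (Cmod_minus_sym l (csum _ _)) in T. lra.
Qed.

Lemma Cser_norm_le a l B : Cser a l -> (forall n, Cmod (csum a n) <= B) -> Cmod l <= B.
Proof.
  intros H HB. replace l with (l - 0)%C by ring. apply (Cser_le a); auto.
  intros n. replace (csum a n - 0)%C with (csum a n) by ring. auto.
Qed.

Lemma C_complete (u : nat -> C) :
  (forall eps, 0 < eps -> exists N, forall n m, (N <= n)%nat -> (N <= m)%nat ->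
     Cmod (u n - u m)%C < eps) ->
  exists l, forall eps, 0 < eps -> exists N, forall n, (N <= n)%nat -> Cmod (u n - l)%C < eps.
Proof.
  intros H.
  assert (HR : Cauchy_crit (fun n => Re (u n))).
  { intros eps He. destruct (H eps He) as [N HN]. exists N. intros n m Hn Hm.
    unfold Rdist. rewrite <- Re_minus. eapply Rle_lt_trans; [apply re_le_Cmod|]. apply HN; lia. }
  assert (HI : Cauchy_crit (fun n => Im (u n))).
  { intros eps He. destruct (H eps He) as [N HN]. exists N. intros n m Hn Hm.
    unfold Rdist. rewrite <- Im_minus. eapply Rle_lt_trans; [apply im_le_Cmod|]. apply HN; lia. }
  destruct (Rcomplete.R_complete _ HR) as [x Hx]. destruct (Rcomplete.R_complete _ HI) as [y Hy].
  exists (x, y). intros eps He.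
  destruct (Hx (eps / 2)) as [n1 N1]; [lra|]. destruct (Hy (eps / 2)) as [n2 N2]; [lra|].
  exists (n1 + n2)%nat. intros n Hn.
  specialize (N1 n ltac:(lia)). specialize (N2 n ltac:(lia)). unfold Rdist in *.
  eapply Rle_lt_trans; [apply Cmod_le_ReIm|].
  rewrite Re_minus, Im_minus. change (Re (x, y)) with x. change (Im (x, y)) with y. lra.
Qed.

Lemma rsum_bounded_cauchy b B : (forall n, 0 <= b n) -> (forall n, rsum b n <= B) ->
  forall eps, 0 < eps -> exists N, forall n m, (N <= n)%nat -> (N <= m)%nat ->
     Rabs (rsum b n - rsum b m) < eps.
Proof.
  intros Hb HB.
  assert (G : Un_growing (rsum b)) by (intros n; simpl; specialize (Hb n); lra).
  assert (U : has_ub (rsum b)) by (exists B; intros x [n ->]; auto).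
  destruct (growing_cv _ G U) as [l Hl].
  intros eps He. destruct (Hl (eps / 2)) as [N HN]; [lra|]. exists N. intros n m Hn Hm.
  assert (H1 := HN n Hn). assert (H2 := HN m Hm). unfold Rdist in *.
  replace (rsum b n - rsum b m) with ((rsum b n - l) - (rsum b m - l)) by ring.
  eapply Rle_lt_trans; [apply Rabs_triang|]. rewrite Rabs_Ropp. lra.
Qed.

(** The Weierstrass majorant test. [B] may be any bound of the partial sums of the majorant, so the
    exact sum of the majorant need not be known. *)
Lemma Cser_dom (a : nat -> C) (b : nat -> R) B :
  (forall n, Cmod (a n) <= b n) -> (forall n, rsum b n <= B) ->
  exists l, Cser a l /\ forall n, Cmod (l - csum a n)%C <= B - rsum b n.
Proof.
  intros Ha HB.
  assert (Hb : forall n, 0 <= b n) by (intros n; eapply Rle_trans; [apply Cmod_ge_0|apply Ha]).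
  destruct (C_complete (csum a)) as [l Hl].
  { intros eps He. destruct (rsum_bounded_cauchy b B Hb HB eps He) as [N HN].
    exists N. assert (K : forall n m, (N <= n)%nat -> (n <= m)%nat ->
      Cmod (csum a m - csum a n)%C < eps).
    { intros n m Hn Hm. eapply Rle_lt_trans; [apply (csum_diff_le a b); auto|].
      eapply Rle_lt_trans; [apply Rle_abs|]. apply HN; lia. }
    intros n m Hn Hm. destruct (Nat.le_ge_cases n m).
    - rewrite Cmod_minus_sym. apply K; auto.
    - apply K; auto. }
  exists l. split; [exact Hl|]. intros n. apply (Cser_le_tail a l _ _ n); [exact Hl|].
  intros m Hm. eapply Rle_trans; [apply (csum_diff_le a b); auto|]. specialize (HB m); lra.
Qed.

(** A value by choice, meaningful only when the series converges; it is then the sum by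
    [Cser_unique]. *)
Definition Csum (a : nat -> C) : C := epsilon (inhabits (RtoC 0)) (Cser a).

Lemma Csum_correct a l : Cser a l -> Cser a (Csum a).
Proof. intros H. unfold Csum. apply epsilon_spec. exists l; auto. Qed.

Lemma Csum_eq a l : Cser a l -> Csum a = l.
Proof. intros H. apply (Cser_unique a); auto. apply (Csum_correct a l); auto. Qed.

Lemma rsum_geom q n : 0 <= q < 1 -> rsum (fun k => q ^ k) n <= / (1 - q).
Proof.
  intros H. assert (E : rsum (fun k => q ^ k) n = (1 - q ^ n) / (1 - q)).
  { induction n; simpl; [|rewrite IHn]; field; lra. }
  rewrite E. assert (P : 0 <= q ^ n) by (apply pow_le; lra).
  unfold Rdiv. rewrite <- (Rmult_1_l (/ (1 - q))) at 2.
  apply Rmult_le_compat_r; [|lra]. left; apply Rinv_0_lt_compat; lra.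
Qed.

Lemma Cser_bounded_terms a l : Cser a l -> exists M, 0 < M /\ forall n, Cmod (a n) <= M.
Proof.
  intros H. destruct (H 1 Rlt_0_1) as [N HN].
  assert (K : forall N0, exists M, 0 < M /\ forall n, (n < N0)%nat -> Cmod (a n) <= M).
  { induction N0 as [|k [M [HM IH]]]; [exists 1; split; [lra|intros; lia]|].
    exists (M + Cmod (a k)). assert (P := Cmod_ge_0 (a k)). split; [lra|].
    intros n Hn. destruct (Nat.eq_dec n k) as [->|]; [lra|].
    specialize (IH n ltac:(lia)). lra. }
  destruct (K N) as [M [HM HK]]. exists (M + 2). split; [lra|]. intros n.
  destruct (Nat.lt_ge_cases n N) as [L|L]; [specialize (HK n L); lra|].
  replace (a n) with ((csum a (S n) - l) - (csum a n - l))%C by (simpl; ring).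
  eapply Rle_trans; [apply Cmod_triangle_minus|].
  assert (H1 := HN n L). assert (H2 := HN (S n) ltac:(lia)). lra.
Qed.

Definition PS (a : nat -> C) (z l : C) := Cser (fun n => a n * z ^ n)%C l.

Definition PSf (a : nat -> C) (z : C) : C := Csum (fun n => a n * z ^ n)%C.

Lemma PS_term_le a z rho M n : 0 < rho -> Cmod (a n) * rho ^ n <= M ->
  Cmod (a n * z ^ n)%C <= M * (Cmod z / rho) ^ n.
Proof.
  intros Hr H. rewrite Cmod_mult, Cmod_pow.
  assert (P : 0 < rho ^ n) by (apply pow_lt; auto).
  unfold Rdiv. rewrite Rpow_mult_distr, pow_inv.
  apply Rle_trans with ((Cmod (a n) * rho ^ n) * (Cmod z ^ n * / rho ^ n)).
  - right; field; lra.
  - apply Rmult_le_compat_r; auto. apply Rmult_le_pos; [apply pow_le, Cmod_ge_0|].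
    left; apply Rinv_0_lt_compat; auto.
Qed.

Lemma PS_conv a z rho M : 0 < rho -> (forall n, Cmod (a n) * rho ^ n <= M) -> Cmod z < rho ->
  exists l, PS a z l /\
    forall n, Cmod (l - csum (fun k => a k * z ^ k)%C n)%C
              <= M / (1 - Cmod z / rho) - M * rsum (fun k => (Cmod z / rho) ^ k) n.
Proof.
  intros Hr H Hz.
  assert (Q : 0 <= Cmod z / rho < 1).
  { assert (P := Cmod_ge_0 z). apply ratio_bounds; lra. }
  assert (HM : 0 <= M).
  { eapply Rle_trans; [|apply (H O)]. simpl. rewrite Rmult_1_r. apply Cmod_ge_0. }
  destruct (Cser_dom (fun n => a n * z ^ n)%C (fun n => M * (Cmod z / rho) ^ n)
             (M / (1 - Cmod z / rho))) as [l [H1 H2]].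
  - intros n. apply PS_term_le; auto.
  - intros n. rewrite rsum_scal. apply Rmult_le_compat_l; auto. apply rsum_geom; auto.
  - exists l; split; auto. intros n. rewrite <- rsum_scal. apply H2.
Qed.

Lemma PSf_correct a z rho M : 0 < rho -> (forall n, Cmod (a n) * rho ^ n <= M) -> Cmod z < rho ->
  PS a z (PSf a z).
Proof.
  intros Hr H Hz. destruct (PS_conv a z rho M Hr H Hz) as [l [Hl _]].
  apply (Csum_correct _ l); auto.
Qed.

Lemma PS_at_0 a : PS a 0 (a O).
Proof.
  intros eps He. exists 1%nat. intros n Hn.
  replace (csum (fun k => a k * 0 ^ k)%C n - a O)%C with (RtoC 0); [rewrite Cmod_0; auto|].
  destruct n as [|n]; [lia|]. rewrite csum_shift. cbv beta. clear Hn.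
  rewrite csum_zero.
  - simpl. ring.
  - intros k _. rewrite Cpow_S. ring.
Qed.

(** With d = (1 - q) / 4, Bernoulli gives n d <= (1 + d)^n, so n^2 is absorbed into (1 + d)^(2n),
    and (1 + d)^2 (1 - 4 d) stays below 1. *)
Lemma n2_geom q : 0 <= q < 1 -> exists K th, 0 < K /\ 0 <= th < 1 /\
  forall n, INR n ^ 2 * q ^ n <= K * th ^ n.
Proof.
  intros Hq. set (d := (1 - q) / 4).
  assert (Hd : 0 < d <= 1 / 4) by (unfold d; lra).
  assert (Eq : q = 1 - 4 * d) by (unfold d; field).
  exists (/ (d * d)), ((1 + d) * (1 + d) * q). split; [|split].
  - apply Rinv_0_lt_compat; nra.
  - split; [|nra]. apply Rmult_le_pos; nra.
  - intros n. assert (B : INR n * d <= (1 + d) ^ n).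
    { assert (X := poly n d (proj1 Hd)). lra. }
    rewrite !Rpow_mult_distr.
    assert (P : 0 <= q ^ n) by (apply pow_le; lra).
    assert (I := pos_INR n).
    replace (/ (d * d) * ((1 + d) ^ n * (1 + d) ^ n * q ^ n))
      with ((((1 + d) ^ n) * ((1 + d) ^ n)) / (d * d) * q ^ n) by (field; lra).
    apply Rmult_le_compat_r; auto.
    apply Rmult_le_reg_r with (d * d); [nra|]. unfold Rdiv.
    rewrite Rmult_assoc, Rinv_l by nra. rewrite Rmult_1_r.
    replace (INR n ^ 2 * (d * d)) with ((INR n * d) * (INR n * d)) by ring.
    apply Rmult_le_compat; auto; nra.
Qed.

(** The factor [r ^ 2] on the left replaces an exponent n - 2 on the right, which would fail for n =
    0, 1. The induction rests on the fact that the remainder for n + 1 is w times the one for n,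
    plus n z^(n-1) (w - z)^2. *)
Lemma pow_taylor2 (w z : C) (r : R) (n : nat) : Cmod w <= r -> Cmod z <= r ->
  r ^ 2 * Cmod (w ^ n - z ^ n - INR n * z ^ (pred n) * (w - z))%C
  <= INR n ^ 2 * r ^ n * Cmod (w - z)%C ^ 2.
Proof.
  intros Hw Hz. assert (Hr : 0 <= r) by (eapply Rle_trans; [apply Cmod_ge_0|exact Hw]).
  set (h := Cmod (w - z)%C). assert (Hh : 0 <= h) by apply Cmod_ge_0.
  induction n as [|n IH].
  - simpl. replace (1 - 1 - 0 * 1 * (w - z))%C with (RtoC 0) by ring. rewrite Cmod_0. lra.
  - set (E := (w ^ n - z ^ n - INR n * z ^ (pred n) * (w - z))%C) in *.
    replace (w ^ S n - z ^ S n - INR (S n) * z ^ pred (S n) * (w - z))%C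
      with (w * E + INR n * z ^ (pred n) * ((w - z) * (w - z)))%C.
    2:{ unfold E. rewrite S_INR, RtoC_plus. simpl pred. rewrite !Cpow_S.
        destruct n as [|n]; [simpl; ring|]. simpl pred. rewrite !Cpow_S. ring. }
    assert (B2 : r ^ 2 * Cmod (INR n * z ^ (pred n) * ((w - z) * (w - z)))%C
                 <= INR n * r ^ S n * h ^ 2).
    { rewrite !Cmod_mult, Cmod_R, Cmod_pow, Rabs_pos_eq by apply pos_INR. fold h.
      destruct n as [|n]; [simpl; lra|]. simpl pred.
      replace (r ^ 2 * (INR (S n) * Cmod z ^ n * (h * h)))
        with ((INR (S n) * h ^ 2 * r ^ 2) * Cmod z ^ n) by ring.
      replace (INR (S n) * r ^ S (S n) * h ^ 2)
        with ((INR (S n) * h ^ 2 * r ^ 2) * r ^ n) by (simpl; ring).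
      apply Rmult_le_compat_l.
      - assert (I := pos_INR (S n)). apply Rmult_le_pos; [apply Rmult_le_pos|]; auto using pow_le.
      - apply pow_incr; split; auto. apply Cmod_ge_0. }
    assert (B1 : r ^ 2 * Cmod (w * E)%C <= INR n ^ 2 * r ^ S n * h ^ 2).
    { rewrite Cmod_mult. assert (P := Cmod_ge_0 E).
      apply Rle_trans with (r * (r ^ 2 * Cmod E)).
      - replace (r * (r ^ 2 * Cmod E)) with (r ^ 2 * (r * Cmod E)) by ring.
        apply Rmult_le_compat_l; [nra|]. apply Rmult_le_compat_r; auto.
      - replace (INR n ^ 2 * r ^ S n * h ^ 2) with (r * (INR n ^ 2 * r ^ n * h ^ 2))
          by (simpl; ring). apply Rmult_le_compat_l; auto. }
    eapply Rle_trans; [apply Rmult_le_compat_l; [nra|apply Cmod_triangle]|].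
    rewrite S_INR.
    assert (P : 0 <= r ^ S n * h ^ 2) by (apply Rmult_le_pos; apply pow_le; auto).
    assert (I := pos_INR n). nra.
Qed.

Definition PSd (a : nat -> C) (n : nat) : C := (INR (S n) * a (S n))%C.

(** At a radius [r] between |z| and [rho], summing [pow_taylor2] against the coefficients gives a
    remainder O(|w - z|^2); the factor n^2 is harmless by [n2_geom]. *)
Lemma PS_deriv a rho M z : 0 < rho -> (forall n, Cmod (a n) * rho ^ n <= M) -> Cmod z < rho ->
  Cderiv (PSf a) z (PSf (PSd a) z) /\ PS (PSd a) z (PSf (PSd a) z).
Proof.
  intros Hr H Hz.
  set (r := (Cmod z + rho) / 2).
  assert (Pz := Cmod_ge_0 z).
  assert (Hr1 : Cmod z < r < rho) by (unfold r; lra).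
  assert (HM : 0 <= M).
  { eapply Rle_trans; [|apply (H O)]. simpl. rewrite Rmult_1_r. apply Cmod_ge_0. }
  assert (Hq : 0 <= r / rho < 1).
  { apply ratio_bounds; lra. }
  destruct (n2_geom _ Hq) as [K [th [HK [Hth HKn]]]].
  assert (Bn : forall n, Cmod (a n) * (INR n ^ 2 * r ^ n) <= M * K * th ^ n).
  { intros n. assert (Pn : 0 < rho ^ n) by (apply pow_lt; auto).
    replace (Cmod (a n) * (INR n ^ 2 * r ^ n))
      with ((Cmod (a n) * rho ^ n) * (INR n ^ 2 * (r / rho) ^ n))
      by (unfold Rdiv; rewrite Rpow_mult_distr, pow_inv; field; lra).
    rewrite (Rmult_assoc M). apply Rmult_le_compat; auto.
    - apply Rmult_le_pos; [apply Cmod_ge_0|lra].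
    - apply Rmult_le_pos; [apply pow2_ge_0|apply pow_le; lra]. }
  (* Termwise derivative without index shift: its term of index 0 is 0 because [INR 0 = 0], whatever
     [pred 0] is. *)
  set (dt := fun n => (a n * (INR n * z ^ (pred n)))%C).
  assert (Bd : forall n, Cmod (dt n) <= (M * K / r) * th ^ n).
  { intros n. unfold dt. rewrite !Cmod_mult, Cmod_R, Cmod_pow, Rabs_pos_eq by apply pos_INR.
    apply Rmult_le_reg_r with r; [lra|].
    replace (M * K / r * th ^ n * r) with (M * K * th ^ n) by (field; lra).
    eapply Rle_trans; [|apply Bn]. rewrite !Rmult_assoc.
    apply Rmult_le_compat_l; [apply Cmod_ge_0|].
    destruct n as [|n]; [simpl; lra|]. simpl pred. assert (I := pos_INR (S n)).
    assert (I1 : 1 <= INR (S n)) by (rewrite S_INR; assert (X := pos_INR n); lra).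
    apply Rle_trans with (INR (S n) * (r ^ n * r)).
    - apply Rmult_le_compat_l; auto. apply Rmult_le_compat_r; [lra|].
      apply pow_incr; lra.
    - assert (P : 0 <= r ^ n * r) by (apply Rmult_le_pos; [apply pow_le|]; lra).
      replace (INR (S n) ^ 2 * r ^ S n) with (INR (S n) * INR (S n) * (r ^ n * r))
        by (simpl; ring). apply Rmult_le_compat_r; auto. nra. }
  destruct (Cser_dom dt (fun n => (M * K / r) * th ^ n) (M * K / r / (1 - th)))
    as [D [HD _]]; auto.
  { intros n. rewrite rsum_scal. apply Rmult_le_compat_l; [|apply rsum_geom; auto].
    apply Rdiv_le_0_compat; nra. }
  assert (HD2 : PS (PSd a) z D).
  { apply Cser_ext with (fun n => dt (S n)).
    - intros n. unfold dt, PSd. simpl pred. ring.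
    - eapply Cser_eq; [apply Cser_shift, HD|]. unfold dt; simpl. ring. }
  assert (ED : PSf (PSd a) z = D) by (apply Csum_eq, HD2).
  rewrite ED. split; auto.
  set (B := M * K / r ^ 2 / (1 - th)).
  assert (HB : 0 <= B).
  { unfold B. apply Rdiv_le_0_compat; [|lra]. apply Rdiv_le_0_compat; nra. }
  intros eps He. exists (Rmin (r - Cmod z) (eps / (B + 1))). split.
  { apply Rmin_pos; [lra|apply Rdiv_lt_0_compat; lra]. }
  intros w Hw.
  assert (W1 := Rlt_le_trans _ _ _ Hw (Rmin_l _ _)).
  assert (W2 := Rlt_le_trans _ _ _ Hw (Rmin_r _ _)).
  assert (Ww : Cmod w < r).
  { assert (T := Cmod_triangle (w - z)%C z). replace (w - z + z)%C with w in T by ring. lra. }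
  assert (Sw := PSf_correct a w rho M Hr H ltac:(lra)).
  assert (Sz := PSf_correct a z rho M Hr H Hz).
  set (h := Cmod (w - z)%C) in *. assert (Hh : 0 <= h) by apply Cmod_ge_0.
  assert (Fin : Cmod (PSf a w - PSf a z - D * (w - z))%C <= B * h ^ 2).
  { replace (PSf a w - PSf a z - D * (w - z))%C
      with (PSf a w - PSf a z - (w - z) * D)%C by ring.
    assert (S := Cser_minus _ _ _ _ (Cser_minus _ _ _ _ Sw Sz) (Cser_scal (w - z)%C _ _ HD)).
    apply (Cser_norm_le _ _ _ S). intros n.
    eapply Rle_trans; [apply Cmod_csum|].
    apply Rle_trans with (rsum (fun k => (M * K / r ^ 2 * h ^ 2) * th ^ k) n).
    - apply rsum_le. intros k _.
      replace (a k * w ^ k - a k * z ^ k - (w - z) * dt k)%C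
        with (a k * (w ^ k - z ^ k - INR k * z ^ (pred k) * (w - z)))%C
        by (unfold dt; ring).
      rewrite Cmod_mult. apply Rmult_le_reg_r with (r ^ 2); [nra|].
      replace (M * K / r ^ 2 * h ^ 2 * th ^ k * r ^ 2) with (M * K * th ^ k * h ^ 2)
        by (field; lra).
      assert (T := pow_taylor2 w z r k ltac:(lra) ltac:(lra)). fold h in T.
      apply Rle_trans with (Cmod (a k) * (INR k ^ 2 * r ^ k * h ^ 2)).
      + rewrite Rmult_assoc. apply Rmult_le_compat_l; [apply Cmod_ge_0|]. lra.
      + rewrite <- Rmult_assoc. apply Rmult_le_compat_r; [nra|]. apply Bn.
    - rewrite rsum_scal. apply Rle_trans with (M * K / r ^ 2 * h ^ 2 * / (1 - th)).
      + apply Rmult_le_compat_l; [|apply rsum_geom; auto].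
        apply Rmult_le_pos; [|nra]. apply Rdiv_le_0_compat; nra.
      + right. unfold B. field. split; lra. }
  eapply Rle_trans; [exact Fin|].
  replace (B * h ^ 2) with ((B * h) * h) by ring. apply Rmult_le_compat_r; auto.
  apply Rle_trans with ((B + 1) * (eps / (B + 1))).
  - apply Rmult_le_compat; lra.
  - right; field; lra.
Qed.

(** Strong induction: once the earlier coefficients vanish, the value 0 at a small real [x] bounds
    |c n| x^n by the tail, which is O(x^(n+1)); then [x] tends to 0. *)
Lemma PS_zero_coef c r : 0 < r -> (forall z, Cmod z < r -> PS c z 0) -> forall n, c n = 0.
Proof.
  intros Hr H.
  assert (Hrho : exists M, 0 < M /\ forall n, Cmod (c n) * (r / 2) ^ n <= M).
  { assert (X := H (RtoC (r / 2))). rewrite Cmod_R, Rabs_pos_eq in X by lra.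
    destruct (Cser_bounded_terms _ _ (X ltac:(lra))) as [M [HM HB]].
    exists M; split; auto. intros n. specialize (HB n).
    rewrite Cmod_mult, Cmod_pow, Cmod_R, Rabs_pos_eq in HB by lra. exact HB. }
  destruct Hrho as [M [HM HB]]. set (rho := r / 2) in *. assert (Hp : 0 < rho) by (unfold rho; lra).
  intros n. induction n as [n IH] using (well_founded_induction Wf_nat.lt_wf).
  apply Cmod_eq_0. apply Rle_antisym; [|apply Cmod_ge_0].
  apply le_epsilon. intros eps He.
  (* With q = x / rho <= 1/2 the tail M q^(n+1) / (1 - q) is at most K x^(n+1); the 2 comes from 1 /
     (1 - q). *)
  set (K := 2 * M / rho ^ S n). assert (Pn : 0 < rho ^ S n) by (apply pow_lt; auto).
  assert (HK : 0 < K) by (apply Rdiv_lt_0_compat; lra).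
  set (x := Rmin (rho / 2) (eps / K)).
  assert (Hx : 0 < x) by (apply Rmin_pos; [lra|apply Rdiv_lt_0_compat; auto]).
  assert (Hx1 : x <= rho / 2) by apply Rmin_l. assert (Hx2 : x <= eps / K) by apply Rmin_r.
  assert (Mx : Cmod (RtoC x) = x) by (rewrite Cmod_R, Rabs_pos_eq; lra).
  assert (S0 := H (RtoC x)). rewrite Mx in S0. specialize (S0 ltac:(unfold rho in *; lra)).
  destruct (PS_conv c (RtoC x) rho M Hp HB ltac:(lra)) as [l [Hl Hn]].
  assert (l = 0) by (apply (Cser_unique _ _ _ Hl S0)). subst l.
  specialize (Hn (S n)). rewrite Mx in Hn.
  assert (E : csum (fun k => c k * x ^ k)%C (S n) = (c n * x ^ n)%C).
  { simpl. assert (Z : csum (fun k => c k * x ^ k)%C n = 0).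
    { clear -IH. assert (G : forall m, (m <= n)%nat -> csum (fun k => c k * x ^ k)%C m = 0).
      { induction m; intros Hm; simpl; auto. rewrite IHm, IH by lia. ring. }
      apply G; lia. }
    rewrite Z. ring. }
  rewrite E in Hn. replace (0 - c n * x ^ n)%C with (- (c n * x ^ n))%C in Hn by ring.
  rewrite Cmod_opp, Cmod_mult, Cmod_pow, Mx in Hn.
  set (q := x / rho) in *.
  assert (Hq : 0 < q <= 1 / 2).
  { unfold q. split; [apply Rdiv_lt_0_compat; auto|].
    apply Rmult_le_reg_r with rho; auto. unfold Rdiv at 1. rewrite Rmult_assoc, Rinv_l; lra. }
  assert (G : M / (1 - q) - M * rsum (fun k => q ^ k) (S n) = M * (q ^ S n / (1 - q))).
  { assert (E2 : forall m, rsum (fun k => q ^ k) m = (1 - q ^ m) / (1 - q)).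
    { induction m; simpl; [|rewrite IHm]; field; lra. }
    rewrite E2. field. lra. }
  rewrite G in Hn.
  assert (Pq : 0 < q ^ S n) by (apply pow_lt; lra).
  assert (G2 : M * (q ^ S n / (1 - q)) <= K * x * x ^ n).
  { replace (K * x * x ^ n) with (M * (2 * q ^ S n)).
    - apply Rmult_le_compat_l; [lra|].
      apply Rmult_le_reg_r with (1 - q); [lra|]. unfold Rdiv. rewrite Rmult_assoc, Rinv_l by lra. nra.
    - unfold K, q, Rdiv. rewrite Rpow_mult_distr, pow_inv. simpl. field.
      split; [apply pow_nonzero|]; lra. }
  assert (Px : 0 < x ^ n) by (apply pow_lt; auto).
  assert (Cmod (c n) <= K * x) by (apply Rmult_le_reg_r with (x ^ n); lra).
  apply Rle_trans with (K * x); [auto|].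
  apply Rle_trans with (K * (eps / K)); [apply Rmult_le_compat_l; lra|].
  right; field; lra.
Qed.

Lemma PS_unique a b f r : 0 < r -> (forall z, Cmod z < r -> PS a z (f z)) ->
  (forall z, Cmod z < r -> PS b z (f z)) -> forall n, a n = b n.
Proof.
  intros Hr Ha Hb n.
  assert (Z : (a n - b n)%C = 0).
  { apply (PS_zero_coef (fun n => a n - b n)%C r Hr). intros z Hz.
    apply Cser_ext with (fun n => a n * z ^ n - b n * z ^ n)%C; [intros; ring|].
    eapply Cser_eq; [apply Cser_minus; [apply Ha|apply Hb]; auto|ring]. }
  replace (a n) with ((a n - b n) + b n)%C by ring. rewrite Z; ring.
Qed.

(** * Goursat's theorem *)

Definition rcont (g : R -> C) (t : R) := forall eps, 0 < eps -> exists d, 0 < d /\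
  forall s, Rabs (s - t) < d -> Cmod (g s - g t)%C < eps.

Definition rcont_on (g : R -> C) (a b : R) := forall t, a <= t <= b -> rcont g t.

Definition cint (g : R -> C) (a b : R) : C :=
  (RInt (fun t => Re (g t)) a b, RInt (fun t => Im (g t)) a b).

Lemma rcont_Re g t : rcont g t -> continuous (fun t => Re (g t)) t.
Proof.
  intros H. apply continuity_pt_filterlim, continuity_pt_locally. intros eps.
  destruct (H eps (cond_pos eps)) as [d [Hd H1]]. exists (mkposreal d Hd). intros s Hs.
  rewrite <- Re_minus. eapply Rle_lt_trans; [apply re_le_Cmod|]. apply H1, Hs.
Qed.

Lemma rcont_Im g t : rcont g t -> continuous (fun t => Im (g t)) t.
Proof.
  intros H. apply continuity_pt_filterlim, continuity_pt_locally. intros eps.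
  destruct (H eps (cond_pos eps)) as [d [Hd H1]]. exists (mkposreal d Hd). intros s Hs.
  rewrite <- Im_minus. eapply Rle_lt_trans; [apply im_le_Cmod|]. apply H1, Hs.
Qed.

Lemma rcont_ex_Re g a b : a <= b -> rcont_on g a b -> ex_RInt (fun t => Re (g t)) a b.
Proof.
  intros L H. apply (ex_RInt_continuous (V := R_CompleteNormedModule)). intros t Ht.
  rewrite Rmin_left, Rmax_right in Ht by auto. apply rcont_Re, H, Ht.
Qed.

Lemma rcont_ex_Im g a b : a <= b -> rcont_on g a b -> ex_RInt (fun t => Im (g t)) a b.
Proof.
  intros L H. apply (ex_RInt_continuous (V := R_CompleteNormedModule)). intros t Ht.
  rewrite Rmin_left, Rmax_right in Ht by auto. apply rcont_Im, H, Ht.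
Qed.

Lemma rcont_const c t : rcont (fun _ => c) t.
Proof.
  intros eps He. exists 1; split; [lra|]. intros s _.
  replace (c - c)%C with (RtoC 0) by ring. rewrite Cmod_0; auto.
Qed.

Lemma rcont_plus g h t : rcont g t -> rcont h t -> rcont (fun s => g s + h s)%C t.
Proof.
  intros H1 H2 eps He. destruct (H1 (eps / 2)) as [d1 [P1 Q1]]; [lra|].
  destruct (H2 (eps / 2)) as [d2 [P2 Q2]]; [lra|].
  exists (Rmin d1 d2); split; [apply Rmin_pos; auto|]. intros s Hs.
  specialize (Q1 s (Rlt_le_trans _ _ _ Hs (Rmin_l _ _))).
  specialize (Q2 s (Rlt_le_trans _ _ _ Hs (Rmin_r _ _))).
  replace (g s + h s - (g t + h t))%C with ((g s - g t) + (h s - h t))%C by ring.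
  eapply Rle_lt_trans; [apply Cmod_triangle|]. lra.
Qed.

Lemma rcont_scal c g t : rcont g t -> rcont (fun s => c * g s)%C t.
Proof.
  intros H eps He. assert (P := Cmod_ge_0 c).
  destruct (H (eps / (Cmod c + 1))) as [d [Hd H1]]; [apply Rdiv_lt_0_compat; lra|].
  exists d; split; auto. intros s Hs. specialize (H1 s Hs).
  replace (c * g s - c * g t)%C with (c * (g s - g t))%C by ring. rewrite Cmod_mult.
  assert (Q := Cmod_ge_0 (g s - g t)%C).
  apply Rle_lt_trans with ((Cmod c + 1) * Cmod (g s - g t)%C); [nra|].
  apply Rlt_le_trans with ((Cmod c + 1) * (eps / (Cmod c + 1))).
  - apply Rmult_lt_compat_l; lra.
  - right; field; lra.
Qed.

Lemma cint_ext g h a b : a <= b -> (forall t, a <= t <= b -> g t = h t) -> cint g a b = cint h a b.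
Proof.
  intros L H. unfold cint. f_equal; apply RInt_ext; intros t Ht;
    rewrite Rmin_left, Rmax_right in Ht by auto; rewrite H; auto; lra.
Qed.

Lemma cint_plus g h a b : a <= b -> rcont_on g a b -> rcont_on h a b ->
  cint (fun t => g t + h t)%C a b = (cint g a b + cint h a b)%C.
Proof.
  intros L H1 H2. apply C_eq; unfold cint; rewrite ?Re_plus, ?Im_plus; simpl.
  - apply (RInt_plus (V := R_CompleteNormedModule)); apply rcont_ex_Re; auto.
  - apply (RInt_plus (V := R_CompleteNormedModule)); apply rcont_ex_Im; auto.
Qed.

Lemma cint_scal c g a b : a <= b -> rcont_on g a b ->
  cint (fun t => c * g t)%C a b = (c * cint g a b)%C.
Proof.
  intros L H. assert (HR := rcont_ex_Re g a b L H). assert (HI := rcont_ex_Im g a b L H).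
  assert (K : forall k (f : R -> R), ex_RInt f a b -> ex_RInt (fun t => k * f t) a b /\
    RInt (fun t => k * f t) a b = k * RInt f a b).
  { intros k f Hf. split.
    - apply (ex_RInt_scal (V := R_NormedModule)); auto.
    - apply (RInt_scal (V := R_CompleteNormedModule)); auto. }
  destruct (K (Re c) _ HR) as [K1 E1]. destruct (K (Im c) _ HI) as [K2 E2].
  destruct (K (Im c) _ HR) as [K3 E3]. destruct (K (Re c) _ HI) as [K4 E4].
  apply C_eq; rewrite ?Re_mult, ?Im_mult.
  - change (Re (cint g a b)) with (RInt (fun t => Re (g t)) a b).
    change (Im (cint g a b)) with (RInt (fun t => Im (g t)) a b).
    rewrite <- E1, <- E2. symmetry.
    exact (eq_sym (RInt_minus (V := R_CompleteNormedModule) _ _ a b K1 K2)).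
  - change (Re (cint g a b)) with (RInt (fun t => Re (g t)) a b).
    change (Im (cint g a b)) with (RInt (fun t => Im (g t)) a b).
    rewrite <- E3, <- E4. rewrite Rplus_comm.
    etransitivity; [|exact (RInt_plus (V := R_CompleteNormedModule) _ _ a b K3 K4)].
    apply RInt_ext. intros t _. rewrite Im_mult. unfold plus; simpl. ring.
Qed.

(* Estimating real and imaginary parts separately costs the factor 2, which is
   harmless here and spares the norm inequality for vector-valued integrals. *)
Lemma cint_norm g a b M : a <= b -> rcont_on g a b -> (forall t, a <= t <= b -> Cmod (g t) <= M) ->
  Cmod (cint g a b) <= 2 * M * (b - a).
Proof.
  intros L H HM. eapply Rle_trans; [apply Cmod_le_ReIm|].
  assert (A : Rabs (Re (cint g a b)) <= (b - a) * M).
  { apply abs_RInt_le_const; auto. apply rcont_ex_Re; auto.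
    intros t Ht. eapply Rle_trans; [apply re_le_Cmod|]. auto. }
  assert (B : Rabs (Im (cint g a b)) <= (b - a) * M).
  { apply abs_RInt_le_const; auto. apply rcont_ex_Im; auto.
    intros t Ht. eapply Rle_trans; [apply im_le_Cmod|]. auto. }
  lra.
Qed.

Lemma cint_point g a : cint g a a = 0.
Proof. apply C_eq; unfold cint; simpl; apply (RInt_point (V := R_CompleteNormedModule)). Qed.

Lemma cint_Chasles g a b c : a <= b -> b <= c -> rcont_on g a c ->
  (cint g a b + cint g b c)%C = cint g a c.
Proof.
  intros L1 L2 H.
  assert (H1 : rcont_on g a b) by (intros t Ht; apply H; lra).
  assert (H2 : rcont_on g b c) by (intros t Ht; apply H; lra).
  apply C_eq; rewrite ?Re_plus, ?Im_plus; unfold cint; simpl.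
  - apply (RInt_Chasles (V := R_CompleteNormedModule)); apply rcont_ex_Re; auto.
  - apply (RInt_Chasles (V := R_CompleteNormedModule)); apply rcont_ex_Im; auto.
Qed.

Lemma cint_const c a b : cint (fun _ => c) a b = (RtoC (b - a) * c)%C.
Proof.
  apply C_eq; rewrite ?Re_mult, ?Im_mult; unfold cint; simpl; rewrite RInt_const;
    unfold scal; simpl; unfold mult; simpl; ring.
Qed.

Lemma RInt_id a b : RInt (fun t => t) a b = (b ^ 2 - a ^ 2) / 2.
Proof.
  apply is_RInt_unique.
  replace ((b ^ 2 - a ^ 2) / 2) with (minus (b ^ 2 / 2) (a ^ 2 / 2))
    by (unfold minus, plus, opp; simpl; field).
  apply (is_RInt_derive (fun t => t ^ 2 / 2) (fun t => t)).
  - intros t _. auto_derive; auto. field.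
  - intros t _. apply continuous_id.
Qed.

(** The counterclockwise boundary integral over [a, b] x [c, d]: dz is dx on the horizontal sides
    and i dy on the vertical ones. *)
Definition rectint (F : C -> C) (a b c d : R) : C :=
  (cint (fun x => F (x, c)) a b - cint (fun x => F (x, d)) a b
   + Ci * (cint (fun y => F (b, y)) c d - cint (fun y => F (a, y)) c d))%C.

Definition Ccont_rect (F : C -> C) (a b c d : R) :=
  forall x y, a <= x <= b -> c <= y <= d -> Ccont F (x, y).

Lemma Cmod_horiz (x x' y : R) : Cmod ((x, y) - (x', y))%C = Rabs (x - x').
Proof.
  replace ((x, y) - (x', y))%C with (RtoC (x - x')); [apply Cmod_R|].
  apply C_eq; simpl; ring.
Qed.

Lemma Cmod_vert (x y y' : R) : Cmod ((x, y) - (x, y'))%C = Rabs (y - y').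
Proof.
  replace ((x, y) - (x, y'))%C with (Ci * RtoC (y - y'))%C.
  - rewrite Cmod_mult, Cmod_Ci, Cmod_R. ring.
  - apply C_eq; simpl; ring.
Qed.

Lemma Ccont_horiz F x y : Ccont F (x, y) -> rcont (fun t => F (t, y)) x.
Proof.
  intros H eps He. destruct (H eps He) as [d [Hd H1]]. exists d; split; auto.
  intros s Hs. apply H1. rewrite Cmod_horiz. auto.
Qed.

Lemma Ccont_vert F x y : Ccont F (x, y) -> rcont (fun t => F (x, t)) y.
Proof.
  intros H eps He. destruct (H eps He) as [d [Hd H1]]. exists d; split; auto.
  intros s Hs. apply H1. rewrite Cmod_vert. auto.
Qed.

Lemma rect_split_x F a m b c d : a <= m <= b -> c <= d -> Ccont_rect F a b c d ->
  rectint F a b c d = (rectint F a m c d + rectint F m b c d)%C.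
Proof.
  intros H L HF. unfold rectint.
  rewrite <- (cint_Chasles (fun x => F (x, c)) a m b); try lra.
  - rewrite <- (cint_Chasles (fun x => F (x, d)) a m b); try lra; [ring|].
    intros t Ht. apply Ccont_horiz, HF; lra.
  - intros t Ht. apply Ccont_horiz, HF; lra.
Qed.

Lemma rect_split_y F a b c m d : a <= b -> c <= m <= d -> Ccont_rect F a b c d ->
  rectint F a b c d = (rectint F a b c m + rectint F a b m d)%C.
Proof.
  intros L H HF. unfold rectint.
  rewrite <- (cint_Chasles (fun y => F (a, y)) c m d); try lra.
  - rewrite <- (cint_Chasles (fun y => F (b, y)) c m d); try lra; [ring|].
    intros t Ht. apply Ccont_vert, HF; lra.
  - intros t Ht. apply Ccont_vert, HF; lra.
Qed.

Lemma rect_norm F a b c d M : a <= b -> c <= d -> Ccont_rect F a b c d ->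
  (forall x y, a <= x <= b -> c <= y <= d -> Cmod (F (x, y)) <= M) ->
  Cmod (rectint F a b c d) <= 4 * M * ((b - a) + (d - c)).
Proof.
  intros L1 L2 HF HM. unfold rectint.
  assert (A1 : Cmod (cint (fun x => F (x, c)) a b) <= 2 * M * (b - a)).
  { apply cint_norm; auto. intros t Ht; apply Ccont_horiz, HF; lra. intros; apply HM; lra. }
  assert (A2 : Cmod (cint (fun x => F (x, d)) a b) <= 2 * M * (b - a)).
  { apply cint_norm; auto. intros t Ht; apply Ccont_horiz, HF; lra. intros; apply HM; lra. }
  assert (A3 : Cmod (cint (fun y => F (b, y)) c d) <= 2 * M * (d - c)).
  { apply cint_norm; auto. intros t Ht; apply Ccont_vert, HF; lra. intros; apply HM; lra. }
  assert (A4 : Cmod (cint (fun y => F (a, y)) c d) <= 2 * M * (d - c)).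
  { apply cint_norm; auto. intros t Ht; apply Ccont_vert, HF; lra. intros; apply HM; lra. }
  eapply Rle_trans; [apply Cmod_triangle|]. rewrite Cmod_mult, Cmod_Ci.
  assert (B1 := Cmod_triangle_minus (cint (fun x => F (x, c)) a b) (cint (fun x => F (x, d)) a b)).
  assert (B2 := Cmod_triangle_minus (cint (fun y => F (b, y)) c d) (cint (fun y => F (a, y)) c d)).
  lra.
Qed.

Lemma rect_affine al l a b c d : a <= b -> c <= d ->
  rectint (fun w => al + l * w)%C a b c d = 0.
Proof.
  intros L1 L2. unfold rectint.
  assert (H : forall y t, rcont (fun x => (x, y)) t).
  { intros y t eps He. exists eps; split; auto. intros s Hs. rewrite Cmod_horiz. auto. }
  assert (V : forall x t, rcont (fun y => (x, y)) t).
  { intros y t eps He. exists eps; split; auto. intros s Hs. rewrite Cmod_vert. auto. }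
  assert (EH : forall y, cint (fun x => al + l * (x, y))%C a b
     = (RtoC (b - a) * al + l * (((b ^ 2 - a ^ 2) / 2)%R, ((b - a) * y)%R))%C).
  { intros y. rewrite (cint_plus (fun _ => al)); auto.
    - rewrite cint_const. rewrite cint_scal; auto; [|intros t _; apply H]. f_equal. f_equal.
      unfold cint; simpl. rewrite RInt_id. f_equal. rewrite RInt_const. reflexivity.
    - intros t _; apply rcont_const.
    - intros t _. apply rcont_scal, H. }
  assert (EV : forall x, cint (fun y => al + l * (x, y))%C c d
     = (RtoC (d - c) * al + l * (((d - c) * x)%R, ((d ^ 2 - c ^ 2) / 2)%R))%C).
  { intros y. rewrite (cint_plus (fun _ => al)); auto.
    - rewrite cint_const. rewrite cint_scal; auto; [|intros t _; apply V]. f_equal. f_equal.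
      unfold cint; simpl. rewrite RInt_id. f_equal. rewrite RInt_const. reflexivity.
    - intros t _; apply rcont_const.
    - intros t _. apply rcont_scal, V. }
  rewrite !EH, !EV. destruct al as [a1 a2], l as [l1 l2].
  apply C_eq; simpl; field.
Qed.

Lemma Ccont_minus_affine F w al l : Ccont F w -> Ccont (fun z => F z - (al + l * z))%C w.
Proof.
  intros H eps He. destruct (H (eps / 2)) as [d1 [P1 Q1]]; [lra|].
  assert (P := Cmod_ge_0 l).
  exists (Rmin d1 (eps / 2 / (Cmod l + 1))). split.
  { apply Rmin_pos; auto. apply Rdiv_lt_0_compat; lra. }
  intros z Hz. specialize (Q1 z (Rlt_le_trans _ _ _ Hz (Rmin_l _ _))).
  assert (W := Rlt_le_trans _ _ _ Hz (Rmin_r _ _)).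
  replace (F z - (al + l * z) - (F w - (al + l * w)))%C
    with ((F z - F w) - l * (z - w))%C by ring.
  eapply Rle_lt_trans; [apply Cmod_triangle_minus|]. rewrite Cmod_mult.
  assert (Cmod l * Cmod (z - w)%C <= eps / 2); [|lra].
  apply Rle_trans with ((Cmod l + 1) * (eps / 2 / (Cmod l + 1))).
  - apply Rmult_le_compat; auto using Cmod_ge_0; lra.
  - right; field; lra.
Qed.

Lemma rect_minus_affine F al l a b c d : a <= b -> c <= d -> Ccont_rect F a b c d ->
  rectint (fun z => F z - (al + l * z))%C a b c d = rectint F a b c d.
Proof.
  intros L1 L2 HF.
  assert (A := rect_affine (- al) (- l) a b c d L1 L2).
  assert (HA : Ccont_rect (fun w => - al + (- l) * w)%C a b c d).
  { intros x y _ _. eapply Cderiv_cont.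
    apply Cderiv_plus; [apply Cderiv_const|apply Cderiv_scal, Cderiv_id]. }
  replace (rectint F a b c d) with (rectint F a b c d + rectint (fun w => - al + (- l) * w) a b c d)%C
    by (rewrite A; ring).
  assert (EQ : forall z, (F z - (al + l * z) = F z + (- al + - l * z))%C) by (intros; ring).
  unfold rectint.
  rewrite (cint_ext (fun x => F (x, c) - _)%C (fun x => F (x, c) + (- al + - l * (x, c)))%C) by (auto; intros; apply EQ).
  rewrite (cint_ext (fun x => F (x, d) - _)%C (fun x => F (x, d) + (- al + - l * (x, d)))%C) by (auto; intros; apply EQ).
  rewrite (cint_ext (fun y => F (b, y) - _)%C (fun y => F (b, y) + (- al + - l * (b, y)))%C) by (auto; intros; apply EQ).
  rewrite (cint_ext (fun y => F (a, y) - _)%C (fun y => F (a, y) + (- al + - l * (a, y)))%C) by (auto; intros; apply EQ).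
  rewrite (cint_plus (fun x => F (x, c)) (fun x => - al + - l * (x, c))%C); auto;
  try (intros t Ht; (apply Ccont_horiz || apply (Ccont_horiz (fun w => - al + - l * w)%C)); (apply HF || apply HA); lra).
  rewrite (cint_plus (fun x => F (x, d)) (fun x => - al + - l * (x, d))%C); auto;
  try (intros t Ht; (apply Ccont_horiz || apply (Ccont_horiz (fun w => - al + - l * w)%C)); (apply HF || apply HA); lra).
  rewrite (cint_plus (fun y => F (b, y)) (fun y => - al + - l * (b, y))%C); auto;
  try (intros t Ht; (apply Ccont_vert || apply (Ccont_vert (fun w => - al + - l * w)%C)); (apply HF || apply HA); lra).
  rewrite (cint_plus (fun y => F (a, y)) (fun y => - al + - l * (a, y))%C); auto;
  try (intros t Ht; (apply Ccont_vert || apply (Ccont_vert (fun w => - al + - l * w)%C)); (apply HF || apply HA); lra).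
  ring.
Qed.

Definition holo_rect (F : C -> C) (a b c d : R) :=
  forall x y, a <= x <= b -> c <= y <= d -> exists l, Cderiv F (x, y) l.

Lemma holo_rect_cont F a b c d : holo_rect F a b c d -> Ccont_rect F a b c d.
Proof. intros H x y Hx Hy. destruct (H x y Hx Hy) as [l Hl]. eapply Cderiv_cont; eauto. Qed.

(** The affine part of [F] at the point integrates to 0. The remainder is at most eps times the
    distance to the point, and the half-perimeter bounds that distance. *)
Lemma goursat_local F x0 y0 l eps : Cderiv F (x0, y0) l -> 0 < eps ->
  exists del, 0 < del /\ forall a b c d, a <= x0 <= b -> c <= y0 <= d ->
    (b - a) + (d - c) < del -> Ccont_rect F a b c d ->
    Cmod (rectint F a b c d) <= 4 * eps * ((b - a) + (d - c)) ^ 2.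
Proof.
  intros HD He. destruct (HD eps He) as [del [Hdel H]]. exists del; split; auto.
  intros a b c d Hx Hy Hs HF.
  rewrite <- (rect_minus_affine F (F (x0, y0) - l * (x0, y0))%C l) by (auto; lra).
  set (S := (b - a) + (d - c)) in *.
  replace (4 * eps * S ^ 2) with (4 * (eps * S) * S) by ring.
  apply rect_norm; try lra.
  - intros x y Hx1 Hy1. apply Ccont_minus_affine, HF; auto.
  - intros x y Hx1 Hy1.
    replace (F (x, y) - (F (x0, y0) - l * (x0, y0) + l * (x, y)))%C
      with (F (x, y) - F (x0, y0) - l * ((x, y) - (x0, y0)))%C by ring.
    assert (D : Cmod ((x, y) - (x0, y0))%C <= S).
    { eapply Rle_trans; [apply Cmod_le_ReIm|]. rewrite Re_minus, Im_minus. simpl.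
      assert (Rabs (x - x0) <= b - a) by (apply Rabs_le; lra).
      assert (Rabs (y - y0) <= d - c) by (apply Rabs_le; lra). unfold S; lra. }
    eapply Rle_trans; [apply H; lra|]. apply Rmult_le_compat_l; lra.
Qed.

Lemma goursat_quarter F a b c d B : a <= b -> c <= d -> Ccont_rect F a b c d ->
  4 * B < Cmod (rectint F a b c d) ->
  exists x y, (x = a \/ x = (a + b) / 2) /\ (y = c \/ y = (c + d) / 2) /\
    B < Cmod (rectint F x (x + (b - a) / 2) y (y + (d - c) / 2)).
Proof.
  intros L1 L2 HF HB. apply NNPP; intros N.
  assert (K : forall x y, (x = a \/ x = (a + b) / 2) -> (y = c \/ y = (c + d) / 2) ->
    Cmod (rectint F x (x + (b - a) / 2) y (y + (d - c) / 2)) <= B).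
  { intros x y Hx Hy. apply Rnot_lt_le. intros X. apply N. exists x, y. auto. }
  assert (K1 := K a c ltac:(auto) ltac:(auto)).
  assert (K2 := K a ((c + d) / 2) ltac:(auto) ltac:(auto)).
  assert (K3 := K ((a + b) / 2) c ltac:(auto) ltac:(auto)).
  assert (K4 := K ((a + b) / 2) ((c + d) / 2) ltac:(auto) ltac:(auto)).
  replace (a + (b - a) / 2) with ((a + b) / 2) in * by field.
  replace (c + (d - c) / 2) with ((c + d) / 2) in * by field.
  replace ((a + b) / 2 + (b - a) / 2) with b in * by field.
  replace ((c + d) / 2 + (d - c) / 2) with d in * by field.
  rewrite (rect_split_x F a ((a + b) / 2) b) in HB by (auto; lra).
  rewrite (rect_split_y F a ((a + b) / 2) c ((c + d) / 2) d) in HB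
    by (try lra; intros x y Hx Hy; apply HF; lra).
  rewrite (rect_split_y F ((a + b) / 2) b c ((c + d) / 2) d) in HB
    by (try lra; intros x y Hx Hy; apply HF; lra).
  assert (T1 := Cmod_triangle (rectint F a ((a + b) / 2) c ((c + d) / 2) + rectint F a ((a + b) / 2) ((c + d) / 2) d)%C
    (rectint F ((a + b) / 2) b c ((c + d) / 2) + rectint F ((a + b) / 2) b ((c + d) / 2) d)%C).
  assert (T2 := Cmod_triangle (rectint F a ((a + b) / 2) c ((c + d) / 2)) (rectint F a ((a + b) / 2) ((c + d) / 2) d)%C).
  assert (T3 := Cmod_triangle (rectint F ((a + b) / 2) b c ((c + d) / 2)) (rectint F ((a + b) / 2) b ((c + d) / 2) d)%C).
  lra.
Qed.

(** The supremum of the left endpoints works, because every left endpoint lies below every right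
    endpoint. *)
Lemma nested_point (x : nat -> R) (W : R) : 0 <= W ->
  (forall k, x k <= x (S k) /\ x (S k) + W / 2 ^ (S k) <= x k + W / 2 ^ k) ->
  exists p, forall k, x k <= p <= x k + W / 2 ^ k.
Proof.
  intros HW H.
  assert (P2 : forall k, 0 <= W / 2 ^ k) by (intros; apply Rdiv_le_0_compat; auto; apply pow_lt; lra).
  assert (Mono : forall j k, x j <= x (j + k)%nat /\ x (j + k)%nat + W / 2 ^ (j + k) <= x j + W / 2 ^ j).
  { intros j k. induction k; [rewrite Nat.add_0_r; lra|].
    rewrite Nat.add_succ_r. specialize (H (j + k)%nat). lra. }
  assert (Cross : forall j k, x j <= x k + W / 2 ^ k).
  { intros j k. destruct (Nat.le_ge_cases j k) as [L|L].
    - destruct (Mono j (k - j)%nat) as [M _]. replace (j + (k - j))%nat with k in M by lia.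
      specialize (P2 k). lra.
    - destruct (Mono k (j - k)%nat) as [_ M]. replace (k + (j - k))%nat with j in M by lia.
      specialize (P2 j). lra. }
  destruct (completeness (fun v => exists k, v = x k)) as [p [Hp1 Hp2]].
  - exists (x O + W / 2 ^ 0). intros v [k ->]. apply Cross.
  - exists (x O). exists O; auto.
  - exists p. intros k. split.
    + apply Hp1. exists k; auto.
    + apply Hp2. intros v [j ->]. apply Cross.
Qed.

Theorem goursat F a b c d : a <= b -> c <= d -> holo_rect F a b c d -> rectint F a b c d = 0.
Proof.
  intros L1 L2 HF. assert (HC := holo_rect_cont F a b c d HF).
  apply Cmod_eq_0. apply Rle_antisym; [|apply Cmod_ge_0].
  set (W := b - a). set (H := d - c).
  assert (HW : 0 <= W) by (unfold W; lra). assert (HH : 0 <= H) by (unfold H; lra).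
  apply le_epsilon. intros e He. rewrite Rplus_0_l.
  (* Chosen so that 4 eps (W + H)^2 <= e; the added 1 avoids a division by 0 for degenerate
     rectangles. *)
  set (eps := e / (4 * ((W + H) ^ 2 + 1))).
  assert (Pos : 0 < 4 * ((W + H) ^ 2 + 1)) by (assert (X := pow2_ge_0 (W + H)); lra).
  assert (Heps : 0 < eps) by (apply Rdiv_lt_0_compat; lra).
  apply Rnot_lt_le. intros Bad0.
  assert (Bad : 4 * eps * (W + H) ^ 2 < Cmod (rectint F a b c d)).
  { eapply Rle_lt_trans; [|exact Bad0]. assert (X := pow2_ge_0 (W + H)).
    replace e with (4 * eps * ((W + H) ^ 2 + 1)); [|unfold eps; field; lra].
    apply Rmult_le_compat_l; lra. }
  (* A quarter of a bad rectangle that keeps a quarter of the integral is again bad: the threshold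
     falls by 4 at each level, exactly as the bound of [goursat_local] does. This gives the
     contradiction at the limit point. *)
  set (bad := fun (k : nat) (p : R * R) =>
    a <= fst p /\ fst p + W / 2 ^ k <= b /\ c <= snd p /\ snd p + H / 2 ^ k <= d /\
    4 * eps * ((W + H) / 2 ^ k) ^ 2 <
    Cmod (rectint F (fst p) (fst p + W / 2 ^ k) (snd p) (snd p + H / 2 ^ k))).
  set (child := fun (k : nat) (p q : R * R) =>
    (fst q = fst p \/ fst q = fst p + W / 2 ^ (S k)) /\
    (snd q = snd p \/ snd q = snd p + H / 2 ^ (S k))).
  assert (half : forall k x, x / 2 ^ k = 2 * (x / 2 ^ S k)).
  { intros k x. simpl. field. apply pow_nonzero; lra. }
  assert (Pk : forall k, 0 <= W / 2 ^ k /\ 0 <= H / 2 ^ k)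
    by (intros k; split; apply Rdiv_le_0_compat; auto; apply pow_lt; lra).
  assert (Step : forall k p, bad k p -> exists q, child k p q /\ bad (S k) q).
  { intros k [x y] (B1 & B2 & B3 & B4 & B5). unfold bad, child. simpl fst in *; simpl snd in *.
    destruct (Pk (S k)) as [Pk1 Pk2]. rewrite (half k W), (half k H) in *.
    destruct (goursat_quarter F x (x + 2 * (W / 2 ^ S k)) y (y + 2 * (H / 2 ^ S k))
                (4 * eps * ((W + H) / 2 ^ S k) ^ 2)) as (x' & y' & Hx' & Hy' & Q); try lra.
    - intros u v Hu Hv. apply HC; lra.
    - eapply Rle_lt_trans; [|exact B5]. right. rewrite (half k (W + H)). ring.
    - assert (E2 : forall u v, (u + 2 * v - u) / 2 = v) by (intros; field). rewrite !E2 in Q.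
      assert (E3 : forall u v, (u + (u + 2 * v)) / 2 = u + v) by (intros; field). rewrite !E3 in *.
      exists (x', y'). simpl fst; simpl snd.
      repeat split; auto; try lra. }
  set (p := nat_rect (fun _ => (R * R)%type) (a, c)
              (fun k q => epsilon (inhabits (0, 0)) (fun q' => child k q q' /\ bad (S k) q'))).
  assert (Hp : forall k, bad k (p k)).
  { induction k.
    - unfold bad; simpl. replace (W / 1) with W by field. replace (H / 1) with H by field.
      replace ((W + H) / 1) with (W + H) by field.
      replace (a + W) with b by (unfold W; ring). replace (c + H) with d by (unfold H; ring).
      simpl in Bad. repeat split; try lra.
    - apply (epsilon_spec (inhabits (0, 0)) (fun q' => child k (p k) q' /\ bad (S k) q')).
      apply Step; auto. }
  assert (Hc : forall k, child k (p k) (p (S k))).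
  { intros k. apply (epsilon_spec (inhabits (0, 0)) (fun q' => child k (p k) q' /\ bad (S k) q')).
    apply Step; auto. }
  destruct (nested_point (fun k => fst (p k)) W HW) as [x0 Hx0].
  { intros k. destruct (Hc k) as [C1 _]. destruct (Pk (S k)) as [Pk1 Pk2].
    rewrite (half k W). destruct C1 as [-> | ->]; lra. }
  destruct (nested_point (fun k => snd (p k)) H HH) as [y0 Hy0].
  { intros k. destruct (Hc k) as [_ C1]. destruct (Pk (S k)) as [Pk1 Pk2].
    rewrite (half k H). destruct C1 as [-> | ->]; lra. }
  destruct (HF x0 y0) as [l Hl].
  { specialize (Hx0 O). destruct (Hp O) as (B1 & B2 & _). simpl in *. lra. }
  { specialize (Hy0 O). destruct (Hp O) as (_ & _ & B1 & B2 & _). simpl in *. lra. }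
  destruct (goursat_local F x0 y0 l eps Hl Heps) as [del [Hdel G]].
  assert (Small : exists k, (W + H) / 2 ^ k < del).
  { destruct (pow_lt_1_zero (/ 2) ltac:(rewrite Rabs_pos_eq; lra) (del / (W + H + 1)))
      as [N HN]; [apply Rdiv_lt_0_compat; lra|].
    exists N. specialize (HN N ltac:(lia)). rewrite Rabs_pos_eq, pow_inv in HN
      by (apply pow_le; lra).
    assert (PN : 0 < / 2 ^ N) by (apply Rinv_0_lt_compat, pow_lt; lra).
    apply Rle_lt_trans with ((W + H + 1) * / 2 ^ N); [unfold Rdiv; nra|].
    apply Rlt_le_trans with ((W + H + 1) * (del / (W + H + 1))).
    - apply Rmult_lt_compat_l; lra.
    - right; field; lra. }
  destruct Small as [k Hk]. destruct (Hp k) as (B1 & B2 & B3 & B4 & B5).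
  destruct (Pk k) as [Pk1 Pk2].
  specialize (G (fst (p k)) (fst (p k) + W / 2 ^ k) (snd (p k)) (snd (p k) + H / 2 ^ k)
    (Hx0 k) (Hy0 k)).
  replace (fst (p k) + W / 2 ^ k - fst (p k) + (snd (p k) + H / 2 ^ k - snd (p k)))
    with ((W + H) / 2 ^ k) in G by (field; apply pow_nonzero; lra).
  assert (G' := G Hk). apply Rlt_not_le in B5. apply B5, G'.
  intros u v Hu Hv. apply HC; lra.
Qed.

(** Continuity makes a small box around the exceptional point negligible. The four remaining pieces
    either avoid the point or, when it lies on an edge, may be degenerate. *)
Lemma goursat_except F a b c d px py : a <= b -> c <= d -> Ccont_rect F a b c d ->
  (forall x y, a <= x <= b -> c <= y <= d -> (x, y) <> (px, py) -> exists l, Cderiv F (x, y) l) ->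
  a <= px <= b -> c <= py <= d -> rectint F a b c d = 0.
Proof.
  intros L1 L2 HC HF Hpx Hpy.
  assert (G : forall a' b' c' d', a <= a' <= b' -> b' <= b -> c <= c' <= d' -> d' <= d ->
    (px < a' \/ b' < px \/ py < c' \/ d' < py) -> rectint F a' b' c' d' = 0).
  { intros a' b' c' d' H1 H2 H3 H4 HN. apply goursat; try lra.
    intros x y Hx Hy. apply HF; try lra. intros E. injection E; intros; subst. lra. }
  assert (DX : forall x c' d', rectint F x x c' d' = 0).
  { intros. unfold rectint. rewrite !cint_point. ring. }
  assert (DY : forall y a' b', rectint F a' b' y y = 0).
  { intros. unfold rectint. rewrite !cint_point. ring. }
  apply Cmod_eq_0. apply Rle_antisym; [|apply Cmod_ge_0].
  apply le_epsilon. intros e He. rewrite Rplus_0_l.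
  destruct (HC px py Hpx Hpy 1 Rlt_0_1) as [del [Hdel Hb]].
  set (M := Cmod (F (px, py)) + 1).
  assert (HM : 0 < M) by (unfold M; assert (X := Cmod_ge_0 (F (px, py))); lra).
  set (h := Rmin (del / 4) (e / (16 * M))).
  assert (Hh : 0 < h) by (apply Rmin_pos; [lra|apply Rdiv_lt_0_compat; lra]).
  assert (Hh1 : h <= del / 4) by apply Rmin_l.
  assert (Hh2 : h <= e / (16 * M)) by apply Rmin_r.
  set (x1 := Rmax a (px - h)). set (x2 := Rmin b (px + h)).
  set (y1 := Rmax c (py - h)). set (y2 := Rmin d (py + h)).
  assert (X1 : a <= x1 <= px /\ px - h <= x1 /\ (x1 = a \/ x1 < px)).
  { unfold x1, Rmax. destruct (Rle_dec a (px - h)); repeat split; lra. }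
  assert (X2 : px <= x2 <= b /\ x2 <= px + h /\ (x2 = b \/ px < x2)).
  { unfold x2, Rmin. destruct (Rle_dec b (px + h)); repeat split; lra. }
  assert (Y1 : c <= y1 <= py /\ py - h <= y1 /\ (y1 = c \/ y1 < py)).
  { unfold y1, Rmax. destruct (Rle_dec c (py - h)); repeat split; lra. }
  assert (Y2 : py <= y2 <= d /\ y2 <= py + h /\ (y2 = d \/ py < y2)).
  { unfold y2, Rmin. destruct (Rle_dec d (py + h)); repeat split; lra. }
  destruct X1 as (X1a & X1b & X1c). destruct X2 as (X2a & X2b & X2c).
  destruct Y1 as (Y1a & Y1b & Y1c). destruct Y2 as (Y2a & Y2b & Y2c).
  assert (Sub : forall a' b' c' d', a <= a' -> b' <= b -> c <= c' -> d' <= d -> Ccont_rect F a' b' c' d').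
  { intros. intros x y Hx Hy. apply HC; lra. }
  rewrite (rect_split_x F a x1 b) by (auto; lra).
  rewrite (rect_split_x F x1 x2 b) by (try lra; apply Sub; lra).
  rewrite (rect_split_y F x1 x2 c y1 d) by (try lra; apply Sub; lra).
  rewrite (rect_split_y F x1 x2 y1 y2 d) by (try lra; apply Sub; lra).
  replace (rectint F a x1 c d) with (RtoC 0)
    by (destruct X1c as [E|E]; [rewrite E, DX; auto|rewrite G; auto; lra]).
  replace (rectint F x2 b c d) with (RtoC 0)
    by (destruct X2c as [E|E]; [rewrite E, DX; auto|rewrite G; auto; lra]).
  replace (rectint F x1 x2 c y1) with (RtoC 0)
    by (destruct Y1c as [E|E]; [rewrite E, DY; auto|rewrite G; auto; lra]).
  replace (rectint F x1 x2 y2 d) with (RtoC 0)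
    by (destruct Y2c as [E|E]; [rewrite E, DY; auto|rewrite G; auto; lra]).
  replace (0 + (0 + (rectint F x1 x2 y1 y2 + 0) + 0))%C with (rectint F x1 x2 y1 y2) by ring.
  apply Rle_trans with (4 * M * ((x2 - x1) + (y2 - y1))).
  - apply rect_norm; try lra; [apply Sub; lra|].
    intros x y Hx Hy.
    assert (D : Cmod ((x, y) - (px, py))%C < del).
    { eapply Rle_lt_trans; [apply Cmod_le_ReIm|]. rewrite Re_minus, Im_minus. simpl.
      assert (Rabs (x - px) <= h) by (apply Rabs_le; lra).
      assert (Rabs (y - py) <= h) by (apply Rabs_le; lra). lra. }
    specialize (Hb _ D).
    replace (F (x, y)) with (F (px, py) + (F (x, y) - F (px, py)))%C by ring.
    eapply Rle_trans; [apply Cmod_triangle|]. unfold M; lra.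
  - apply Rle_trans with (4 * M * (4 * (e / (16 * M)))).
    + apply Rmult_le_compat_l; lra.
    + right; field; lra.
Qed.

(** * Cauchy's formula on a disc *)

Lemma Ccont_comp f g z : Ccont f z -> Ccont g (f z) -> Ccont (fun w => g (f w)) z.
Proof.
  intros Hf Hg eps He. destruct (Hg eps He) as [d1 [P1 Q1]].
  destruct (Hf d1 P1) as [d2 [P2 Q2]]. exists d2; split; auto.
Qed.

Lemma Ccont_Cexp z : Ccont Cexp z.
Proof. eapply Cderiv_cont, Cderiv_Cexp. Qed.

(** For [r > 0], the point of modulus r and argument t, written so that the circle is the image
    under [Cexp] of a segment on the line Re = ln r. *)
Definition circ (r t : R) : C := Cexp (ln r, t).

Lemma Cmod_circ r t : 0 < r -> Cmod (circ r t) = r.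
Proof. intros H. unfold circ. rewrite Cmod_Cexp. simpl. apply exp_ln; auto. Qed.

Lemma circ_neq0 r t : circ r t <> 0.
Proof. apply Cexp_neq0. Qed.

Lemma circ_cont F r t : Ccont F (circ r t) -> rcont (fun s => F (circ r s)) t.
Proof.
  intros H. apply (Ccont_vert (fun w => F (Cexp w))). apply Ccont_comp; auto. apply Ccont_Cexp.
Qed.

Lemma cos_eq_1_small u : Rabs u <= PI -> cos u = 1 -> u = 0.
Proof.
  intros H E.
  assert (S : sin (u / 2) = 0).
  { assert (X : 1 - cos u = 2 * (sin (u / 2)) ^ 2).
    { replace u with (2 * (u / 2)) at 1 by field. rewrite cos_2a_sin. ring. }
    rewrite E in X. nra. }
  assert (P := PI_RGT_0). apply Rabs_le_between in H.
  destruct (Rtotal_order u 0) as [L|[L|L]]; auto.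
  - assert (X := sin_gt_0 (- (u / 2)) ltac:(lra) ltac:(lra)). rewrite sin_neg in X. lra.
  - assert (X := sin_gt_0 (u / 2) ltac:(lra) ltac:(lra)). lra.
Qed.

Lemma Cexp_inj_strip x y x' y' : Rabs (y - y') <= PI -> Cexp (x, y) = Cexp (x', y') ->
  (x, y) = (x', y').
Proof.
  intros H E.
  assert (Ex : exp x = exp x').
  { assert (M := f_equal Cmod E). rewrite !Cmod_Cexp in M. exact M. }
  apply exp_inv in Ex. subst x'.
  assert (E1 : Cexp ((x, y) - (x, y'))%C = 1).
  { rewrite Cexp_minus, E. field. apply Cexp_neq0. }
  apply (f_equal Re) in E1. unfold Cexp in E1. rewrite Re_minus, Im_minus in E1. simpl in E1.
  replace (x - x) with 0 in E1 by ring. rewrite exp_0, Rmult_1_l in E1.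
  apply cos_eq_1_small in E1; auto. f_equal. lra.
Qed.

(* Pulled back by the exponential, circles become vertical segments, and Goursat's
   theorem on rectangles shows that the mean over a circle does not depend on its
   radius.  The exceptional point [z0] is needed for difference quotients. *)
Lemma mean_value_0 k R0 z0 r : 0 < r < R0 -> (forall z, Cmod z < R0 -> Ccont k z) ->
  (forall z, 0 < Cmod z < R0 -> z <> z0 -> exists l, Cderiv k z l) -> k 0 = 0 ->
  cint (fun t => k (circ r t)) (- PI) PI = 0.
Proof.
  intros Hr HC HD H0. assert (PP := PI_RGT_0).
  set (K := fun w => k (Cexp w)).
  assert (Hx : forall x, x <= ln r -> 0 < exp x < R0).
  { intros x Hx. split; [apply exp_pos|]. apply Rle_lt_trans with r; [|lra].
    rewrite <- (exp_ln r) by lra. destruct Hx as [Hx|Hx]; [left; apply exp_increasing; auto|right; f_equal; auto]. }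
  assert (KC : forall x y, x <= ln r -> Ccont K (x, y)).
  { intros x y Hxr. unfold K. apply Ccont_comp; [apply Ccont_Cexp|]. apply HC. rewrite Cmod_Cexp. simpl. apply Hx; auto. }
  assert (KD : forall x y, x <= ln r -> Cexp (x, y) <> z0 -> exists l, Cderiv K (x, y) l).
  { intros x y Hxr Hn. destruct (HD (Cexp (x, y))) as [l Hl]; auto.
    - rewrite Cmod_Cexp. simpl. apply Hx; auto.
    - exists (l * Cexp (x, y))%C. apply (Cderiv_comp Cexp k); auto. apply Cderiv_Cexp. }
  (* Height PI rather than 2 PI, so that [Cexp_inj_strip] leaves at most one preimage of [z0] in the
     rectangle. *)
  assert (Half : forall a c, a <= ln r -> rectint K a (ln r) c (c + PI) = 0).
  { intros a c Ha.
    destruct (classic (exists px py, a <= px <= ln r /\ c <= py <= c + PI /\ Cexp (px, py) = z0))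
      as [(px & py & Hpx & Hpy & E)|N].
    - apply goursat_except with px py; auto; try lra.
      + intros x y Hx1 Hy1. apply KC; lra.
      + intros x y Hx1 Hy1 Hn. apply KD; [lra|]. intros E2. apply Hn.
        apply Cexp_inj_strip; [|congruence]. apply Rabs_le; lra.
    - apply goursat; try lra. intros x y Hx1 Hy1. apply KD; [lra|].
      intros E. apply N. exists x, y. auto. }
  assert (Full : forall a, a <= ln r -> cint (fun t => k (circ r t)) (- PI) PI
     = cint (fun t => K (a, t)) (- PI) PI).
  { intros a Ha.
    assert (R1 : rectint K a (ln r) (- PI) PI = 0).
    { rewrite (rect_split_y K a (ln r) (- PI) 0 PI); try lra.
      - assert (X1 := Half a (- PI) Ha). replace (- PI + PI) with 0 in X1 by ring.
        assert (X2 := Half a 0 Ha). rewrite Rplus_0_l in X2. rewrite X1, X2. ring.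
      - intros x y Hx1 Hy1. apply KC; lra. }
    unfold rectint in R1.
    (* By periodicity the two horizontal sides cancel, so the two vertical sides carry equal
       integrals. *)
    rewrite (cint_ext (fun x => K (x, - PI)) (fun x => K (x, PI))) in R1; auto.
    2:{ intros t _. unfold K. f_equal. unfold Cexp; simpl. rewrite cos_neg, sin_neg, sin_PI.
        f_equal; ring. }
    change (cint (fun y => K (ln r, y)) (- PI) PI) with (cint (fun t => k (circ r t)) (- PI) PI) in R1.
    set (A := cint (fun t => k (circ r t)) (- PI) PI) in *.
    set (B := cint (fun y => K (a, y)) (- PI) PI) in *.
    replace A with (B + (/ Ci) * (Ci * (A - B)))%C by (field; intros E; injection E; lra).
    replace (Ci * (A - B))%C with (RtoC 0); [ring|]. rewrite <- R1. ring. }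
  apply Cmod_eq_0. apply Rle_antisym; [|apply Cmod_ge_0].
  apply le_epsilon. intros e He. rewrite Rplus_0_l.
  assert (C0 : Cmod 0 < R0) by (rewrite Cmod_0; lra).
  destruct (HC 0 C0 (e / (4 * PI))) as [d [Hd H1]]; [apply Rdiv_lt_0_compat; lra|].
  (* Far to the left the circle is so small that continuity at 0 and [k 0 = 0] make the integrand
     small. *)
  set (a := Rmin (ln r) (ln (d / 2))).
  rewrite (Full a) by apply Rmin_l.
  replace e with (2 * (e / (4 * PI)) * (PI - - PI)) by (field; lra).
  apply cint_norm; [lra| |].
  - intros t _. apply Ccont_vert, KC, Rmin_l.
  - intros t _. unfold K. specialize (H1 (Cexp (a, t))). rewrite H0 in H1.
    replace (k (Cexp (a, t)) - 0)%C with (k (Cexp (a, t))) in H1 by ring. left; apply H1.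
    replace (Cexp (a, t) - 0)%C with (Cexp (a, t)) by ring. rewrite Cmod_Cexp. simpl.
    apply Rle_lt_trans with (d / 2); [|lra]. rewrite <- (exp_ln (d / 2)) by lra.
    destruct (Rmin_r (ln r) (ln (d / 2))) as [L|L]; [left; apply exp_increasing; auto|right; f_equal; auto].
Qed.

Lemma cint_conj g a b : a <= b -> rcont_on g a b ->
  cint (fun t => Cconj (g t)) a b = Cconj (cint g a b).
Proof.
  intros L H. unfold cint, Cconj. simpl. f_equal.
  apply (RInt_opp (V := R_CompleteNormedModule)). apply rcont_ex_Im; auto.
Qed.

Lemma circ_inv_pow r t n : 0 < r -> (/ circ r t ^ n)%C = (RtoC (/ (r * r) ^ n) * Cconj (circ r t ^ n))%C.
Proof.
  intros Hr. assert (Hp := Cpow_nz _ n (circ_neq0 r t)).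
  assert (E : (circ r t ^ n * Cconj (circ r t ^ n))%C = RtoC ((r * r) ^ n)).
  { rewrite <- Cmod2_conj. rewrite Cmod_pow, Cmod_circ by auto. f_equal.
    rewrite <- pow_mult, Nat.mul_comm, pow_mult. f_equal. ring. }
  assert (P : 0 < (r * r) ^ n) by (apply pow_lt; nra).
  rewrite RtoC_inv by lra. rewrite <- E. field. split; auto.
  intros Z. assert (M := f_equal Cmod Z). rewrite Cmod_conj, Cmod_0 in M.
  apply Cmod_eq_0 in M. exact (Hp M).
Qed.

(** On the circle 1 / z^n is a real multiple of the conjugate of z^n, and z^n has mean 0 since it
    vanishes at the origin. *)
Lemma cint_circ_neg_pow r n : 0 < r -> (1 <= n)%nat ->
  cint (fun t => / circ r t ^ n)%C (- PI) PI = 0.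
Proof.
  intros Hr Hn. assert (PP := PI_RGT_0).
  assert (HD : forall z, exists l, Cderiv (fun w => w ^ n)%C z l)
    by (intros z; eexists; apply (Cderiv_pow n (fun w => w)), Cderiv_id).
  assert (HC : forall z, Ccont (fun w => w ^ n)%C z)
    by (intros z; destruct (HD z) as [l Hl]; eapply Cderiv_cont; eauto).
  rewrite (cint_ext _ (fun t => RtoC (/ (r * r) ^ n) * Cconj (circ r t ^ n))%C) by
    (try lra; intros; apply circ_inv_pow; auto).
  assert (RC : rcont_on (fun t => circ r t ^ n)%C (- PI) PI)
    by (intros t _; apply (circ_cont (fun w => w ^ n)%C); auto).
  rewrite cint_scal; [|lra|].
  - rewrite cint_conj by (auto; lra).
    rewrite (mean_value_0 (fun w => w ^ n)%C (r + 1) 0 r); auto; [|lra|].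
    + unfold Cconj; simpl. apply C_eq; simpl; ring.
    + destruct n; [lia|]. rewrite Cpow_S. ring.
  - intros t Ht eps He. destruct (RC t Ht eps He) as [d [Hd H1]]. exists d; split; auto.
    intros s Hs. replace (Cconj (circ r s ^ n) - Cconj (circ r t ^ n))%C
      with (Cconj (circ r s ^ n - circ r t ^ n)) by (unfold Cconj; apply C_eq; simpl; ring).
    rewrite Cmod_conj. auto.
Qed.

Lemma rcont_bounded g a b : a <= b -> rcont_on g a b -> exists M, 0 < M /\ forall t, a <= t <= b -> Cmod (g t) <= M.
Proof.
  intros L H.
  destruct (continuity_ab_maj (fun t => Cmod (g t)) a b L) as [m [Hm _]].
  - intros t Ht. apply continuity_pt_locally. intros eps.
    destruct (H t Ht eps (cond_pos eps)) as [d [Hd H1]]. exists (mkposreal d Hd).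
    intros s Hs. specialize (H1 s Hs). apply Rabs_def1.
    + assert (X := Cmod_ge_minus (g s) (g t)). lra.
    + assert (X := Cmod_ge_minus (g t) (g s)). rewrite Cmod_minus_sym in X. lra.
  - exists (Cmod (g m) + 1). assert (X := Cmod_ge_0 (g m)). split; [lra|].
    intros t Ht. specialize (Hm t Ht). lra.
Qed.

(** The Cauchy integral for the n-th Taylor coefficient, parametrised by the angle: dz = i z dt has
    absorbed i and one power of z. *)
Definition ccoef (f : C -> C) (r : R) (n : nat) : C :=
  (RtoC (/ (2 * PI)) * cint (fun t => f (circ r t) * / circ r t ^ n)%C (- PI) PI)%C.

(** The difference quotient, completed by the derivative at [z0], is continuous, and holomorphic
    elsewhere. Multiplied by z, the remnant of dz, it vanishes at 0, so [mean_value_0] applies. *)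
Lemma cauchy_integral f R0 r z0 : 0 < r < R0 -> holo (fun z => Cmod z < R0) f -> Cmod z0 < r ->
  cint (fun t => circ r t * ((f (circ r t) - f z0) / (circ r t - z0)))%C (- PI) PI = 0.
Proof.
  intros Hr Hf Hz. assert (PP := PI_RGT_0).
  destruct (Hf z0) as [l Hl]; [lra|].
  set (h := fun z => if excluded_middle_informative (z = z0) then l else ((f z - f z0) / (z - z0))%C).
  assert (Hh : forall z, z <> z0 -> h z = ((f z - f z0) / (z - z0))%C).
  { intros z N. unfold h. destruct excluded_middle_informative; congruence. }
  assert (Hh0 : h z0 = l) by (unfold h; destruct excluded_middle_informative; congruence).
  assert (HD : forall z, Cmod z < R0 -> z <> z0 -> exists m, Cderiv h z m).
  { intros z Hz1 N. destruct (Hf z Hz1) as [m Hm].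
    assert (N' := Cminus_neq0 _ _ N).
    eexists. eapply (Cderiv_ext_loc (fun w => (f w - f z0) / (w - z0))%C h z _ (Cmod (z - z0)%C)).
    - apply Cmod_gt_0; auto.
    - intros w Hw. symmetry; apply Hh. intros ->. rewrite Cmod_minus_sym in Hw. lra.
    - apply (Cderiv_div (fun w => f w - f z0)%C (fun w => w - z0)%C); auto;
        (apply Cderiv_minus; [|apply Cderiv_const]); [exact Hm|apply Cderiv_id]. }
  assert (HC : forall z, Cmod z < R0 -> Ccont h z).
  { intros z Hz1. destruct (classic (z = z0)) as [->|N].
    - intros eps He. destruct (Hl (eps / 2)) as [d [Hd H1]]; [lra|].
      exists d; split; auto. intros w Hw. rewrite Hh0.
      destruct (classic (w = z0)) as [->|N].
      + rewrite Hh0. replace (l - l)%C with (RtoC 0) by ring. rewrite Cmod_0; auto.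
      + rewrite (Hh w N). assert (N' := Cminus_neq0 _ _ N).
        specialize (H1 w Hw).
        replace ((f w - f z0) / (w - z0) - l)%C with ((f w - f z0 - l * (w - z0)) / (w - z0))%C
          by (field; auto).
        assert (P : 0 < Cmod (w - z0)%C) by (apply Cmod_gt_0; auto).
        rewrite Cmod_div by auto. apply Rle_lt_trans with (eps / 2); [|lra].
        apply Rmult_le_reg_r with (Cmod (w - z0)%C); auto.
        unfold Rdiv at 1. rewrite Rmult_assoc, Rinv_l by lra. lra.
    - destruct (HD z Hz1 N) as [m Hm]. eapply Cderiv_cont; eauto. }
  rewrite (cint_ext _ (fun t => (fun z => z * h z)%C (circ r t))); [|lra|].
  - apply (mean_value_0 (fun z => z * h z)%C R0 z0 r Hr).
    + intros z Hz1 eps He.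
      destruct (classic (z = z0)) as [E|N].
      * assert (Cz := HC z Hz1). subst z.
        assert (Pl := Cmod_ge_0 l). assert (Pz := Cmod_ge_0 z0).
        destruct (Cz (Rmin 1 (eps / (2 * (Cmod z0 + 1))))) as [d [Hd H1]].
        { apply Rmin_pos; [lra|apply Rdiv_lt_0_compat; lra]. }
        exists (Rmin d (eps / (2 * (Cmod l + 2)))). split.
        { apply Rmin_pos; auto. apply Rdiv_lt_0_compat; lra. }
        intros w Hw. specialize (H1 w (Rlt_le_trans _ _ _ Hw (Rmin_l _ _))).
        assert (W := Rlt_le_trans _ _ _ Hw (Rmin_r _ _)).
        assert (A1 := Rlt_le_trans _ _ _ H1 (Rmin_l _ _)).
        assert (A2 := Rlt_le_trans _ _ _ H1 (Rmin_r _ _)).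
        replace (w * h w - z0 * h z0)%C with ((w - z0) * h w + z0 * (h w - h z0))%C by ring.
        eapply Rle_lt_trans; [apply Cmod_triangle|]. rewrite !Cmod_mult.
        assert (B1 : Cmod (h w) <= Cmod l + 1).
        { replace (h w) with (h z0 + (h w - h z0))%C by ring.
          eapply Rle_trans; [apply Cmod_triangle|]. rewrite Hh0 in *. lra. }
        assert (B2 : Cmod (w - z0)%C * Cmod (h w) <= eps / (2 * (Cmod l + 2)) * (Cmod l + 1)).
        { apply Rmult_le_compat; auto using Cmod_ge_0. lra. }
        assert (B3 : Cmod z0 * Cmod (h w - h z0)%C <= Cmod z0 * (eps / (2 * (Cmod z0 + 1)))).
        { apply Rmult_le_compat_l; lra. }
        assert (X1 : eps / (2 * (Cmod l + 2)) * (Cmod l + 1) < eps / 2).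
        { apply Rlt_le_trans with (eps / (2 * (Cmod l + 2)) * (Cmod l + 2)).
          - apply Rmult_lt_compat_l; [apply Rdiv_lt_0_compat|]; lra.
          - right; field; lra. }
        assert (X2 : Cmod z0 * (eps / (2 * (Cmod z0 + 1))) <= eps / 2).
        { apply Rle_trans with ((Cmod z0 + 1) * (eps / (2 * (Cmod z0 + 1)))).
          - apply Rmult_le_compat_r; [left; apply Rdiv_lt_0_compat|]; lra.
          - right; field; lra. }
        lra.
      * destruct (HD z Hz1 N) as [m Hm].
        exact (Cderiv_cont _ _ _ (Cderiv_mult (fun w => w) h z _ _ (Cderiv_id z) Hm) eps He).
    + intros z Hz1 N. destruct (HD z (proj2 Hz1) N) as [m Hm]. eexists.
      apply (Cderiv_mult (fun w => w) h z _ _ (Cderiv_id z) Hm).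
    + simpl. ring.
  - intros t _. simpl. rewrite Hh; auto. intros E.
    assert (M := Cmod_circ r t ltac:(lra)). rewrite E in M. lra.
Qed.

Lemma cint_csum (u : nat -> C) (g : nat -> R -> C) a b n : a <= b ->
  (forall m, rcont_on (g m) a b) ->
  rcont_on (fun t => csum (fun m => u m * g m t)%C n) a b /\
  cint (fun t => csum (fun m => u m * g m t)%C n) a b = csum (fun m => u m * cint (g m) a b)%C n.
Proof.
  intros L H. induction n as [|n [IH1 IH2]]; simpl.
  - split; [intros t _; apply rcont_const|]. rewrite cint_const. ring.
  - split.
    + intros t Ht. apply (rcont_plus _ (fun t => u n * g n t)%C); auto. apply rcont_scal, H; auto.
    + rewrite (cint_plus (fun t => csum (fun m => u m * g m t)%C n) (fun t => u n * g n t)%C); auto.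
      * rewrite IH2, cint_scal; auto.
      * intros t Ht. apply rcont_scal, H; auto.
Qed.

Lemma geom_split (z w : C) n : z <> 0 -> z <> w ->
  (z / (z - w) = csum (fun m => w ^ m * / z ^ m) n + (w ^ n * / z ^ n) * (z / (z - w)))%C.
Proof.
  intros Hz Hw. assert (N := Cminus_neq0 _ _ Hw).
  induction n as [|n IH].
  - simpl. field. auto.
  - rewrite IH at 1. simpl csum. rewrite !Cpow_S.
    assert (P := Cpow_nz z n Hz). field. auto.
Qed.

(** The Cauchy kernel is expanded by the finite identity [geom_split] with its exact remainder, so
    no limit is interchanged with the integral; the remainder is of size (|z0| / r)^n. *)
Theorem cauchy_ps f R0 r z0 : 0 < r < R0 -> holo (fun z => Cmod z < R0) f -> Cmod z0 < r ->
  PS (ccoef f r) z0 (f z0).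
Proof.
  intros Hr Hf Hz. assert (PP := PI_RGT_0). assert (Pz := Cmod_ge_0 z0).
  assert (CI := cauchy_integral f R0 r z0 Hr Hf Hz).
  assert (Hn : forall t, circ r t <> z0).
  { intros t E. assert (M := Cmod_circ r t ltac:(lra)). rewrite E in M. lra. }
  assert (FC : forall F, (forall t, Ccont F (circ r t)) -> rcont_on (fun t => F (circ r t)) (- PI) PI)
    by (intros F HF t _; apply circ_cont; auto).
  assert (Fder : forall t, exists l, Cderiv f (circ r t) l)
    by (intros t; apply Hf; rewrite Cmod_circ; lra).
  set (g := fun t => (circ r t * ((f (circ r t) - f z0) / (circ r t - z0)))%C) in *.
  assert (gC : rcont_on g (- PI) PI).
  { apply (FC (fun z => z * ((f z - f z0) / (z - z0)))%C). intros t.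
    destruct (Fder t) as [l Hl]. eapply Cderiv_cont. apply Cderiv_mult; [apply Cderiv_id|].
    apply (Cderiv_div (fun z => f z - f z0)%C (fun z => z - z0)%C); [apply Cminus_neq0, Hn| |];
    (apply Cderiv_minus; [|apply Cderiv_const]); [exact Hl|apply Cderiv_id]. }
  destruct (rcont_bounded g (- PI) PI ltac:(lra) gC) as [M [HM0 HM]].
  (* The constant [f z0] is expanded along with [f]: it contributes only for m = 0, since negative
     powers have mean 0 on the circle. *)
  set (gm := fun m t => (f (circ r t) * / circ r t ^ m - f z0 * / circ r t ^ m)%C).
  assert (pC : forall m, rcont_on (fun t => / circ r t ^ m)%C (- PI) PI).
  { intros m. apply (FC (fun z => / z ^ m)%C). intros t. eapply Cderiv_cont.
    apply (Cderiv_inv (fun z => z ^ m)%C); [apply Cpow_nz, circ_neq0|].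
    apply (Cderiv_pow m (fun z => z)), Cderiv_id. }
  assert (fC : forall m, rcont_on (fun t => f (circ r t) * / circ r t ^ m)%C (- PI) PI).
  { intros m. apply (FC (fun z => f z * / z ^ m)%C). intros t. destruct (Fder t) as [l Hl].
    eapply Cderiv_cont. apply Cderiv_mult; [exact Hl|].
    apply (Cderiv_inv (fun z => z ^ m)%C); [apply Cpow_nz, circ_neq0|].
    apply (Cderiv_pow m (fun z => z)), Cderiv_id. }
  assert (gmC : forall m, rcont_on (gm m) (- PI) PI).
  { intros m t Ht. unfold gm.
    intros eps He.
    destruct (rcont_plus _ _ t (fC m t Ht) (rcont_scal (- f z0)%C _ t (pC m t Ht)) eps He) as [d [Hd H1]].
    exists d; split; auto. intros s Hs. specialize (H1 s Hs).
    match goal with |- Cmod ?x < _ => match type of H1 with Cmod ?y < _ => replace x with y by ring end end.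
    exact H1. }
  assert (gmI : forall m, cint (gm m) (- PI) PI
     = (RtoC (2 * PI) * (ccoef f r m - (if Nat.eqb m 0 then f z0 else 0)))%C).
  { intros m. unfold gm.
    rewrite (cint_ext _ (fun t => f (circ r t) * / circ r t ^ m + (- f z0) * / circ r t ^ m)%C)
      by (try lra; intros; ring).
    rewrite cint_plus; [|lra|apply fC|intros t Ht; apply rcont_scal, pC; auto].
    rewrite cint_scal by (try lra; apply pC).
    unfold ccoef. destruct m as [|m]; simpl Nat.eqb; cbv iota.
    - rewrite (cint_ext (fun t => / circ r t ^ 0)%C (fun _ => 1)) by (try lra; intros; simpl; field; intros E; injection E; lra).
      rewrite cint_const. replace (PI - - PI) with (2 * PI) by ring.
      rewrite RtoC_inv by lra. field. intros E. injection E. lra.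
    - rewrite cint_circ_neg_pow by (lra || lia). rewrite RtoC_inv by lra. field.
      intros E. injection E. lra. }
  set (q := Cmod z0 / r).
  assert (Hq : 0 <= q < 1).
  { unfold q. apply ratio_bounds; lra. }
  assert (Key : forall n, Cmod (csum (fun m => ccoef f r m * z0 ^ m)%C (S n) - f z0)%C <= 2 * M * q ^ S n).
  { intros n.
    assert (E1 : cint g (- PI) PI = (csum (fun m => z0 ^ m * cint (gm m) (- PI) PI)%C (S n)
        + z0 ^ S n * cint (fun t => / circ r t ^ S n * g t)%C (- PI) PI)%C).
    { destruct (cint_csum (fun m => z0 ^ m)%C gm (- PI) PI (S n) ltac:(lra) gmC) as [S1 S2].
      assert (RC : rcont_on (fun t => / circ r t ^ S n * g t)%C (- PI) PI).
      { apply (FC (fun z => / z ^ S n * (z * ((f z - f z0) / (z - z0))))%C). intros t.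
        destruct (Fder t) as [l Hl]. eapply Cderiv_cont. apply Cderiv_mult.
        - apply (Cderiv_inv (fun z => z ^ S n)%C); [apply Cpow_nz, circ_neq0|].
          apply (Cderiv_pow (S n) (fun z => z)), Cderiv_id.
        - apply Cderiv_mult; [apply Cderiv_id|].
          apply (Cderiv_div (fun z => f z - f z0)%C (fun z => z - z0)%C); [apply Cminus_neq0, Hn| |];
          (apply Cderiv_minus; [|apply Cderiv_const]); [exact Hl|apply Cderiv_id]. }
      rewrite <- S2, <- (cint_scal (z0 ^ S n)%C) by (auto; lra).
      rewrite <- cint_plus; auto; [|lra|intros t Ht; apply rcont_scal, RC; auto].
      apply cint_ext; [lra|]. intros t _. unfold g.
      assert (N := Cminus_neq0 _ _ (Hn t)).
      replace (circ r t * ((f (circ r t) - f z0) / (circ r t - z0)))%C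
        with ((f (circ r t) - f z0) * (circ r t / (circ r t - z0)))%C by (field; auto).
      rewrite (geom_split (circ r t) z0 (S n) (circ_neq0 r t) (Hn t)) at 1.
      rewrite Cmult_plus_distr_l, <- csum_scal. f_equal.
      - apply csum_ext. intros k _. unfold gm. ring.
      - ring. }
    rewrite CI in E1.
    assert (E2 : csum (fun m => z0 ^ m * cint (gm m) (- PI) PI)%C (S n)
      = (RtoC (2 * PI) * (csum (fun m => ccoef f r m * z0 ^ m)%C (S n) - f z0))%C).
    { rewrite (csum_ext _ (fun m => RtoC (2 * PI) * (ccoef f r m * z0 ^ m - (if Nat.eqb m 0 then f z0 else 0)))%C).
      2:{ intros m _. rewrite gmI. destruct m; simpl; [|destruct (z0 ^ m)%C]; ring. }
      rewrite csum_scal, csum_minus. f_equal. f_equal. rewrite csum_shift. cbn [Nat.eqb].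
      rewrite csum_zero by auto. ring. }
    rewrite E2 in E1.
    set (T := (csum (fun m => ccoef f r m * z0 ^ m)%C (S n) - f z0)%C) in *.
    set (I := cint (fun t => / circ r t ^ S n * g t)%C (- PI) PI) in *.
    assert (BI : Cmod I <= 2 * (/ r ^ S n * M) * (PI - - PI)).
    { apply cint_norm; [lra| |].
      - apply (FC (fun z => / z ^ S n * (z * ((f z - f z0) / (z - z0))))%C). intros t.
        destruct (Fder t) as [l Hl]. eapply Cderiv_cont. apply Cderiv_mult.
        + apply (Cderiv_inv (fun z => z ^ S n)%C); [apply Cpow_nz, circ_neq0|].
          apply (Cderiv_pow (S n) (fun z => z)), Cderiv_id.
        + apply Cderiv_mult; [apply Cderiv_id|].
          apply (Cderiv_div (fun z => f z - f z0)%C (fun z => z - z0)%C); [apply Cminus_neq0, Hn| |];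
          (apply Cderiv_minus; [|apply Cderiv_const]); [exact Hl|apply Cderiv_id].
      - intros t Ht. rewrite Cmod_mult, Cmod_inv, Cmod_pow, Cmod_circ by (try lra; apply Cpow_nz, circ_neq0).
        apply Rmult_le_compat_l; auto. left; apply Rinv_0_lt_compat, pow_lt; lra. }
    assert (E3 : (RtoC (2 * PI) * T)%C = (- (z0 ^ S n * I))%C).
    { replace (RtoC (2 * PI) * T)%C with ((RtoC (2 * PI) * T + z0 ^ S n * I) - z0 ^ S n * I)%C by ring.
      rewrite <- E1. ring. }
    apply (f_equal Cmod) in E3. rewrite Cmod_opp, !Cmod_mult, Cmod_R, Cmod_pow, Rabs_pos_eq in E3 by lra.
    apply Rmult_le_reg_l with (2 * PI); [lra|]. rewrite E3.
    eapply Rle_trans; [apply Rmult_le_compat_l; [apply pow_le; auto|exact BI]|].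
    right. unfold q, Rdiv. rewrite Rpow_mult_distr, pow_inv. ring. }
  intros eps He.
  destruct (pow_lt_1_zero q ltac:(rewrite Rabs_pos_eq; lra) (eps / (2 * M))) as [N HN];
    [apply Rdiv_lt_0_compat; lra|].
  exists (S N). intros n Hn'. destruct n as [|n]; [lia|].
  eapply Rle_lt_trans; [apply Key|]. specialize (HN (S n) ltac:(lia)).
  rewrite Rabs_pos_eq in HN by (apply pow_le; lra).
  apply Rlt_le_trans with (2 * M * (eps / (2 * M))).
  - apply Rmult_lt_compat_l; lra.
  - right; field; lra.
Qed.

Lemma ccoef_bound f R0 r M : 0 < r < R0 -> holo (fun z => Cmod z < R0) f ->
  (forall z, Cmod z = r -> Cmod (f z) <= M) -> forall n, Cmod (ccoef f r n) * r ^ n <= 2 * M.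
Proof.
  intros Hr Hf HM n. assert (PP := PI_RGT_0). unfold ccoef.
  assert (Pn : 0 < r ^ n) by (apply pow_lt; lra).
  rewrite Cmod_mult, Cmod_R, Rabs_pos_eq by (left; apply Rinv_0_lt_compat; lra).
  assert (B : Cmod (cint (fun t => f (circ r t) * / circ r t ^ n)%C (- PI) PI)
    <= 2 * (M * / r ^ n) * (PI - - PI)).
  { apply cint_norm; [lra| |].
    - intros t _. apply (circ_cont (fun z => f z * / z ^ n)%C).
      destruct (Hf (circ r t)) as [l Hl]; [rewrite Cmod_circ; lra|].
      eapply Cderiv_cont. apply Cderiv_mult; [exact Hl|].
      apply (Cderiv_inv (fun z => z ^ n)%C); [apply Cpow_nz, circ_neq0|].
      apply (Cderiv_pow n (fun z => z)), Cderiv_id.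
    - intros t _. rewrite Cmod_mult, Cmod_inv, Cmod_pow, Cmod_circ by (try lra; apply Cpow_nz, circ_neq0).
      apply Rmult_le_compat_r; [left; apply Rinv_0_lt_compat; auto|]. apply HM, Cmod_circ; lra. }
  apply Rle_trans with (/ (2 * PI) * (2 * (M * / r ^ n) * (PI - - PI)) * r ^ n).
  - apply Rmult_le_compat_r; [lra|]. apply Rmult_le_compat_l; auto.
    left; apply Rinv_0_lt_compat; lra.
  - right. field. lra.
Qed.

(** * Consequences of Cauchy's formula *)

Lemma PS_bounded a z l : PS a z l -> exists M, 0 < M /\ forall n, Cmod (a n) * Cmod z ^ n <= M.
Proof.
  intros H. destruct (Cser_bounded_terms _ _ H) as [M [HM HB]]. exists M; split; auto.
  intros n. specialize (HB n). rewrite Cmod_mult, Cmod_pow in HB. exact HB.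
Qed.

Lemma PS_bounded_disc a r f rho : 0 <= rho < r -> (forall z, Cmod z < r -> PS a z (f z)) ->
  exists M, 0 < M /\ forall n, Cmod (a n) * rho ^ n <= M.
Proof.
  intros Hr H. assert (X := H (RtoC rho)). rewrite Cmod_R, Rabs_pos_eq in X by lra.
  destruct (PS_bounded _ _ _ (X ltac:(lra))) as [M [HM HB]]. exists M; split; auto.
  intros n. specialize (HB n). rewrite Cmod_R, Rabs_pos_eq in HB by lra. exact HB.
Qed.

Lemma PSf_eq a z l : PS a z l -> PSf a z = l.
Proof. apply Csum_eq. Qed.

Lemma PS_disc_deriv a r f : 0 < r -> (forall z, Cmod z < r -> PS a z (f z)) ->
  forall z, Cmod z < r -> Cderiv f z (PSf (PSd a) z) /\ PS (PSd a) z (PSf (PSd a) z).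
Proof.
  intros Hr H z Hz. assert (Pz := Cmod_ge_0 z).
  destruct (PS_bounded_disc a r f ((Cmod z + r) / 2) ltac:(lra) H) as [M [HM HB]].
  destruct (PS_deriv a ((Cmod z + r) / 2) M z ltac:(lra) HB ltac:(lra)) as [D P].
  split; auto. apply (Cderiv_ext_loc (PSf a) f z _ (r - Cmod z)); auto; [lra|].
  intros w Hw. apply PSf_eq, H.
  assert (T := Cmod_triangle (w - z)%C z). replace (w - z + z)%C with w in T by ring. lra.
Qed.

Lemma PS_disc_holo a r f : 0 < r -> (forall z, Cmod z < r -> PS a z (f z)) ->
  holo (fun z => Cmod z < r) f.
Proof. intros Hr H z Hz. exists (PSf (PSd a) z). apply (PS_disc_deriv a r f); auto. Qed.

Lemma holo_derivative f r : 0 < r -> holo (fun z => Cmod z < r) f ->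
  forall r1, 0 < r1 < r -> exists f1, (forall z, Cmod z < r1 -> Cderiv f z (f1 z)) /\
    holo (fun z => Cmod z < r1) f1.
Proof.
  intros Hr Hf r1 Hr1. exists (PSf (PSd (ccoef f r1))).
  assert (P : forall z, Cmod z < r1 -> PS (ccoef f r1) z (f z))
    by (intros; apply (cauchy_ps f r); auto).
  split.
  - intros z Hz. apply (PS_disc_deriv (ccoef f r1) r1 f); auto; lra.
  - apply (PS_disc_holo (PSd (ccoef f r1)) r1); [lra|]. intros z Hz.
    apply (PS_disc_deriv (ccoef f r1) r1 f); auto; lra.
Qed.

Lemma pow_unbounded x K : 1 < x -> exists n, K < x ^ n.
Proof.
  intros Hx. destruct (Pow_x_infinity x ltac:(rewrite Rabs_pos_eq; lra) (K + 1)) as [N HN].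
  exists N. specialize (HN N ltac:(lia)). rewrite Rabs_pos_eq in HN by (apply pow_le; lra). lra.
Qed.

Lemma coef_sum_bound a z l r M : 0 < r -> (forall n, Cmod (a n) * r ^ n <= M) -> Cmod z < r ->
  PS a z l -> Cmod l <= M / (1 - Cmod z / r).
Proof.
  intros Hr H Hz HP. destruct (PS_conv a z r M Hr H Hz) as [l' [Hl' B]].
  rewrite (Cser_unique _ _ _ HP Hl'). specialize (B O). simpl in B.
  replace (l' - 0)%C with l' in B by ring. lra.
Qed.

(* The lossy coefficient bound for [f^n] becomes sharp as [n] grows. *)
Theorem maximum_modulus f R0 r M : 0 < r < R0 -> holo (fun z => Cmod z < R0) f ->
  (forall z, Cmod z = r -> Cmod (f z) <= M) -> forall z, Cmod z <= r -> Cmod (f z) <= M.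
Proof.
  intros Hr Hf HM z [Hz|Hz]; [|auto].
  apply Rnot_lt_le. intros N. assert (Pz := Cmod_ge_0 z).
  assert (PM : 0 <= M).
  { eapply Rle_trans; [apply Cmod_ge_0|apply (HM (RtoC r))]. rewrite Cmod_R, Rabs_pos_eq; lra. }
  set (M' := (M + Cmod (f z)) / 2). assert (HM' : M < M' < Cmod (f z)) by (unfold M'; lra).
  set (K := 2 / (1 - Cmod z / r)).
  destruct (pow_unbounded (Cmod (f z) / M') K) as [n Hn].
  { apply Rmult_lt_reg_r with M'; [lra|]. unfold Rdiv. rewrite Rmult_assoc, Rinv_l; lra. }
  assert (Hfn : holo (fun z => Cmod z < R0) (fun z => f z ^ n)%C).
  { intros w Hw. destruct (Hf w Hw) as [l Hl]. eexists. apply (Cderiv_pow n f); eauto. }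
  assert (P := cauchy_ps _ R0 r z Hr Hfn Hz).
  assert (B := ccoef_bound _ R0 r (M ^ n) Hr Hfn).
  assert (Q : Cmod (f z ^ n)%C <= 2 * M ^ n / (1 - Cmod z / r)).
  { apply (coef_sum_bound (ccoef (fun z => f z ^ n)%C r) z); auto; [lra|].
    apply B. intros w Hw. rewrite Cmod_pow. apply pow_incr. split; [apply Cmod_ge_0|auto]. }
  rewrite Cmod_pow in Q.
  assert (HK : 0 <= K).
  { unfold K. apply Rdiv_le_0_compat; [lra|].
    assert (Cmod z / r < 1); [|lra].
    apply Rmult_lt_reg_r with r; [lra|]. unfold Rdiv. rewrite Rmult_assoc, Rinv_l; lra. }
  assert (PM' : 0 < M' ^ n) by (apply pow_lt; lra).
  assert (Q2 : Cmod (f z) ^ n <= K * M' ^ n).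
  { eapply Rle_trans; [exact Q|]. replace (2 * M ^ n / (1 - Cmod z / r)) with (K * M ^ n)
      by (unfold K, Rdiv; ring). apply Rmult_le_compat_l; auto. apply pow_incr; lra. }
  unfold Rdiv in Hn. rewrite Rpow_mult_distr, pow_inv in Hn.
  apply (Rmult_lt_compat_r (M' ^ n)) in Hn; auto.
  rewrite Rmult_assoc, Rinv_l in Hn; lra.
Qed.

Lemma Cderiv_unique f w l m : Cderiv f w l -> Cderiv f w m -> l = m.
Proof.
  intros H1 H2. destruct (classic (l = m)) as [|N]; auto. exfalso.
  assert (PN : 0 < Cmod (l - m)%C) by (apply Cmod_gt_0, Cminus_neq0; auto).
  destruct (H1 (Cmod (l - m)%C / 4)) as [d1 [D1 Q1]]; [lra|].
  destruct (H2 (Cmod (l - m)%C / 4)) as [d2 [D2 Q2]]; [lra|].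
  set (h := Rmin d1 d2 / 2). assert (Hh : 0 < h) by (unfold h; assert (0 < Rmin d1 d2) by (apply Rmin_pos; auto); lra).
  assert (Hh1 : h < d1) by (unfold h; assert (X := Rmin_l d1 d2); unfold h in Hh; lra).
  assert (Hh2 : h < d2) by (unfold h; assert (X := Rmin_r d1 d2); unfold h in Hh; lra).
  assert (E : Cmod (w + RtoC h - w)%C = h).
  { replace (w + RtoC h - w)%C with (RtoC h) by ring. rewrite Cmod_R, Rabs_pos_eq; lra. }
  specialize (Q1 (w + RtoC h)%C). specialize (Q2 (w + RtoC h)%C). rewrite E in Q1, Q2.
  specialize (Q1 Hh1). specialize (Q2 Hh2).
  replace (w + RtoC h - w)%C with (RtoC h) in Q1, Q2 by ring.
  assert (T := Cmod_triangle_minus (f (w + h)%C - f w - m * h)%C (f (w + h)%C - f w - l * h)%C).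
  replace (f (w + h)%C - f w - m * h - (f (w + h)%C - f w - l * h))%C with ((l - m) * h)%C in T by ring.
  rewrite Cmod_mult, Cmod_R, (Rabs_pos_eq h) in T by lra. nra.
Qed.

Lemma zero_deriv_const f r : (forall z, Cmod z < r -> Cderiv f z 0) ->
  forall z, Cmod z < r -> f z = f 0.
Proof.
  intros H z Hz. assert (Pz := Cmod_ge_0 z).
  set (s := (Cmod z + r) / 2). assert (Hs : Cmod z < s < r) by (unfold s; lra).
  assert (Hf : holo (fun z => Cmod z < r) f) by (intros w Hw; exists 0; auto).
  assert (P : forall w, Cmod w < s -> PS (ccoef f s) w (f w))
    by (intros; apply (cauchy_ps f r); auto; lra).
  assert (Z : forall n, PSd (ccoef f s) n = 0).
  { apply (PS_zero_coef _ s); [lra|]. intros w Hw.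
    destruct (PS_disc_deriv (ccoef f s) s f ltac:(lra) P w Hw) as [D Q].
    replace (RtoC 0) with (PSf (PSd (ccoef f s)) w); auto.
    apply (Cderiv_unique f w); auto. apply H; lra. }
  assert (A : forall w, Cmod w < s -> f w = ccoef f s 0).
  { intros w Hw. apply (Cser_unique _ _ _ (P w Hw)).
    intros eps He. exists 1%nat. intros n Hn. destruct n as [|n]; [lia|].
    rewrite csum_shift, csum_zero.
    - simpl. replace (ccoef f s 0 * 1 + 0 - ccoef f s 0)%C with (RtoC 0) by ring.
      rewrite Cmod_0; auto.
    - intros k _. specialize (Z k). unfold PSd in Z.
      assert (N0 : RtoC (INR (S k)) <> 0).
      { apply RtoC_neq0, not_0_INR. lia. }
      replace (ccoef f s (S k)) with (/ INR (S k) * (INR (S k) * ccoef f s (S k)))%C by (field; auto).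
      rewrite Z. ring. }
  rewrite A by lra. symmetry. apply A. rewrite Cmod_0; lra.
Qed.

(** The nonnegative u = A - Re f has -1/2 times the coefficients of f for n >= 1, because the
    conjugate of f contributes the conjugate of the integral of f z^n, which is 0. A coefficient of
    u is controlled by its mean A - Re (f 0). The constant is 4, not 2, because real and imaginary
    parts are bounded separately. *)
Theorem borel_caratheodory f R0 r A n : 0 < r < R0 -> holo (fun z => Cmod z < R0) f ->
  (forall z, Cmod z = r -> Re (f z) <= A) -> (1 <= n)%nat ->
  Cmod (ccoef f r n) * r ^ n <= 4 * (A - Re (f 0)).
Proof.
  intros Hr Hf HA Hn. assert (PP := PI_RGT_0).
  assert (Pn : 0 < r ^ n) by (apply pow_lt; lra).
  assert (Fder : forall t, exists l, Cderiv f (circ r t) l)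
    by (intros t; apply Hf; rewrite Cmod_circ; lra).
  assert (f0C : rcont_on (fun t => f (circ r t)) (- PI) PI).
  { intros t _. destruct (Fder t) as [l Hl]. apply (circ_cont f). eapply Cderiv_cont; eauto. }
  assert (fpC : rcont_on (fun t => f (circ r t) * circ r t ^ n)%C (- PI) PI).
  { intros t _. apply (circ_cont (fun z => f z * z ^ n)%C). destruct (Fder t) as [l Hl].
    eapply Cderiv_cont. apply Cderiv_mult; [exact Hl|]. apply (Cderiv_pow n (fun z => z)), Cderiv_id. }
  assert (pC : rcont_on (fun t => / circ r t ^ n)%C (- PI) PI).
  { intros t _. apply (circ_cont (fun z => / z ^ n)%C). eapply Cderiv_cont.
    apply (Cderiv_inv (fun z => z ^ n)%C); [apply Cpow_nz, circ_neq0|].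
    apply (Cderiv_pow n (fun z => z)), Cderiv_id. }
  assert (fC : rcont_on (fun t => f (circ r t) * / circ r t ^ n)%C (- PI) PI).
  { intros t _. apply (circ_cont (fun z => f z * / z ^ n)%C). destruct (Fder t) as [l Hl].
    eapply Cderiv_cont. apply Cderiv_mult; [exact Hl|].
    apply (Cderiv_inv (fun z => z ^ n)%C); [apply Cpow_nz, circ_neq0|].
    apply (Cderiv_pow n (fun z => z)), Cderiv_id. }
  assert (conjC : forall g, rcont_on g (- PI) PI -> rcont_on (fun t => Cconj (g t)) (- PI) PI).
  { intros g Hg t Ht eps He. destruct (Hg t Ht eps He) as [d [Hd H1]]. exists d; split; auto.
    intros s Hs. replace (Cconj (g s) - Cconj (g t))%C with (Cconj (g s - g t))
      by (unfold Cconj; apply C_eq; simpl; ring). rewrite Cmod_conj. auto. }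
  assert (Z : cint (fun t => f (circ r t) * circ r t ^ n)%C (- PI) PI = 0).
  { apply (mean_value_0 (fun z => f z * z ^ n)%C R0 0 r Hr).
    - intros z Hz. destruct (Hf z Hz) as [l Hl]. eapply Cderiv_cont.
      apply Cderiv_mult; [exact Hl|]. apply (Cderiv_pow n (fun z => z)), Cderiv_id.
    - intros z Hz _. destruct (Hf z (proj2 Hz)) as [l Hl]. eexists.
      apply Cderiv_mult; [exact Hl|]. apply (Cderiv_pow n (fun z => z)), Cderiv_id.
    - destruct n; [lia|]. rewrite Cpow_S. ring. }
  assert (Zc : cint (fun t => RtoC (/ (r * r) ^ n) * Cconj (f (circ r t) * circ r t ^ n))%C (- PI) PI = 0).
  { rewrite cint_scal by (try lra; apply conjC, fpC). rewrite cint_conj by (try lra; auto).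
    rewrite Z. apply C_eq; simpl; ring. }
  assert (Zp := cint_circ_neg_pow r n ltac:(lra) Hn).
  set (u := fun t => A - Re (f (circ r t))).
  assert (Hu : forall t, 0 <= u t) by (intros t; unfold u; assert (X := HA (circ r t) ltac:(apply Cmod_circ; lra)); lra).
  set (g := fun t => (RtoC (u t) * / circ r t ^ n)%C).
  assert (gE : forall t, g t = (RtoC A * / circ r t ^ n + (- / 2) * (f (circ r t) * / circ r t ^ n)
     + (- / 2) * (RtoC (/ (r * r) ^ n) * Cconj (f (circ r t) * circ r t ^ n)))%C).
  { intros t. unfold g. rewrite Cmult_conj.
    replace (RtoC (/ (r * r) ^ n) * (Cconj (f (circ r t)) * Cconj (circ r t ^ n)))%C
      with (Cconj (f (circ r t)) * / circ r t ^ n)%C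
      by (rewrite circ_inv_pow by lra; ring).
    replace (RtoC (u t)) with (RtoC A + - / 2 * (f (circ r t)) + - / 2 * Cconj (f (circ r t)))%C; [ring|].
    unfold u. destruct (f (circ r t)) as [p q]. apply C_eq; simpl; field. }
  set (c2 := fun t => (RtoC (/ (r * r) ^ n) * Cconj (f (circ r t) * circ r t ^ n))%C) in *.
  assert (c2C : rcont_on c2 (- PI) PI) by (intros t Ht; apply rcont_scal; apply (conjC _ fpC); auto).
  set (c1 := fun t => (f (circ r t) * / circ r t ^ n)%C) in *.
  set (c0 := fun t => (/ circ r t ^ n)%C) in *.
  assert (gI : cint g (- PI) PI = ((- / 2) * cint c1 (- PI) PI)%C).
  { rewrite (cint_ext g (fun t => (RtoC A * c0 t + (- / 2) * c1 t) + (- / 2) * c2 t)%C) by (try lra; intros; apply gE).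
    rewrite cint_plus; [|lra| |].
    - rewrite cint_plus; [|lra| |].
      + rewrite !cint_scal by (auto; lra). rewrite Zc.
        replace (cint c0 (- PI) PI) with (RtoC 0) by (symmetry; exact Zp). ring.
      + intros t Ht. apply rcont_scal; auto.
      + intros t Ht. apply rcont_scal; auto.
    - intros t Ht. apply (rcont_plus (fun t => RtoC A * c0 t)%C (fun t => - / 2 * c1 t)%C); apply rcont_scal; auto.
    - intros t Ht. apply rcont_scal; auto. }
  assert (gC : rcont_on g (- PI) PI).
  { intros t Ht eps He.
    destruct (rcont_plus (fun t => RtoC A * c0 t + (- / 2) * c1 t)%C (fun t => (- / 2) * c2 t)%C t
      (rcont_plus (fun t => RtoC A * c0 t)%C (fun t => (- / 2) * c1 t)%C t (rcont_scal _ _ _ (pC t Ht)) (rcont_scal _ _ _ (fC t Ht)))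
      (rcont_scal _ _ _ (c2C t Ht)) eps He) as [d [Hd H1]].
    exists d; split; auto. intros s Hs. rewrite !gE. apply H1; auto. }
  assert (uI : RInt u (- PI) PI = 2 * PI * (A - Re (f 0))).
  { assert (P0 := cauchy_ps f R0 r 0 Hr Hf ltac:(rewrite Cmod_0; lra)).
    assert (E0 := Cser_unique _ _ _ P0 (PS_at_0 (ccoef f r))).
    unfold u. etransitivity.
    { apply (RInt_minus (V := R_CompleteNormedModule) (fun _ => A) (fun t => Re (f (circ r t)))).
      - apply ex_RInt_const.
      - apply rcont_ex_Re; auto; lra. }
    rewrite RInt_const. rewrite E0. unfold ccoef, minus, plus, opp, scal; simpl. unfold mult; simpl.
    rewrite (RInt_ext (fun t => Re (f (circ r t) * / 1)%C) (fun t => Re (f (circ r t)))).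
    - field. lra.
    - intros t _. f_equal. field. }
  assert (uEx : ex_RInt u (- PI) PI).
  { apply (ex_RInt_minus (V := R_NormedModule) (fun _ => A) (fun t => Re (f (circ r t)))).
    - apply ex_RInt_const.
    - apply rcont_ex_Re; auto; lra. }
  assert (gB : Cmod (cint g (- PI) PI) <= 2 * (/ r ^ n * RInt u (- PI) PI)).
  { assert (gM : forall t, Cmod (g t) = / r ^ n * u t).
    { intros t. unfold g. rewrite Cmod_mult, Cmod_inv, Cmod_pow, Cmod_circ, Cmod_R, Rabs_pos_eq
        by (try apply Cpow_nz, circ_neq0; auto; lra). ring. }
    assert (sEx : ex_RInt (fun t => / r ^ n * u t) (- PI) PI)
      by (apply (ex_RInt_scal (V := R_NormedModule)); auto).
    assert (sE : RInt (fun t => / r ^ n * u t) (- PI) PI = / r ^ n * RInt u (- PI) PI)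
      by (apply (RInt_scal (V := R_CompleteNormedModule)); auto).
    rewrite <- sE.
    assert (Comp : forall h, ex_RInt h (- PI) PI -> (forall t, Rabs (h t) <= Cmod (g t)) ->
       Rabs (RInt h (- PI) PI) <= RInt (fun t => / r ^ n * u t) (- PI) PI).
    { intros h Hex Hh. apply Rabs_le. split.
      - assert (X := RInt_le (fun t => - (/ r ^ n * u t)) h (- PI) PI ltac:(lra)
          ltac:(apply (ex_RInt_opp (V := R_NormedModule)); auto) Hex).
        assert (OE : RInt (fun t => - (/ r ^ n * u t)) (- PI) PI = - RInt (fun t => / r ^ n * u t) (- PI) PI)
          by (apply (RInt_opp (V := R_CompleteNormedModule)); auto).
        rewrite OE in X. apply X. intros t _. specialize (Hh t). rewrite gM in Hh.
        apply Rabs_le_between in Hh. lra.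
      - apply RInt_le; auto; [lra|]. intros t _. specialize (Hh t). rewrite gM in Hh.
        apply Rabs_le_between in Hh. lra. }
    eapply Rle_trans; [apply Cmod_le_ReIm|].
    assert (X1 := Comp (fun t => Re (g t)) ltac:(apply rcont_ex_Re; auto; lra) ltac:(intros; apply re_le_Cmod)).
    assert (X2 := Comp (fun t => Im (g t)) ltac:(apply rcont_ex_Im; auto; lra) ltac:(intros; apply im_le_Cmod)).
    change (Re (cint g (- PI) PI)) with (RInt (fun t => Re (g t)) (- PI) PI).
    change (Im (cint g (- PI) PI)) with (RInt (fun t => Im (g t)) (- PI) PI). lra. }
  unfold ccoef. fold c1.
  assert (E1 : cint c1 (- PI) PI = (- 2 * cint g (- PI) PI)%C).
  { rewrite gI. field. }
  assert (P2 : 0 < / (2 * PI)) by (apply Rinv_0_lt_compat; lra).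
  rewrite E1, !Cmod_mult, !Cmod_R, (Rabs_pos_eq (/ (2 * PI))) by lra.
  rewrite (Rabs_left (-2)) by lra.
  rewrite uI in gB.
  apply Rle_trans with (/ (2 * PI) * (2 * (2 * (/ r ^ n * (2 * PI * (A - Re (f 0)))))) * r ^ n).
  - apply Rmult_le_compat_r; [lra|]. apply Rmult_le_compat_l; [lra|]. lra.
  - right. field. lra.
Qed.

(** * Logarithms as power series *)

(** Taylor coefficients of the branch of log (F / F(0)) that vanishes at 0. The normalisation
    [a O = 0] makes them unique when F(0) is nonzero, and products of functions become sums of
    coefficients. *)
Definition logser (F : C -> C) (r : R) (a : nat -> C) :=
  a O = 0 /\ forall z, Cmod z < r -> PS a z (PSf a z) /\ F z = (F 0 * Cexp (PSf a z))%C.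

Lemma INR_S_neq0 k : RtoC (INR (S k)) <> 0.
Proof. apply RtoC_neq0, not_0_INR. lia. Qed.

Definition PSint (e : nat -> C) (n : nat) : C :=
  match n with O => 0 | S k => (e k / INR (S k))%C end.

Lemma PSd_PSint e n : PSd (PSint e) n = e n.
Proof. unfold PSd, PSint. field. apply INR_S_neq0. Qed.

Lemma PSf_0 a : PSf a 0 = a O.
Proof. apply PSf_eq, PS_at_0. Qed.

(** If phi is the logarithmic derivative of G and p its primitive, then G exp (- p) has derivative 0
    and is constant. *)
Lemma log_of_deriv G r e phi : 0 < r -> (forall z, Cmod z < r -> PS e z (phi z)) ->
  (forall z, Cmod z < r -> Cderiv G z (phi z * G z)%C) -> logser G r (PSint e).
Proof.
  intros Hr He HG.
  assert (P : forall z, Cmod z < r -> PS (PSint e) z (PSf (PSint e) z)).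
  { intros z Hz. assert (Pz := Cmod_ge_0 z).
    destruct (PS_bounded_disc e r phi ((Cmod z + r) / 2) ltac:(lra) He) as [M [HM HB]].
    set (rho := (Cmod z + r) / 2) in *. assert (Hrho : Cmod z < rho) by (unfold rho; lra).
    apply (PSf_correct _ z rho (M * rho)); auto; [lra|].
    intros [|n].
    - simpl. rewrite Cmod_0. nra.
    - unfold PSint. rewrite Cmod_div by apply INR_S_neq0. rewrite Cmod_R, Rabs_pos_eq by apply pos_INR.
      rewrite <- tech_pow_Rmult.
      specialize (HB n). assert (I : 1 <= INR (S n)) by (rewrite S_INR; assert (X := pos_INR n); lra).
      assert (P0 := Cmod_ge_0 (e n)).
      assert (Pr : 0 <= rho * rho ^ n) by (apply Rmult_le_pos; [lra|apply pow_le; lra]).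
      apply Rle_trans with (Cmod (e n) * (rho * rho ^ n)).
      + apply Rmult_le_compat_r; auto. apply Rmult_le_reg_r with (INR (S n)); [lra|].
        unfold Rdiv. rewrite Rmult_assoc, Rinv_l by lra. nra.
      + replace (Cmod (e n) * (rho * rho ^ n)) with (Cmod (e n) * rho ^ n * rho) by ring.
        apply Rmult_le_compat_r; lra. }
  split; [reflexivity|]. intros z Hz. split; auto.
  assert (K : (G z * Cexp (- PSf (PSint e) z))%C = (G 0 * Cexp (- PSf (PSint e) 0))%C).
  { apply (zero_deriv_const (fun z => G z * Cexp (- PSf (PSint e) z))%C r); auto.
    clear z Hz. intros z Hz.
    destruct (PS_disc_deriv (PSint e) r _ Hr P z Hz) as [D Q].
    assert (E : PSf (PSd (PSint e)) z = phi z).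
    { apply (Cser_unique _ _ _ Q). apply Cser_ext with (fun n => e n * z ^ n)%C; [|apply He; auto].
      intros n. rewrite PSd_PSint. reflexivity. }
    rewrite E in D. eapply Cderiv_eq.
    - apply Cderiv_mult; [apply HG; auto|]. apply Cderiv_exp_comp.
      apply Cderiv_ext with (fun w => (-(1)) * PSf (PSint e) w)%C; [intros; ring|].
      apply Cderiv_scal; exact D.
    - simpl. ring. }
  rewrite PSf_0 in K. simpl in K.
  replace (- 0)%C with (RtoC 0) in K by ring. rewrite Cexp_0, Cmult_1_r in K.
  rewrite <- K, <- Cmult_assoc, <- Cexp_plus.
  replace (- PSf (PSint e) z + PSf (PSint e) z)%C with (RtoC 0) by ring. rewrite Cexp_0. ring.
Qed.

(** The difference of the two logarithms is continuous, vanishes at 0 and has exponential 1, so it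
    vanishes near 0 by [Cexp_inj_small]; its coefficients are then 0. *)
Lemma logser_unique (F : C -> C) r a b : 0 < r -> F 0 <> 0 -> logser F r a -> logser F r b -> forall n, a n = b n.
Proof.
  intros Hr HF [Ha0 Ha] [Hb0 Hb] n.
  assert (Z : (a n - b n)%C = 0).
  { set (h := fun z => (PSf a z - PSf b z)%C).
    assert (hP : forall z, Cmod z < r -> PS (fun n => a n - b n)%C z (h z)).
    { intros z Hz. apply Cser_ext with (fun n => a n * z ^ n - b n * z ^ n)%C; [intros; ring|].
      apply Cser_minus; [apply Ha|apply Hb]; auto. }
    assert (hE : forall z, Cmod z < r -> Cexp (h z) = 1).
    { intros z Hz. unfold h. rewrite Cexp_minus.
      destruct (Ha z Hz) as [_ E1]. destruct (Hb z Hz) as [_ E2]. rewrite E1 in E2.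
      replace (Cexp (PSf a z)) with (/ F 0 * (F 0 * Cexp (PSf a z)))%C by (field; auto).
      rewrite E2. field. split; auto. apply Cexp_neq0. }
    assert (h0 : h 0 = 0) by (unfold h; rewrite !PSf_0, Ha0, Hb0; ring).
    assert (hc : Ccont h 0).
    { destruct (PS_disc_deriv _ r h Hr hP 0 ltac:(rewrite Cmod_0; auto)) as [D _].
      eapply Cderiv_cont; eauto. }
    destruct (hc (1 / 5) ltac:(lra)) as [d [Hd Hc]].
    apply (PS_zero_coef (fun n => a n - b n)%C (Rmin d r)); [apply Rmin_pos; auto|].
    intros z Hz.
    assert (Z1 := Rlt_le_trans _ _ _ Hz (Rmin_l _ _)). assert (Z2 := Rlt_le_trans _ _ _ Hz (Rmin_r _ _)).
    eapply Cser_eq; [apply hP; auto|]. apply Cexp_inj_small; [|apply hE; auto].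
    specialize (Hc z). rewrite h0 in Hc. replace (z - 0)%C with z in Hc by ring.
    replace (h z - 0)%C with (h z) in Hc by ring. left; auto. }
  replace (a n) with ((a n - b n) + b n)%C by ring. rewrite Z; ring.
Qed.

Lemma logser_le F r r' a : r' <= r -> logser F r a -> logser F r' a.
Proof. intros L [H0 H]. split; auto. intros z Hz. apply H. lra. Qed.

Lemma logser_ext F G r a : 0 < r -> (forall z, Cmod z < r -> F z = G z) -> logser F r a -> logser G r a.
Proof.
  intros Hr E [H0 H]. split; auto. intros z Hz. rewrite <- !E; auto. rewrite Cmod_0; auto.
Qed.

Lemma logser_coef_ext F r a b : (forall n, a n = b n) -> logser F r a -> logser F r b.
Proof.
  intros E [H0 H].
  assert (K : forall z l, PS a z l -> PS b z l).
  { intros z l Hl. apply Cser_ext with (fun n => a n * z ^ n)%C; auto. intros n. rewrite E; auto. }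
  split; [rewrite <- E; auto|]. intros z Hz. destruct (H z Hz) as [P Q].
  rewrite (PSf_eq b z (PSf a z)) by auto. auto.
Qed.

Lemma logser_mult F G r a b : logser F r a -> logser G r b ->
  logser (fun z => F z * G z)%C r (fun n => a n + b n)%C.
Proof.
  intros [Ha0 Ha] [Hb0 Hb]. split; [rewrite Ha0, Hb0; ring|]. intros z Hz.
  destruct (Ha z Hz) as [Pa Ea]. destruct (Hb z Hz) as [Pb Eb].
  assert (P : PS (fun n => a n + b n)%C z (PSf a z + PSf b z)%C).
  { apply Cser_ext with (fun n => a n * z ^ n + b n * z ^ n)%C; [intros; ring|].
    apply Cser_plus; auto. }
  rewrite (PSf_eq _ _ _ P). split; auto. rewrite Ea, Eb, Cexp_plus. ring.
Qed.

Lemma logser_const c r : logser (fun _ => c) r (fun _ => 0).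
Proof.
  split; auto. intros z Hz.
  assert (P : PS (fun _ => 0) z 0).
  { apply Cser_zero. intros n. ring. }
  rewrite (PSf_eq _ _ _ P). split; auto. rewrite Cexp_0. ring.
Qed.

Lemma logser_scal c F r a : logser F r a -> logser (fun z => c * F z)%C r a.
Proof.
  intros H. apply (logser_coef_ext _ _ (fun n => 0 + a n)%C); [intros; ring|].
  apply (logser_mult (fun _ => c)); auto. apply logser_const.
Qed.

Lemma logser_inv (F : C -> C) r a : F 0 <> 0 -> logser F r a -> logser (fun z => / F z)%C r (fun n => - a n)%C.
Proof.
  intros HF [Ha0 Ha]. split; [rewrite Ha0; ring|]. intros z Hz. destruct (Ha z Hz) as [Pa Ea].
  assert (P : PS (fun n => - a n)%C z (- PSf a z)%C).
  { apply Cser_ext with (fun n => (-(1)) * (a n * z ^ n))%C; [intros; ring|].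
    eapply Cser_eq; [apply Cser_scal; exact Pa|ring]. }
  rewrite (PSf_eq _ _ _ P). split; auto. rewrite Ea, Cexp_opp. field.
  split; auto. apply Cexp_neq0.
Qed.

Lemma logser_exp p f r : (forall z, Cmod z < r -> PS p z (f z)) -> 0 < r ->
  logser (fun z => Cexp (f z)) r (fun n => match n with O => 0 | S _ => p n end).
Proof.
  intros Hp Hr. split; auto. intros z Hz.
  assert (E0 : f 0 = p O).
  { apply (Cser_unique (fun n => p n * 0 ^ n)%C); [apply Hp; rewrite Cmod_0; auto|apply PS_at_0]. }
  assert (P : PS (fun n => match n with O => 0 | S _ => p n end) z (f z - p O)%C).
  { assert (S1 := Cser_shift _ _ (Hp z Hz)). cbv beta in S1.
    assert (S2 := Cser_unshift (fun n => match n with O => 0 | S _ => p n end * z ^ n)%C _ S1).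
    eapply Cser_eq; [exact S2|]. simpl. ring. }
  rewrite (PSf_eq _ _ _ P). split; auto. rewrite <- Cexp_plus, E0. f_equal. ring.
Qed.

Lemma PS_geom (w z : C) : w <> 0 -> Cmod z < Cmod w -> PS (fun n => - / w ^ S n)%C z (- / (w - z))%C.
Proof.
  intros Hw Hz. assert (Pw : 0 < Cmod w) by (apply Cmod_gt_0; auto). assert (Pz := Cmod_ge_0 z).
  assert (N : (w - z)%C <> 0) by (apply Cminus_neq0; intros E; rewrite E in Hz; lra).
  assert (E : forall n, csum (fun k => - / w ^ S k * z ^ k)%C n = (- / (w - z) * (1 - (z / w) ^ n))%C).
  { induction n; cbn [csum].
    - simpl. ring.
    - rewrite IHn, !Cpow_S. unfold Cdiv. rewrite !Cpow_mult_l, !Cpow_inv by auto.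
      assert (Pn := Cpow_nz w n Hw). field. auto. }
  set (q := Cmod z / Cmod w).
  assert (Hq : 0 <= q < 1).
  { unfold q. apply ratio_bounds; lra. }
  assert (PN : 0 < Cmod (w - z)%C) by (apply Cmod_gt_0; auto).
  intros eps He.
  destruct (pow_lt_1_zero q ltac:(rewrite Rabs_pos_eq; lra) (eps * Cmod (w - z)%C)) as [n0 HN].
  { apply Rmult_lt_0_compat; auto. }
  exists n0. intros n Hn. rewrite E.
  replace (- / (w - z) * (1 - (z / w) ^ n) - - / (w - z))%C with (/ (w - z) * (z / w) ^ n)%C by ring.
  rewrite Cmod_mult, Cmod_inv, Cmod_pow, Cmod_div by auto. fold q.
  specialize (HN n Hn). rewrite Rabs_pos_eq in HN by (apply pow_le; lra).
  apply Rmult_lt_reg_l with (Cmod (w - z)%C); auto.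
  rewrite <- Rmult_assoc, Rinv_r, Rmult_1_l by lra. lra.
Qed.

Lemma logser_linear (w : C) r : w <> 0 -> 0 < r -> r <= Cmod w ->
  logser (fun z => 1 - z / w)%C r (PSint (fun n => - / w ^ S n)%C).
Proof.
  intros Hw Hr Hrw. apply (log_of_deriv _ r _ (fun z => - / (w - z))%C Hr).
  - intros z Hz. apply PS_geom; auto; lra.
  - intros z Hz.
    assert (N : (w - z)%C <> 0) by (apply Cminus_neq0; intros E; rewrite E in *; lra).
    eapply Cderiv_eq.
    + apply (Cderiv_ext (fun z => 1 + (- / w) * z)%C); [intros; field; auto|].
      apply Cderiv_plus; [apply Cderiv_const|apply Cderiv_scal, Cderiv_id].
    + simpl. field. auto.
Qed.

Lemma Cmod_PSint_linear (w : C) n : w <> 0 -> (1 <= n)%nat ->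
  Cmod (PSint (fun n => - / w ^ S n)%C n) = / INR n * / Cmod w ^ n.
Proof.
  intros Hw Hn. destruct n as [|n]; [lia|]. unfold PSint.
  rewrite Cmod_div by apply INR_S_neq0.
  rewrite Cmod_opp, Cmod_inv, Cmod_pow, Cmod_R, Rabs_pos_eq by (try apply pos_INR; apply Cpow_nz; auto).
  unfold Rdiv. ring.
Qed.

Lemma Re_log_le (F0 Fz l : C) M : F0 <> 0 -> Fz = (F0 * Cexp l)%C -> Cmod Fz <= M ->
  Re l <= ln (M / Cmod F0).
Proof.
  intros HF E HM. assert (P : 0 < Cmod F0) by (apply Cmod_gt_0; auto).
  rewrite <- (ln_exp (Re l)). apply ln_le; [apply exp_pos|].
  rewrite <- Cmod_Cexp. apply Rmult_le_reg_r with (Cmod F0); auto.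
  unfold Rdiv. rewrite Rmult_assoc, Rinv_l, Rmult_1_r by lra.
  rewrite <- Cmod_mult, Cmult_comm, <- E. auto.
Qed.

(** Without zeros, G'/G is holomorphic and integrates to a logarithm. The bound on |G| is a
    one-sided bound on its real part, which is exactly what [borel_caratheodory] needs. *)
Theorem logser_exists G R0 r M : 0 < r < R0 -> holo (fun z => Cmod z < R0) G ->
  (forall z, Cmod z < R0 -> G z <> 0) -> (forall z, Cmod z < R0 -> Cmod (G z) <= M) ->
  exists a, logser G r a /\ forall n, Cmod (a n) * r ^ n <= 4 * ln (M / Cmod (G 0)).
Proof.
  intros Hr HG HN HM.
  (* Two intermediate radii: passing to the derivative, and then to the power series of the
     quotient, each shrinks the disc. *)
  set (r1 := (r + R0) / 2). set (rA := (r1 + R0) / 2).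
  assert (H1 : r < r1 < rA /\ rA < R0) by (unfold rA, r1; lra). clearbody rA. clearbody r1.
  destruct (holo_derivative G R0 ltac:(lra) HG rA ltac:(lra)) as [G1 [HD HG1]].
  set (phi := fun z => (G1 z / G z)%C).
  assert (Hphi : holo (fun z => Cmod z < rA) phi).
  { intros z Hz. destruct (HG1 z Hz) as [l Hl]. eexists.
    apply Cderiv_div; [apply HN; lra|exact Hl|apply HD; auto]. }
  set (a := PSint (ccoef phi r1)).
  assert (La : logser G r1 a).
  { apply (log_of_deriv G r1 _ phi); [lra| |].
    - intros z Hz. apply (cauchy_ps phi rA); auto; lra.
    - intros z Hz. eapply Cderiv_eq; [apply HD; lra|]. unfold phi. field. apply HN; lra. }
  exists a. split; [apply (logser_le _ r1); auto; lra|].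
  assert (C0 : Cmod 0 < R0) by (rewrite Cmod_0; lra).
  assert (G0 := HN 0 C0). assert (P0 : 0 < Cmod (G 0)) by (apply Cmod_gt_0; auto).
  destruct La as [La0 La].
  assert (Pf : forall z, Cmod z < r1 -> PS a z (PSf a z)) by (intros; apply La; auto).
  assert (Hl := PS_disc_holo a r1 (PSf a) ltac:(lra) Pf).
  intros n. destruct n as [|n].
  - rewrite La0, Cmod_0, Rmult_0_l.
    assert (0 <= ln (M / Cmod (G 0))); [|lra].
    apply Rle_trans with (ln 1); [rewrite ln_1; lra|]. apply ln_le; [lra|]. apply Rmult_le_reg_r with (Cmod (G 0)); auto.
    unfold Rdiv. rewrite Rmult_assoc, Rinv_l by lra. specialize (HM 0 C0). lra.
  - assert (B := borel_caratheodory (PSf a) r1 r (ln (M / Cmod (G 0))) (S n) ltac:(lra) Hl).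
    rewrite PSf_0, La0 in B. simpl (Re 0) in B. rewrite Rminus_0_r in B.
    rewrite (PS_unique a (ccoef (PSf a) r) (PSf a) r).
    + apply B; [|lia]. intros z Hz. apply Re_log_le with (G z); auto; [|apply HM; lra].
      apply La; lra.
    + lra.
    + intros z Hz. apply Pf; lra.
    + intros z Hz. apply (cauchy_ps _ r1); auto; lra.
Qed.

(** * Blaschke products *)

(** Away from [w] the quotient is a plain division; near [w] it is the Taylor series of [F] with its
    vanishing constant term shifted out. *)
Lemma divide_zero F R0 w : holo (fun z => Cmod z < R0) F -> Cmod w < R0 -> F w = 0 ->
  exists Q, holo (fun z => Cmod z < R0) Q /\ forall z, F z = ((z - w) * Q z)%C.
Proof.
  intros HF Hw Fw. set (s := R0 - Cmod w). set (t := s / 2).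
  assert (Hs : 0 < t < s) by (unfold t, s; lra).
  set (f := fun h => F (w + h)%C).
  assert (Hf : holo (fun z => Cmod z < s) f).
  { intros h Hh. destruct (HF (w + h)%C) as [l Hl].
    - eapply Rle_lt_trans; [apply Cmod_triangle|]. unfold s in Hh. lra.
    - exists l. apply Cderiv_shift; auto. }
  assert (Pf : forall h, Cmod h < t -> PS (ccoef f t) h (f h))
    by (intros; apply (cauchy_ps f s); auto).
  assert (f0 : f 0 = 0) by (unfold f; replace (w + 0)%C with w by ring; auto).
  assert (a0 : ccoef f t 0 = 0).
  { rewrite <- f0. symmetry. apply (Cser_unique (fun n => ccoef f t n * 0 ^ n)%C); [apply Pf|apply PS_at_0].
    rewrite Cmod_0; lra. }
  set (Q := fun z => if excluded_middle_informative (z = w) then ccoef f t 1 else (F z / (z - w))%C).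
  assert (Qn : forall z, z <> w -> Q z = (F z / (z - w))%C)
    by (intros z N; unfold Q; destruct excluded_middle_informative; congruence).
  assert (Qw : Q w = ccoef f t 1) by (unfold Q; destruct excluded_middle_informative; congruence).
  exists Q. split.
  - intros z Hz. destruct (classic (z = w)) as [->|N].
    + assert (PQ : forall h, Cmod h < t -> PS (fun n => ccoef f t (S n)) h (Q (w + h)%C)).
      { intros h Hh. destruct (classic (h = 0)) as [->|Nh].
        - replace (w + 0)%C with w by ring. rewrite Qw. apply PS_at_0.
        - rewrite Qn.
          2:{ intros E. apply Nh. replace h with ((w + h) - w)%C by ring. rewrite E; ring. }
          replace (w + h - w)%C with h by ring.
          apply Cser_ext with (fun n => / h * (ccoef f t (S n) * h ^ S n))%C.
          + intros n. rewrite Cpow_S. field; auto.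
          + eapply Cser_eq; [apply Cser_scal; exact (Cser_shift (fun n => ccoef f t n * h ^ n)%C _ (Pf h Hh))|]. cbv beta. rewrite a0.
            unfold f. field. auto. }
      destruct (PS_disc_deriv _ t _ ltac:(lra) PQ 0 ltac:(rewrite Cmod_0; lra)) as [D _].
      eexists. apply Cderiv_ext with (fun z => (fun h => Q (w + h)%C) (- w + z)%C).
      * intros z. cbv beta. f_equal. ring.
      * apply (Cderiv_shift (fun h => Q (w + h)%C)). replace (- w + w)%C with (RtoC 0) by ring. exact D.
    + destruct (HF z Hz) as [l Hl]. assert (N' := Cminus_neq0 _ _ N).
      eexists. apply (Cderiv_ext_loc (fun z => F z / (z - w))%C Q z _ (Cmod (z - w)%C)).
      * apply Cmod_gt_0; auto.
      * intros v Hv. symmetry; apply Qn. intros ->. rewrite Cmod_minus_sym in Hv. lra.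
      * apply (Cderiv_div F (fun z => z - w)%C); [auto|exact Hl|].
        apply Cderiv_minus; [apply Cderiv_id|apply Cderiv_const].
  - intros z. destruct (classic (z = w)) as [->|N].
    + rewrite Fw. ring.
    + rewrite Qn by auto. field. apply Cminus_neq0; auto.
Qed.

Definition blaschke (r : R) (w z : C) : C := (r * (z - w) / (r * r - Cconj w * z))%C.

Fixpoint blaschke_prod (r : R) (l : list C) (z : C) : C :=
  match l with nil => 1 | w :: l' => (blaschke r w z * blaschke_prod r l' z)%C end.

Lemma blaschke_denom r w z : Cmod w < r -> Cmod z <= r -> (r * r - Cconj w * z)%C <> 0.
Proof.
  intros Hw Hz. assert (Pw := Cmod_ge_0 w). assert (Pz := Cmod_ge_0 z).
  apply Cmod_neq0.
  assert (X := Cmod_ge_minus (r * r)%C (Cconj w * z)%C).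
  rewrite !Cmod_mult, Cmod_conj, Cmod_R, Rabs_pos_eq in X by lra. nra.
Qed.

(** On the circle r^2 = z conj z, which turns the denominator into z conj (z - w). So a Blaschke
    factor has modulus 1 there. *)
Lemma blaschke_circle r w z : 0 < r -> Cmod z = r -> Cmod (r * (z - w))%C = Cmod (r * r - Cconj w * z)%C.
Proof.
  intros Hr Hz.
  assert (E : (RtoC r * RtoC r)%C = (z * Cconj z)%C).
  { rewrite <- Cmod2_conj, Hz. rewrite <- RtoC_mult. f_equal. ring. }
  rewrite E. replace (z * Cconj z - Cconj w * z)%C with (z * Cconj (z - w))%C
    by (destruct z, w; apply C_eq; simpl; ring).
  rewrite !Cmod_mult, Cmod_conj, Hz, Cmod_R, Rabs_pos_eq; lra.
Qed.

(* Each division multiplies the value at 0 by at least [R1 / R2] while [M] stays a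
   bound, so fewer than [k] zeros can be divided out. *)
Theorem blaschke_extract R0 R1 R2 M : 0 < R2 < R1 -> R1 < R0 -> forall k F,
  holo (fun z => Cmod z < R0) F -> (forall z, Cmod z <= R1 -> Cmod (F z) <= M) ->
  M * R2 ^ k < Cmod (F 0) * R1 ^ k ->
  exists l G, (forall w, In w l -> 0 < Cmod w <= R2 /\ F w = 0) /\
    holo (fun z => Cmod z < R0) G /\ (forall z, Cmod z <= R1 -> Cmod (G z) <= M) /\
    (forall z, Cmod z <= R2 -> G z <> 0) /\
    (forall z, Cmod z <= R1 -> F z = (G z * blaschke_prod R1 l z)%C).
Proof.
  intros H12 H10 k. induction k as [|k IH]; intros F HF HM HB.
  - exfalso. simpl in HB. assert (X := HM 0 ltac:(rewrite Cmod_0; lra)). lra.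
  - destruct (classic (exists w, Cmod w <= R2 /\ F w = 0)) as [[w [Hw Fw]]|N].
    2:{ exists nil, F. repeat split; auto; try easy.
        - intros z Hz E. apply N. exists z; auto.
        - intros z Hz. simpl. ring. }
    destruct (divide_zero F R0 w HF ltac:(lra) Fw) as [Q [HQ EQ]].
    assert (PM : 0 <= M) by (eapply Rle_trans; [apply Cmod_ge_0|apply (HM 0); rewrite Cmod_0; lra]).
    assert (F0 : 0 < Cmod (F 0)).
    { assert (0 <= M * R2 ^ S k) by (apply Rmult_le_pos; auto; apply pow_le; lra).
      assert (0 < R1 ^ S k) by (apply pow_lt; lra).
      assert (X := Cmod_ge_0 (F 0)). destruct X as [X|X]; auto. rewrite <- X in HB. lra. }
    assert (w0 : 0 < Cmod w).
    { apply Cmod_gt_0. intros E. subst w. rewrite Fw, Cmod_0 in F0. lra. }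
    set (F1 := fun z => (Q z * ((R1 * R1 - Cconj w * z) / R1))%C).
    assert (NR : RtoC R1 <> 0) by (apply RtoC_neq0; lra).
    assert (E1 : forall z, Cmod z <= R1 -> F z = (F1 z * blaschke R1 w z)%C).
    { intros z Hz. rewrite EQ. unfold F1, blaschke. field. split; auto. apply blaschke_denom; lra. }
    assert (HF1 : holo (fun z => Cmod z < R0) F1).
    { intros z Hz. destruct (HQ z Hz) as [l Hl]. eexists. apply Cderiv_mult; [exact Hl|].
      apply (Cderiv_ext (fun z => / R1 * (R1 * R1 - Cconj w * z))%C); [intros; field; auto|].
      apply Cderiv_scal, Cderiv_minus; [apply Cderiv_const|apply Cderiv_scal, Cderiv_id]. }
    assert (HM1 : forall z, Cmod z <= R1 -> Cmod (F1 z) <= M).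
    { apply (maximum_modulus F1 R0 R1 M); auto; [lra|]. intros z Hz.
      assert (Dn := blaschke_denom R1 w z ltac:(lra) ltac:(lra)).
      assert (BC := blaschke_circle R1 w z ltac:(lra) Hz).
      assert (X := HM z ltac:(lra)). rewrite E1 in X by lra.
      rewrite Cmod_mult in X. unfold blaschke in X. rewrite Cmod_div, BC in X by auto.
      assert (PD : 0 < Cmod (R1 * R1 - Cconj w * z)%C) by (apply Cmod_gt_0; auto).
      unfold Rdiv in X. rewrite Rinv_r in X by lra. lra. }
    assert (B0 : Cmod (blaschke R1 w 0) = Cmod w / R1).
    { unfold blaschke. replace (R1 * (0 - w) / (R1 * R1 - Cconj w * 0))%C with (- w / R1)%C by (field; auto).
      rewrite Cmod_div, Cmod_opp, Cmod_R, Rabs_pos_eq by (auto; lra). reflexivity. }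
    destruct (IH F1 HF1 HM1) as (l & G & HL & HG & HGM & HGN & HE).
    { assert (X := E1 0 ltac:(rewrite Cmod_0; lra)). apply (f_equal Cmod) in X.
      rewrite Cmod_mult, B0 in X. rewrite X in HB. simpl in HB.
      assert (Pk : 0 < R1 ^ k) by (apply pow_lt; lra).
      assert (P1 := Cmod_ge_0 (F1 0)).
      assert (Y : M * R2 ^ k * R2 < Cmod (F1 0) * R1 ^ k * R2).
      { replace (M * R2 ^ k * R2) with (M * (R2 * R2 ^ k)) by ring.
        eapply Rlt_le_trans; [exact HB|].
        replace (Cmod (F1 0) * (Cmod w / R1) * (R1 * R1 ^ k)) with (Cmod (F1 0) * R1 ^ k * Cmod w)
          by (field; lra).
        apply Rmult_le_compat_l; [|lra]. apply Rmult_le_pos; lra. }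
      apply Rmult_lt_reg_r in Y; lra. }
    exists (w :: l), G. split; [|split; [|split; [|split]]]; auto.
    + intros v [<-|Hv]; [split; auto; lra|]. destruct (HL v Hv) as [V1 V2].
      split; auto. rewrite E1 by lra. rewrite V2. ring.
    + intros z Hz. rewrite E1, HE by auto. simpl. ring.
Qed.

Fixpoint lsum (f : C -> R) (l : list C) : R :=
  match l with nil => 0 | w :: l' => f w + lsum f l' end.

Lemma lsum_le f g l : (forall w, In w l -> f w <= g w) -> lsum f l <= lsum g l.
Proof.
  induction l; simpl; intros H; [lra|]. apply Rplus_le_compat; auto.
Qed.

Lemma lsum_scal c f l : lsum (fun w => c * f w) l = c * lsum f l.
Proof. induction l; simpl; [|rewrite IHl]; ring. Qed.

(** Up to a constant the factor is (1 - z/w) / (1 - z/v) with v the reflection of w in the circle.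
    As |v| >= |w|, each of the two logarithms contributes at most 1 / (n |w|^n). *)
Lemma logser_blaschke r0 w r : 0 < Cmod w < r0 -> 0 < r <= Cmod w ->
  exists b, logser (blaschke r0 w) r b /\
    forall n, (1 <= n)%nat -> Cmod (b n) <= 2 / INR n * / Cmod w ^ n.
Proof.
  intros Hw Hr. assert (w0 : w <> 0) by (apply Cmod_neq0; lra).
  assert (cw0 : Cconj w <> 0) by (apply Cmod_neq0; rewrite Cmod_conj; lra).
  assert (Nr : RtoC r0 <> 0) by (apply RtoC_neq0; lra).
  set (v := (r0 * r0 / Cconj w)%C).
  assert (v0 : v <> 0).
  { apply Cmod_neq0. unfold v. rewrite Cmod_div, Cmod_mult, Cmod_R, Rabs_pos_eq, Cmod_conj by (auto; lra).
    apply Rdiv_lt_0_compat; nra. }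
  assert (Hv : Cmod w <= Cmod v).
  { unfold v. rewrite Cmod_div, Cmod_mult, Cmod_R, Rabs_pos_eq, Cmod_conj by (auto; lra).
    apply Rmult_le_reg_r with (Cmod w); [lra|]. unfold Rdiv. rewrite Rmult_assoc, Rinv_l by lra. nra. }
  exists (fun n => PSint (fun n => - / w ^ S n)%C n + - PSint (fun n => - / v ^ S n)%C n)%C. split.
  - apply (logser_ext (fun z => (- w / r0) * ((1 - z / w) * / (1 - z / v)))%C); [lra| |].
    + intros z Hz. unfold blaschke, v.
      assert (D := blaschke_denom r0 w z ltac:(lra) ltac:(lra)).
      field. repeat split; auto.
    + apply logser_scal. apply (logser_mult (fun z => 1 - z / w)%C (fun z => / (1 - z / v))%C).
      * apply logser_linear; auto; lra.
      * apply (logser_inv (fun z => 1 - z / v)%C).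
        -- intros E. replace (1 - 0 / v)%C with (RtoC 1) in E by (field; auto).
           apply RtoC_inj in E. lra.
        -- apply logser_linear; auto; lra.
  - intros n Hn. eapply Rle_trans; [apply Cmod_triangle|]. rewrite Cmod_opp.
    rewrite !Cmod_PSint_linear by auto.
    assert (I : 0 < / INR n) by (apply Rinv_0_lt_compat, lt_0_INR; lia).
    assert (L : / Cmod v ^ n <= / Cmod w ^ n).
    { apply Rinv_le_contravar; [apply pow_lt; lra|]. apply pow_incr; lra. }
    unfold Rdiv. nra.
Qed.

Lemma logser_blaschke_prod r0 l r : 0 < r -> (forall w, In w l -> r <= Cmod w < r0) ->
  exists b, logser (blaschke_prod r0 l) r b /\
    forall n, (1 <= n)%nat -> Cmod (b n) <= 2 / INR n * lsum (fun w => / Cmod w ^ n) l.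
Proof.
  intros Hr. induction l as [|w l IH]; intros H.
  - exists (fun _ => 0). split; [apply logser_const|]. intros n Hn. rewrite Cmod_0. simpl. lra.
  - destruct IH as [b [Hb Bb]]; [intros; apply H; right; auto|].
    assert (Hw := H w (or_introl eq_refl)).
    destruct (logser_blaschke r0 w r ltac:(lra) ltac:(lra)) as [c [Hc Bc]].
    exists (fun n => c n + b n)%C. split.
    + apply (logser_mult (blaschke r0 w) (blaschke_prod r0 l)); auto.
    + intros n Hn. eapply Rle_trans; [apply Cmod_triangle|]. simpl.
      specialize (Bb n Hn). specialize (Bc n Hn). lra.
Qed.

Lemma blaschke_prod_0_le r0 l : 0 < r0 -> (forall w, In w l -> Cmod w < r0) -> Cmod (blaschke_prod r0 l 0) <= 1.
Proof.
  intros Hr. induction l as [|w l IH]; intros H; simpl; [rewrite Cmod_1; lra|].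
  rewrite Cmod_mult. assert (X := IH (fun v Hv => H v (or_intror Hv))).
  assert (Hw := H w (or_introl eq_refl)).
  assert (Nr : RtoC r0 <> 0) by (apply RtoC_neq0; lra).
  assert (B0 : Cmod (blaschke r0 w 0) = Cmod w / r0).
  { unfold blaschke. replace (r0 * (0 - w) / (r0 * r0 - Cconj w * 0))%C with (- w / r0)%C by (field; auto).
    rewrite Cmod_div, Cmod_opp, Cmod_R, Rabs_pos_eq by (auto; lra). reflexivity. }
  rewrite B0. assert (Pw := Cmod_ge_0 w).
  assert (Q : 0 <= Cmod w / r0 <= 1).
  { split; [apply Rdiv_le_0_compat; lra|]. apply Rmult_le_reg_r with r0; auto.
    unfold Rdiv. rewrite Rmult_assoc, Rinv_l; lra. }
  assert (P := Cmod_ge_0 (blaschke_prod r0 l 0)). nra.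
Qed.

(* [R] is the distance to the nearest zero, [R2 < R1] the radii used for dividing
   the zeros out, and [R3] the radius of the zero-free cofactor's expansion. *)
Theorem log_coef_zeros F R0 R1 R2 R3 R M : 0 < R < R3 -> R3 < R2 -> R2 < R1 -> R1 < R0 ->
  holo (fun z => Cmod z < R0) F -> (forall z, Cmod z <= R1 -> Cmod (F z) <= M) -> F 0 <> 0 ->
  (forall w, Cmod w <= R2 -> F w = 0 -> R <= Cmod w) ->
  exists l a, (forall w, In w l -> Cmod w <= R2 /\ F w = 0) /\ logser F R a /\
    (forall n, (1 <= n)%nat -> Cmod (a n) <=
       2 / INR n * lsum (fun w => / Cmod w ^ n) l + 4 * ln (M / Cmod (F 0)) / R3 ^ n) /\
    (forall z, Cmod z <= R1 -> Cmod (F z) <= M * Cmod (blaschke_prod R1 l z)).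
Proof.
  intros HR H32 H21 H10 HF HM F0 HZ.
  assert (P0 : 0 < Cmod (F 0)) by (apply Cmod_gt_0; auto).
  (* [k] is any bound on the number of zeros that can be divided out; it does not enter the
     conclusion. *)
  destruct (pow_unbounded (R1 / R2) (M / Cmod (F 0))) as [k Hk].
  { apply Rmult_lt_reg_r with R2; [lra|]. unfold Rdiv. rewrite Rmult_assoc, Rinv_l; lra. }
  destruct (blaschke_extract R0 R1 R2 M ltac:(lra) H10 k F HF HM) as (l & G & HL & HG & HGM & HGN & HE).
  { assert (Pk : 0 < R2 ^ k) by (apply pow_lt; lra).
    unfold Rdiv in Hk. rewrite Rpow_mult_distr, pow_inv in Hk.
    apply (Rmult_lt_compat_r (R2 ^ k * Cmod (F 0))) in Hk; [|nra].
    replace (M * / Cmod (F 0) * (R2 ^ k * Cmod (F 0))) with (M * R2 ^ k) in Hk by (field; lra).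
    replace (R1 ^ k * / R2 ^ k * (R2 ^ k * Cmod (F 0))) with (Cmod (F 0) * R1 ^ k) in Hk by (field; lra).
    auto. }
  destruct (logser_exists G R2 R3 M ltac:(lra)) as [g [Lg Bg]].
  { intros z Hz. apply HG. lra. }
  { intros z Hz. apply HGN. lra. }
  { intros z Hz. apply HGM. lra. }
  destruct (logser_blaschke_prod R1 l R ltac:(lra)) as [b [Lb Bb]].
  { intros w Hw. destruct (HL w Hw) as [X1 X2]. split; [apply HZ; auto; lra|lra]. }
  exists l, (fun n => g n + b n)%C. split; [|split; [|split]].
  - intros w Hw. destruct (HL w Hw) as [X1 X2]. split; auto; lra.
  - apply (logser_ext (fun z => G z * blaschke_prod R1 l z)%C); [lra| |].
    + intros z Hz. symmetry. apply HE. lra.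
    + apply logser_mult; auto. apply (logser_le _ R3); auto; lra.
  - intros n Hn. eapply Rle_trans; [apply Cmod_triangle|]. specialize (Bb n Hn). specialize (Bg n).
    assert (Pn : 0 < R3 ^ n) by (apply pow_lt; lra).
    (* The Blaschke product has modulus at most 1 at 0, so the cofactor is no smaller there than
       [F]. *)
    assert (G0 : Cmod (F 0) <= Cmod (G 0)).
    { rewrite HE by (rewrite Cmod_0; lra). rewrite Cmod_mult.
      assert (X := blaschke_prod_0_le R1 l ltac:(lra) ltac:(intros w Hw; destruct (HL w Hw); lra)).
      assert (Y := Cmod_ge_0 (G 0)). nra. }
    assert (PM : 0 < M) by (assert (X := HM 0 ltac:(rewrite Cmod_0; lra)); lra).
    assert (LL : ln (M / Cmod (G 0)) <= ln (M / Cmod (F 0))).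
    { apply ln_le; [apply Rdiv_lt_0_compat; lra|]. apply Rmult_le_compat_l; [lra|].
      apply Rinv_le_contravar; lra. }
    assert (Cmod (g n) <= 4 * ln (M / Cmod (F 0)) / R3 ^ n); [|lra].
    apply Rmult_le_reg_r with (R3 ^ n); auto. unfold Rdiv at 1.
    rewrite Rmult_assoc, Rinv_l, Rmult_1_r by lra. lra.
  - intros z Hz. rewrite HE by auto. rewrite Cmod_mult.
    apply Rmult_le_compat_r; [apply Cmod_ge_0|]. auto.
Qed.

(** * The zeta function in the right half-plane *)

Lemma exp_le (x y : R) : x <= y -> exp x <= exp y.
Proof. intros [H|H]; [left; apply exp_increasing; auto|right; f_equal; auto]. Qed.

Lemma ln_ge_inv x : 0 < x -> / (x + 1) <= ln (x + 1) - ln x.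
Proof.
  intros Hx. assert (H := exp_ineq1_le (ln x - ln (x + 1))).
  unfold Rminus in H. rewrite exp_plus, exp_Ropp, !exp_ln in H by lra.
  assert (E : x * / (x + 1) = 1 - / (x + 1)) by (field; lra). lra.
Qed.

Definition npow (eta : R) (n : nat) : R := exp (- eta * ln (INR n)).

(** Comparison with the integral of x^(-1-eta) in telescoping form: (x+1)^(-1-eta) <= (x^(-eta) -
    (x+1)^(-eta)) / eta, from [ln_ge_inv] and exp u >= 1 + u. *)
Lemma npow_tail eta j n : 0 < eta -> (1 <= j)%nat ->
  rsum (fun k => npow (1 + eta) (S (j + k))) n <= npow eta j / eta.
Proof.
  intros He Hj.
  assert (X : rsum (fun k => npow (1 + eta) (S (j + k))) n <= (npow eta j - npow eta (j + n)) / eta).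
  { induction n as [|n IH]; cbn [rsum].
    - rewrite Nat.add_0_r. right. field. lra.
    - assert (S1 : npow (1 + eta) (S (j + n)) <= (npow eta (j + n) - npow eta (S (j + n))) / eta).
      { assert (Hp : 0 < INR (j + n)) by (apply lt_0_INR; lia).
        unfold npow. rewrite S_INR. set (x := INR (j + n)) in *.
        assert (L := ln_ge_inv x Hp).
        replace (- (1 + eta) * ln (x + 1)) with (- ln (x + 1) + - eta * ln (x + 1)) by ring.
        rewrite exp_plus, exp_Ropp, exp_ln by lra.
        replace (- eta * ln x) with (- eta * ln (x + 1) + eta * (ln (x + 1) - ln x)) by ring.
        rewrite exp_plus. set (E := exp (- eta * ln (x + 1))).
        assert (PE : 0 < E) by apply exp_pos.
        assert (Q := exp_ineq1_le (eta * (ln (x + 1) - ln x))).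
        assert (G : 1 + eta * / (x + 1) <= exp (eta * (ln (x + 1) - ln x))) by nra.
        apply Rmult_le_reg_r with eta; auto. unfold Rdiv at 1.
        rewrite (Rmult_assoc _ (/ eta)), Rinv_l, Rmult_1_r by lra. nra. }
      rewrite Nat.add_succ_r.
      replace ((npow eta j - npow eta (S (j + n))) / eta) with
        ((npow eta j - npow eta (j + n)) / eta + (npow eta (j + n) - npow eta (S (j + n))) / eta) by (field; lra).
      lra. }
  eapply Rle_trans; [exact X|]. apply Rmult_le_compat_r; [left; apply Rinv_0_lt_compat; auto|].
  assert (P := exp_pos (- eta * ln (INR (j + n)))). unfold npow. lra.
Qed.

Lemma npow_1 eta : npow eta 1 = 1.
Proof. unfold npow. simpl. rewrite ln_1, Rmult_0_r. apply exp_0. Qed.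

Lemma npow_pos eta n : 0 < npow eta n.
Proof. apply exp_pos. Qed.

Lemma npow_sum eta n : 0 < eta -> rsum (fun k => npow (1 + eta) (S k)) n <= 1 + / eta.
Proof.
  intros He. destruct n as [|n].
  - simpl. assert (0 < / eta) by (apply Rinv_0_lt_compat; auto). lra.
  - change (S n) with (1 + n)%nat. rewrite rsum_add. cbn [rsum]. rewrite npow_1, Rplus_0_l.
    apply Rplus_le_compat_l.
    assert (X := npow_tail eta 1 n He (le_n 1)). rewrite npow_1 in X. unfold Rdiv in X. rewrite Rmult_1_l in X.
    exact X.
Qed.

Lemma npow_le e1 e2 n : e1 <= e2 -> npow e2 (S n) <= npow e1 (S n).
Proof.
  intros H. apply exp_le. assert (0 <= ln (INR (S n))); [|nra].
  rewrite <- ln_1. apply ln_le; [lra|]. rewrite S_INR. assert (X := pos_INR n). lra.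
Qed.

Lemma npow_tail_lim eta eps : 0 < eta -> 0 < eps -> exists j, (1 <= j)%nat /\
  forall j', (j <= j')%nat -> npow eta j' < eps.
Proof.
  intros He Hp.
  destruct (archimed_cor1 (exp (ln eps / eta))) as [N [HN HN0]]; [apply exp_pos|].
  exists N. split; [lia|]. intros j' Hj. unfold npow. rewrite <- (exp_ln eps) by auto.
  apply exp_increasing.
  assert (PN : 0 < INR N) by (apply lt_0_INR; auto).
  assert (L1 : - ln (INR N) < ln eps / eta).
  { rewrite <- ln_Rinv by auto. rewrite <- (ln_exp (ln eps / eta)). apply ln_increasing; auto.
    apply Rinv_0_lt_compat; auto. }
  assert (L2 : ln (INR N) <= ln (INR j')) by (apply ln_le; auto; apply le_INR; auto).
  apply Rle_lt_trans with (eta * - ln (INR N)); [nra|].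
  apply Rlt_le_trans with (eta * (ln eps / eta)); [apply Rmult_lt_compat_l; auto|].
  right. field. lra.
Qed.

Lemma is_series_Cser a l : is_series (K := C_AbsRing) (V := C_NormedModule) a l -> Cser a l.
Proof.
  intros H eps He.
  assert (X := proj1 (filterlim_locally_ball_norm (K := C_AbsRing) (U := C_NormedModule) _ _) H (mkposreal eps He)).
  (* [sum_n a m] includes the term of index m, hence equals [csum a (S m)]. *)
  destruct X as [N HN]. exists (S N). intros n Hn. destruct n as [|n]; [lia|].
  specialize (HN n ltac:(lia)).
  assert (E : forall m, sum_n a m = csum a (S m)).
  { induction m.
    - rewrite sum_O. simpl. symmetry. apply Cplus_0_l.
    - rewrite sum_Sn, IHm. reflexivity. }
  rewrite E in HN. exact HN.
Qed.

Lemma Re_mult_real z x : Re (z * RtoC x)%C = Re z * x.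
Proof. rewrite Re_mult. simpl. ring. Qed.

Lemma Im_mult_real z x : Im (z * RtoC x)%C = Im z * x.
Proof. rewrite Im_mult. simpl. ring. Qed.

Lemma Cmod_dirichlet s n : Cmod (dirichlet_term s n) = npow (Re s) (S n).
Proof. unfold dirichlet_term, npow. rewrite Cmod_Cexp, Re_mult_real, Re_opp. reflexivity. Qed.

Lemma dirichlet_0 s : dirichlet_term s 0 = 1.
Proof.
  unfold dirichlet_term. simpl (INR 1). rewrite ln_1. rewrite Cmult_0_r. apply Cexp_0.
Qed.

Lemma zeta_Cser zeta s : is_riemann_zeta zeta -> 1 < Re s -> Cser (dirichlet_term s) (zeta s).
Proof. intros Hzeta H. apply is_series_Cser, Hzeta, H. Qed.

Lemma zeta_holo zeta : is_riemann_zeta zeta -> holo (fun s => s <> 1) zeta.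
Proof. intros Hzeta s Hs. apply ex_derive_Cderiv. apply Hzeta, Hs. Qed.

Lemma zeta_near_1 zeta s : is_riemann_zeta zeta -> 1 < Re s ->
  Cmod (zeta s - 1)%C <= / (Re s - 1).
Proof.
  intros Hzeta H. assert (S1 := zeta_Cser zeta s Hzeta H).
  assert (B : forall n, rsum (fun k => npow (Re s) (S (S k))) n <= / (Re s - 1)).
  { intros n. assert (X := npow_tail (Re s - 1) 1 n ltac:(lra) (le_n 1)).
    rewrite npow_1 in X. replace (1 + (Re s - 1)) with (Re s) in X by ring.
    unfold Rdiv in X. rewrite Rmult_1_l in X. exact X. }
  assert (S2 := Cser_shift _ _ S1). rewrite dirichlet_0 in S2.
  apply (Cser_norm_le _ _ _ S2). intros n.
  eapply Rle_trans; [apply Cmod_csum|]. eapply Rle_trans; [|apply (B n)].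
  apply rsum_le. intros k _. rewrite Cmod_dirichlet. lra.
Qed.

(** * Analytic continuation of zeta to the half-plane Re s > 0 *)

(** The theorem of Weierstrass at the centre of a disc: the derivative is the sum of the first
    Taylor coefficients. By Cauchy's bounds the remainder of each term is at most a constant times M
    n |z|^2, so the remainders add up to O(|z|^2). *)
Lemma holo_series_deriv (g : nat -> C -> C) (M : nat -> R) B r : 0 < r ->
  (forall n, holo (fun z => Cmod z < r) (g n)) ->
  (forall n z, Cmod z < r -> Cmod (g n z) <= M n) -> (forall n, rsum M n <= B) ->
  exists l, Cderiv (fun z => Csum (fun n => g n z)) 0 l.
Proof.
  intros Hr Hg HM HB.
  set (t := r / 2). assert (Ht : 0 < t < r) by (unfold t; lra).
  assert (M0 : forall n, 0 <= M n).
  { intros n. eapply Rle_trans; [apply Cmod_ge_0|apply (HM n 0)]. rewrite Cmod_0; auto. }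
  assert (PB : 0 <= B) by (specialize (HB O); simpl in HB; lra).
  assert (CB : forall n k, Cmod (ccoef (g n) t k) * t ^ k <= 2 * M n).
  { intros n. apply (ccoef_bound (g n) r t (M n)); auto. intros z Hz. apply HM; lra. }
  destruct (Cser_dom (fun n => ccoef (g n) t 1) (fun n => 2 / t * M n) (2 / t * B)) as [D [HD _]].
  { intros n. specialize (CB n 1%nat). apply Rmult_le_reg_r with t; [lra|].
    replace (2 / t * M n * t) with (2 * M n) by (field; lra). lra. }
  { intros n. rewrite rsum_scal. apply Rmult_le_compat_l; auto. left; apply Rdiv_lt_0_compat; lra. }
  exists D. intros eps He. set (K := 8 * B / (t * t)).
  assert (HK : 0 <= K) by (unfold K; apply Rdiv_le_0_compat; nra).
  exists (Rmin (t / 2) (eps / (K + 1))). split.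
  { apply Rmin_pos; [lra|apply Rdiv_lt_0_compat; lra]. }
  intros z Hz. replace (z - 0)%C with z in * by ring.
  assert (Z1 := Rlt_le_trans _ _ _ Hz (Rmin_l _ _)). assert (Z2 := Rlt_le_trans _ _ _ Hz (Rmin_r _ _)).
  assert (Sv : forall w, Cmod w < r -> Cser (fun n => g n w) (Csum (fun n => g n w))).
  { intros w Hw. destruct (Cser_dom (fun n => g n w) M B) as [l [Hl _]]; auto.
    apply (Csum_correct _ l Hl). }
  assert (Sz := Sv z ltac:(lra)). assert (S0 := Sv 0 ltac:(rewrite Cmod_0; lra)).
  assert (S3 := Cser_minus _ _ _ _ (Cser_minus _ _ _ _ Sz S0) (Cser_scal z _ _ HD)).
  assert (Fin : Cmod (Csum (fun n => g n z) - Csum (fun n => g n 0) - z * D)%C <= K * Cmod z ^ 2).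
  { apply (Cser_norm_le _ _ _ S3). intros n. eapply Rle_trans; [apply Cmod_csum|].
    apply Rle_trans with (rsum (fun k => 8 / (t * t) * Cmod z ^ 2 * M k) n).
    - apply rsum_le. intros k _.
      assert (P : PS (ccoef (g k) t) z (g k z)) by (apply (cauchy_ps (g k) r); auto; lra).
      assert (P0 : g k 0 = ccoef (g k) t 0).
      { apply (Cser_unique (fun n => ccoef (g k) t n * 0 ^ n)%C); [|apply PS_at_0].
        apply (cauchy_ps (g k) r); auto. rewrite Cmod_0; lra. }
      destruct (PS_conv (ccoef (g k) t) z t (2 * M k) ltac:(lra) (CB k) ltac:(lra)) as [l [Hl Hn]].
      assert (El := Cser_unique _ _ _ P Hl). subst l. specialize (Hn 2%nat). cbn [rsum csum] in Hn.
      simpl in Hn. rewrite P0.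
      replace (g k z - ccoef (g k) t 0 - z * ccoef (g k) t 1)%C
        with (g k z - (0 + ccoef (g k) t 0 * 1 + ccoef (g k) t 1 * (z * 1)))%C by ring.
      eapply Rle_trans; [exact Hn|]. set (q := Cmod z / t).
      assert (Hq : 0 <= q <= 1 / 2).
      { unfold q. split; [apply Rdiv_le_0_compat; [apply Cmod_ge_0|lra]|].
        apply Rmult_le_reg_r with t; [lra|]. unfold Rdiv at 1. rewrite Rmult_assoc, Rinv_l; lra. }
      assert (E1 : 8 / (t * t) * Cmod z ^ 2 * M k = 8 * q ^ 2 * M k) by (unfold q; field; lra).
      rewrite E1.
      assert (E2 : 2 * M k / (1 - q) - 2 * M k * (0 + 1 + q * 1) = 2 * M k * (q ^ 2 / (1 - q)))
        by (field; lra).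
      rewrite E2. assert (Q : q ^ 2 / (1 - q) <= 4 * q ^ 2).
      { apply Rmult_le_reg_r with (1 - q); [lra|]. unfold Rdiv. rewrite Rmult_assoc, Rinv_l by lra. nra. }
      specialize (M0 k). nra.
    - rewrite rsum_scal. apply Rle_trans with (8 / (t * t) * Cmod z ^ 2 * B).
      + apply Rmult_le_compat_l; auto. apply Rmult_le_pos; [|apply pow2_ge_0].
        apply Rdiv_le_0_compat; nra.
      + right. unfold K. field. lra. }
  replace (D * z)%C with (z * D)%C by ring.
  eapply Rle_trans; [exact Fin|]. assert (Pz := Cmod_ge_0 z).
  replace (K * Cmod z ^ 2) with ((K * Cmod z) * Cmod z) by ring. apply Rmult_le_compat_r; auto.
  apply Rle_trans with ((K + 1) * (eps / (K + 1))).
  - apply Rmult_le_compat; lra.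
  - right; field; lra.
Qed.

Definition rcpow (x : R) (a : C) : C := Cexp (a * RtoC (ln x))%C.

Lemma Cmod_rcpow x a : Cmod (rcpow x a) = exp (Re a * ln x).
Proof. unfold rcpow. rewrite Cmod_Cexp, Re_mult_real. reflexivity. Qed.

Lemma rcpow_deriv (k a : C) x : 0 < x ->
  is_derive (fun t => Re (k * rcpow t a)%C) x (Re (k * (a * rcpow x (a - 1)))%C) /\
  is_derive (fun t => Im (k * rcpow t a)%C) x (Im (k * (a * rcpow x (a - 1)))%C).
Proof.
  intros Hx.
  assert (E : rcpow x (a - 1) = (rcpow x a * RtoC (/ x))%C).
  { unfold rcpow. replace ((a - 1) * RtoC (ln x))%C with (a * RtoC (ln x) - RtoC (ln x))%C by ring.
    rewrite Cexp_minus, Cexp_RtoC, exp_ln by auto. unfold Cdiv. rewrite RtoC_inv by lra. reflexivity. }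
  rewrite E. unfold rcpow, Cexp. destruct k as [k1 k2], a as [a1 a2].
  split.
  - apply (is_derive_ext (fun t => k1 * (exp (a1 * ln t) * cos (a2 * ln t)) - k2 * (exp (a1 * ln t) * sin (a2 * ln t)))).
    + intros t. simpl. replace (a1 * ln t - a2 * 0) with (a1 * ln t) by ring.
      replace (a1 * 0 + a2 * ln t) with (a2 * ln t) by ring. reflexivity.
    + auto_derive; auto. simpl. replace (a1 * ln x - a2 * 0) with (a1 * ln x) by ring.
      replace (a1 * 0 + a2 * ln x) with (a2 * ln x) by ring. field. lra.
  - apply (is_derive_ext (fun t => k1 * (exp (a1 * ln t) * sin (a2 * ln t)) + k2 * (exp (a1 * ln t) * cos (a2 * ln t)))).
    + intros t. simpl. replace (a1 * ln t - a2 * 0) with (a1 * ln t) by ring.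
      replace (a1 * 0 + a2 * ln t) with (a2 * ln t) by ring. reflexivity.
    + auto_derive; auto. simpl. replace (a1 * ln x - a2 * 0) with (a1 * ln x) by ring.
      replace (a1 * 0 + a2 * ln x) with (a2 * ln x) by ring. field. lra.
Qed.

Lemma taylor2_bound (g g1 g2 : R -> R) x B :
  (forall t, x <= t <= x + 1 -> is_derive g t (g1 t)) ->
  (forall t, x <= t <= x + 1 -> is_derive g1 t (g2 t)) ->
  (forall t, x <= t <= x + 1 -> Rabs (g2 t) <= B) -> Rabs (g (x + 1) - g x - g1 x) <= B.
Proof.
  intros H1 H2 HB.
  destruct (MVT_gen g x (x + 1) g1) as [c [Hc E]].
  - intros t. rewrite Rmin_left, Rmax_right by lra. intros Ht. apply H1; lra.
  - intros t. rewrite Rmin_left, Rmax_right by lra. intros Ht.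
    apply continuity_pt_filterlim, (ex_derive_continuous (K := R_AbsRing) (V := R_NormedModule)). exists (g1 t). apply H1; lra.
  - rewrite Rmin_left, Rmax_right in Hc by lra. rewrite E.
    destruct (MVT_gen g1 x c g2) as [d [Hd E2]].
    + intros t. rewrite Rmin_left, Rmax_right by lra. intros Ht. apply H2; lra.
    + intros t. rewrite Rmin_left, Rmax_right by lra. intros Ht.
      apply continuity_pt_filterlim, (ex_derive_continuous (K := R_AbsRing) (V := R_NormedModule)). exists (g2 t). apply H2; lra.
    + rewrite Rmin_left, Rmax_right in Hd by lra.
      replace (g1 c * (x + 1 - x) - g1 x) with (g2 d * (c - x)) by lra.
      rewrite Rabs_mult, (Rabs_pos_eq (c - x)) by lra.
      specialize (HB d ltac:(lra)). assert (P := Rabs_pos (g2 d)). nra.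
Qed.

(* With [phi(x) = x^(1 - s)], this is [phi(m + 1) - phi(m) - phi'(m)] at [m = n + 1]. *)
Definition reg_term (n : nat) (s : C) : C :=
  (rcpow (INR (S n) + 1) (1 - s) - rcpow (INR (S n)) (1 - s) - (1 - s) * rcpow (INR (S n)) (- s))%C.

(** The second derivative of x^(1-s) is -s (1-s) x^(-s-1); its decay, one power better than x^(-s),
    is what moves convergence from Re s > 1 to Re s > 0. *)
Lemma Cmod_reg_term n s : 0 < Re s ->
  Cmod (reg_term n s) <= 2 * (Cmod s * Cmod (1 - s)%C) * npow (1 + Re s) (S n).
Proof.
  intros Hs. set (x := INR (S n)).
  assert (Hx : 0 < x) by (apply lt_0_INR; lia).
  assert (E2 : forall t, x <= t <= x + 1 ->
    Cmod ((1 - s) * (- s * rcpow t (- s - 1)))%C <= Cmod s * Cmod (1 - s)%C * npow (1 + Re s) (S n)).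
  { intros t Ht. rewrite !Cmod_mult, Cmod_opp, Cmod_rcpow.
    replace (Cmod (1 - s)%C * (Cmod s * exp (Re (- s - 1)%C * ln t)))
      with (Cmod s * Cmod (1 - s)%C * exp (Re (- s - 1)%C * ln t)) by ring.
    apply Rmult_le_compat_l; [apply Rmult_le_pos; apply Cmod_ge_0|].
    unfold npow. fold x. apply exp_le. rewrite Re_minus, Re_opp. simpl (Re 1).
    assert (L : ln x <= ln t) by (apply ln_le; lra). nra. }
  assert (D1 : forall t, x <= t <= x + 1 ->
     is_derive (fun u => Re (1 * rcpow u (1 - s))%C) t (Re ((1 - s) * rcpow t (- s))%C) /\
     is_derive (fun u => Im (1 * rcpow u (1 - s))%C) t (Im ((1 - s) * rcpow t (- s))%C)).
  { intros t Ht. destruct (rcpow_deriv 1 (1 - s) t ltac:(lra)) as [A B].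
    replace (1 * ((1 - s) * rcpow t (1 - s - 1)))%C with ((1 - s) * rcpow t (- s))%C in A, B
      by (replace (1 - s - 1)%C with (- s)%C by ring; ring). auto. }
  assert (D2 : forall t, x <= t <= x + 1 ->
     is_derive (fun u => Re ((1 - s) * rcpow u (- s))%C) t (Re ((1 - s) * (- s * rcpow t (- s - 1)))%C) /\
     is_derive (fun u => Im ((1 - s) * rcpow u (- s))%C) t (Im ((1 - s) * (- s * rcpow t (- s - 1)))%C)).
  { intros t Ht. apply (rcpow_deriv (1 - s) (- s) t ltac:(lra)). }
  eapply Rle_trans; [apply Cmod_le_ReIm|].
  assert (A1 := taylor2_bound _ _ _ x _ (fun t Ht => proj1 (D1 t Ht)) (fun t Ht => proj1 (D2 t Ht))
    (fun t Ht => Rle_trans _ _ _ (re_le_Cmod _) (E2 t Ht))).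
  assert (A2 := taylor2_bound _ _ _ x _ (fun t Ht => proj2 (D1 t Ht)) (fun t Ht => proj2 (D2 t Ht))
    (fun t Ht => Rle_trans _ _ _ (im_le_Cmod _) (E2 t Ht))).
  unfold reg_term. fold x. cbv beta in A1, A2. rewrite !Cmult_1_l in A1, A2. rewrite !Re_minus, !Im_minus. lra.
Qed.

Lemma reg_term_holo n s : exists l, Cderiv (reg_term n) s l.
Proof.
  assert (D : forall x a b, exists l, Cderiv (fun s => rcpow x (a + b * s)) s l).
  { intros x a b. eexists. unfold rcpow. apply Cderiv_exp_comp.
    apply (Cderiv_ext (fun s => RtoC (ln x) * (a + b * s))%C); [intros; ring|].
    apply Cderiv_scal. apply Cderiv_plus; [apply Cderiv_const|apply Cderiv_scal, Cderiv_id]. }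
  destruct (D (INR (S n) + 1) 1 (-1)) as [l1 D1].
  destruct (D (INR (S n)) 1 (-1)) as [l2 D2]. destruct (D (INR (S n)) 0 (-1)) as [l3 D3].
  eexists. eapply (Cderiv_ext (fun s => rcpow (INR (S n) + 1) (1 + (-1) * s) - rcpow (INR (S n)) (1 + (-1) * s)
     - (1 - s) * rcpow (INR (S n)) (0 + (-1) * s))%C).
  - intros w. unfold reg_term. replace (1 + (-1) * w)%C with (1 - w)%C by ring.
    replace (0 + (-1) * w)%C with (- w)%C by ring. reflexivity.
  - apply Cderiv_minus; [apply Cderiv_minus; [exact D1|exact D2]|].
    apply Cderiv_mult; [|exact D3]. apply Cderiv_minus; [apply Cderiv_const|apply Cderiv_id].
Qed.

(* The continuation of [(s - 1) zeta(s)] to [Re s > 0]. *)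
Definition reg_zeta (s : C) : C := (1 + Csum (fun n => reg_term n s))%C.

Lemma reg_zeta_Cser s : 0 < Re s -> Cser (fun n => reg_term n s) (Csum (fun n => reg_term n s)) /\
  Cmod (Csum (fun n => reg_term n s)) <= 2 * (Cmod s * Cmod (1 - s)%C) * (1 + / Re s).
Proof.
  intros Hs. set (K := 2 * (Cmod s * Cmod (1 - s)%C)).
  assert (HK : 0 <= K) by (unfold K; assert (X := Cmod_ge_0 s); assert (Y := Cmod_ge_0 (1 - s)%C); nra).
  destruct (Cser_dom (fun n => reg_term n s) (fun n => K * npow (1 + Re s) (S n)) (K * (1 + / Re s)))
    as [l [Hl Hb]].
  - intros n. apply Cmod_reg_term; auto.
  - intros n. rewrite rsum_scal. apply Rmult_le_compat_l; auto. apply npow_sum; auto.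
  - assert (C1 := Csum_correct _ l Hl). split; auto.
    rewrite (Cser_unique _ _ _ C1 Hl). specialize (Hb O). simpl in Hb.
    replace (l - 0)%C with l in Hb by ring. lra.
Qed.

Lemma reg_zeta_holo : holo (fun s => 0 < Re s) reg_zeta.
Proof.
  intros s Hs. set (r := Re s / 2). assert (Hr : 0 < r) by (unfold r; lra).
  assert (ReB : forall z, Cmod z < r -> r <= Re (s + z)%C).
  { intros z Hz. rewrite Re_plus. assert (X := re_le_Cmod z). apply Rabs_le_between in X.
    unfold r in *. lra. }
  set (A := Cmod s + r). assert (Ps := Cmod_ge_0 s).
  destruct (holo_series_deriv (fun n z => reg_term n (s + z)%C)
     (fun n => 2 * (A * (1 + A)) * npow (1 + r) (S n)) (2 * (A * (1 + A)) * (1 + / r)) r Hr) as [l Hl].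
  - intros n z _. destruct (reg_term_holo n (s + z)%C) as [l Hl]. exists l. apply Cderiv_shift; auto.
  - intros n z Hz. assert (R1 := ReB z Hz).
    eapply Rle_trans; [apply Cmod_reg_term; lra|].
    assert (A1 : Cmod (s + z)%C <= A) by (unfold A; eapply Rle_trans; [apply Cmod_triangle|]; lra).
    assert (A2 : Cmod (1 - (s + z))%C <= 1 + A).
    { eapply Rle_trans; [apply Cmod_triangle_minus|]. rewrite Cmod_1. lra. }
    assert (P1 := Cmod_ge_0 (s + z)%C). assert (P2 := Cmod_ge_0 (1 - (s + z))%C).
    apply Rmult_le_compat.
    + nra.
    + left; apply npow_pos.
    + apply Rmult_le_compat_l; [lra|]. apply Rmult_le_compat; auto.
    + apply npow_le. lra.
  - intros n. rewrite rsum_scal. apply Rmult_le_compat_l; [unfold A; nra|]. apply npow_sum; auto.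
  - exists l. apply (Cderiv_ext (fun z => 1 + (fun h => Csum (fun n => reg_term n (s + h)%C)) (- s + z))%C).
    + intros z. unfold reg_zeta. f_equal. cbv beta. f_equal. apply functional_extensionality. intros n. f_equal. ring.
    + eapply Cderiv_eq; [apply Cderiv_plus; [apply Cderiv_const|]|].
      * apply (Cderiv_shift (fun h => Csum (fun n => reg_term n (s + h)%C))).
        replace (- s + s)%C with (RtoC 0) by ring. exact Hl.
      * ring.
Qed.

(** The degree of the polynomial is immaterial: later only its logarithm counts. *)
Lemma reg_zeta_bound s : 1 / 8 <= Re s -> Cmod (reg_zeta s) <= 20 * (1 + Cmod s) ^ 2.
Proof.
  intros Hs. destruct (reg_zeta_Cser s ltac:(lra)) as [_ B]. unfold reg_zeta.
  eapply Rle_trans; [apply Cmod_triangle|]. rewrite Cmod_1.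
  assert (X := Cmod_triangle_minus 1 s). rewrite Cmod_1 in X.
  assert (I : / Re s <= 8).
  { replace 8 with (/ (1 / 8)) by field. apply Rinv_le_contravar; lra. }
  assert (P := Cmod_ge_0 s). assert (P2 := Cmod_ge_0 (1 - s)%C).
  assert (2 * (Cmod s * Cmod (1 - s)%C) * (1 + / Re s) <= 2 * (Cmod s * (1 + Cmod s)) * 9).
  { apply Rmult_le_compat.
    - nra.
    - assert (0 < / Re s) by (apply Rinv_0_lt_compat; lra). lra.
    - nra.
    - lra. }
  nra.
Qed.

Lemma reg_zeta_1 : reg_zeta 1 = 1.
Proof.
  unfold reg_zeta. rewrite (Csum_eq _ 0); [ring|].
  apply Cser_zero. intros n. unfold reg_term. replace (1 - 1)%C with (RtoC 0) by ring.
  unfold rcpow. rewrite !Cmult_0_l, Cexp_0. ring.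
Qed.

Lemma reg_term_telescope n s :
  csum (fun k => reg_term k s) n = (rcpow (INR n + 1) (1 - s) - 1 + (s - 1) * csum (dirichlet_term s) n)%C.
Proof.
  induction n as [|n IH]; cbn [csum].
  - simpl (INR 0). rewrite Rplus_0_l. unfold rcpow. rewrite ln_1, Cmult_0_r, Cexp_0. ring.
  - rewrite IH. unfold reg_term. rewrite <- S_INR.
    replace (dirichlet_term s n) with (rcpow (INR (S n)) (- s)) by reflexivity. ring.
Qed.

Lemma identity_ball f g p r d : 0 < d -> holo (fun z => Cmod (z - p)%C < r) f ->
  holo (fun z => Cmod (z - p)%C < r) g -> (forall z, Cmod (z - p)%C < d -> f z = g z) ->
  forall z, Cmod (z - p)%C < r -> f z = g z.
Proof.
  intros Hd Hf Hg E z Hz.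
  assert (Sh : forall h, holo (fun z => Cmod (z - p)%C < r) h -> holo (fun z => Cmod z < r) (fun w => h (p + w)%C)).
  { intros h Hh w Hw. destruct (Hh (p + w)%C) as [l Hl].
    - replace (p + w - p)%C with w by ring. auto.
    - exists l. apply Cderiv_shift; auto. }
  set (w := (z - p)%C) in *. assert (Pw := Cmod_ge_0 w).
  set (t := (Cmod w + r) / 2). assert (Ht : 0 < t < r) by (unfold t; lra).
  assert (Pf := fun v Hv => cauchy_ps _ r t v Ht (Sh f Hf) Hv).
  assert (Pg := fun v Hv => cauchy_ps _ r t v Ht (Sh g Hg) Hv).
  assert (EQ : forall n, ccoef (fun w => f (p + w)%C) t n = ccoef (fun w => g (p + w)%C) t n).
  { apply (PS_unique _ _ (fun w => f (p + w)%C) (Rmin d t)); [apply Rmin_pos; lra| |].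
    - intros v Hv. apply Pf. eapply Rlt_le_trans; [exact Hv|apply Rmin_r].
    - intros v Hv. rewrite (E (p + v)%C).
      + apply (Pg v). eapply Rlt_le_trans; [exact Hv|apply Rmin_r].
      + replace (p + v - p)%C with v by ring. eapply Rlt_le_trans; [exact Hv|apply Rmin_l]. }
  assert (X1 := Pf w ltac:(unfold t; lra)). assert (X2 := Pg w ltac:(unfold t; lra)).
  cbv beta in X1, X2. replace (p + w)%C with z in X1, X2 by (unfold w; ring).
  apply (Cser_unique _ _ _ X1). eapply Cser_ext; [|exact X2]. intros n. cbv beta. rewrite EQ. reflexivity.
Qed.

(** A chain of discs of radius r whose centres are at most r / 2 apart: each next centre has a
    neighbourhood inside the previous disc, and [identity_ball] takes over. *)
Lemma identity_segment f g p q r (D : C -> Prop) : 0 < r -> holo D f -> holo D g ->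
  (forall tau, 0 <= tau <= 1 -> forall z, Cmod (z - (p + RtoC tau * (q - p)))%C < r -> D z) ->
  (forall z, Cmod (z - p)%C < r -> f z = g z) ->
  forall z, Cmod (z - q)%C < r -> f z = g z.
Proof.
  intros Hr Hf Hg HD E.
  set (L := Cmod (q - p)%C). assert (PL : 0 <= L) by apply Cmod_ge_0.
  destruct (archimed_cor1 (r / 2 / (L + 1))) as [N [HN HN0]]; [apply Rdiv_lt_0_compat; lra|].
  assert (PN : 0 < INR N) by (apply lt_0_INR; auto).
  set (pt := fun k : nat => (p + RtoC (INR k / INR N) * (q - p))%C).
  assert (K : forall k, (k <= N)%nat -> forall z, Cmod (z - pt k)%C < r -> f z = g z).
  { induction k as [|k IH]; intros Hk.
    - replace (pt O) with p; auto. unfold pt. simpl (INR 0). unfold Rdiv. rewrite Rmult_0_l. ring.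
    - specialize (IH ltac:(lia)).
      assert (Tk : 0 <= INR (S k) / INR N <= 1).
      { split; [apply Rdiv_le_0_compat; auto; apply pos_INR|].
        apply Rmult_le_reg_r with (INR N); auto. unfold Rdiv. rewrite Rmult_assoc, Rinv_l by lra.
        rewrite Rmult_1_r, Rmult_1_l. apply le_INR; auto. }
      apply (identity_ball f g (pt (S k)) r (r / 2)); [lra| | |].
      + intros z Hz. apply Hf. apply (HD _ Tk). exact Hz.
      + intros z Hz. apply Hg. apply (HD _ Tk). exact Hz.
      + intros z Hz. apply IH. eapply Rle_lt_trans; [apply (Cmod_dist_triangle z (pt (S k)) (pt k))|].
        assert (X : Cmod (pt (S k) - pt k)%C <= r / 2); [|lra].
        replace (pt (S k) - pt k)%C with (RtoC (/ INR N) * (q - p))%C.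
        * rewrite Cmod_mult, Cmod_R, Rabs_pos_eq by (left; apply Rinv_0_lt_compat; auto). fold L.
          apply Rle_trans with (r / 2 / (L + 1) * (L + 1)).
          -- apply Rmult_le_compat; try lra. left; apply Rinv_0_lt_compat; auto.
          -- right; field; lra.
        * unfold pt. rewrite S_INR. replace ((INR k + 1) / INR N) with (INR k / INR N + / INR N) by (field; lra).
          rewrite RtoC_plus. ring. }
  assert (X := K N (le_n N)). replace (pt N) with q in X; auto.
  unfold pt. replace (INR N / INR N) with 1 by (field; lra). ring.
Qed.

(** The differences of x^(1-s) telescope to (n+1)^(1-s) - 1, whose first part tends to 0 for Re s >
    1; the derivatives leave (s - 1) times the Dirichlet series. *)
Lemma reg_zeta_eq_right zeta s : is_riemann_zeta zeta -> 1 < Re s -> (zeta s * (s - 1))%C = reg_zeta s.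
Proof.
  intros Hzeta Hs. unfold reg_zeta. assert (S1 := zeta_Cser zeta s Hzeta Hs).
  rewrite (Csum_eq _ (-(1) + (s - 1) * zeta s)%C); [ring|].
  intros eps He. assert (P := Cmod_ge_0 (s - 1)%C).
  destruct (S1 (eps / 2 / (Cmod (s - 1)%C + 1))) as [N1 H1]; [apply Rdiv_lt_0_compat; lra|].
  destruct (npow_tail_lim (Re s - 1) (eps / 2) ltac:(lra) ltac:(lra)) as [N2 [_ H2]].
  exists (N1 + N2)%nat. intros n Hn. rewrite reg_term_telescope.
  specialize (H1 n ltac:(lia)). specialize (H2 (S n) ltac:(lia)).
  replace (rcpow (INR n + 1) (1 - s) - 1 + (s - 1) * csum (dirichlet_term s) n - (- (1) + (s - 1) * zeta s))%C
    with (rcpow (INR n + 1) (1 - s) + (s - 1) * (csum (dirichlet_term s) n - zeta s))%C by ring.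
  eapply Rle_lt_trans; [apply Cmod_triangle|]. rewrite Cmod_mult, Cmod_rcpow.
  rewrite <- S_INR. replace (exp (Re (1 - s)%C * ln (INR (S n)))) with (npow (Re s - 1) (S n)).
  2:{ unfold npow. f_equal. rewrite Re_minus. simpl. ring. }
  assert (Cmod (s - 1)%C * Cmod (csum (dirichlet_term s) n - zeta s)%C <= eps / 2); [|lra].
  apply Rle_trans with ((Cmod (s - 1)%C + 1) * (eps / 2 / (Cmod (s - 1)%C + 1))).
  - apply Rmult_le_compat; auto using Cmod_ge_0; lra.
  - right; field; lra.
Qed.

Lemma Rabs_Re_le z p r : Cmod (z - p)%C < r -> Rabs (Re z - Re p) < r.
Proof. intros H. rewrite <- Re_minus. eapply Rle_lt_trans; [apply re_le_Cmod|auto]. Qed.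

Lemma Rabs_Im_le z p r : Cmod (z - p)%C < r -> Rabs (Im z - Im p) < r.
Proof. intros H. rewrite <- Im_minus. eapply Rle_lt_trans; [apply im_le_Cmod|auto]. Qed.

(* Continue from [Re s > 1] along a horizontal segment away from the real axis,
   then along a vertical one down to [s]; neither meets the pole. *)
Theorem reg_zeta_eq zeta s : is_riemann_zeta zeta -> 0 < Re s -> s <> 1 -> (zeta s * (s - 1))%C = reg_zeta s.
Proof.
  intros Hzeta Hs N1. destruct s as [x y]. simpl in Hs.
  (* The detour height [h = y + sg] moves away from the real axis, so |h| >= 1. *)
  set (sg := if Rle_dec 0 y then 1 else -1).
  assert (Hsg : (0 <= y /\ sg = 1) \/ (y < 0 /\ sg = -1)).
  { unfold sg. destruct (Rle_dec 0 y); [left|right]; split; lra. }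
  set (h := y + sg). clearbody sg.
  set (D := fun z : C => 0 < Re z /\ z <> 1).
  set (F := fun z => (zeta z * (z - 1))%C).
  assert (HF : holo D F).
  { intros z [Z1 Z2]. destruct (zeta_holo zeta Hzeta z Z2) as [l Hl]. eexists.
    apply Cderiv_mult; [exact Hl|]. apply Cderiv_minus; [apply Cderiv_id|apply Cderiv_const]. }
  assert (HG : holo D reg_zeta) by (intros z [Z1 Z2]; apply reg_zeta_holo; auto).
  (* The point differs from 1 in its real part or in its imaginary part; the discs along the
     vertical segment keep clear of the pole on that account. *)
  assert (Hdel : exists del, 0 < del /\ (del <= Rabs (x - 1) \/ del <= Rabs y)).
  { destruct (Req_dec x 1) as [E|E].
    - exists (Rabs y). split; [|lra]. apply Rabs_pos_lt. intros Ey. apply N1. subst. reflexivity.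
    - exists (Rabs (x - 1)). split; [|lra]. apply Rabs_pos_lt. lra. }
  destruct Hdel as [del [Hd Hd2]].
  set (r := Rmin (1 / 2) (Rmin (x / 2) del)).
  assert (Hr : 0 < r) by (repeat apply Rmin_pos; lra).
  assert (r1 : r <= 1 / 2) by apply Rmin_l.
  assert (r2 : r <= x / 2) by (eapply Rle_trans; [apply Rmin_r|apply Rmin_l]).
  assert (r3 : r <= del) by (eapply Rle_trans; [apply Rmin_r|apply Rmin_r]).
  change (F (x, y) = reg_zeta (x, y)).
  assert (A1 : forall z, Cmod (z - (2, h))%C < r -> F z = reg_zeta z).
  { intros z Hz0. apply reg_zeta_eq_right; auto. apply Rabs_Re_le in Hz0. simpl in Hz0.
    apply Rabs_def2 in Hz0. lra. }
  assert (A2 : forall z, Cmod (z - (x, h))%C < r -> F z = reg_zeta z).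
  { apply (identity_segment F reg_zeta (2, h) (x, h) r D); auto.
    intros tau Ht z Hz0.
    assert (X := Rabs_Re_le _ _ _ Hz0). assert (Y := Rabs_Im_le _ _ _ Hz0). simpl in X, Y.
    apply Rabs_def2 in X. apply Rabs_def2 in Y. split.
    - destruct (Rle_dec x 2); [assert (0 <= (2 - x) * (1 - tau)) by nra|assert (0 <= tau * (x - 2)) by nra]; lra.
    - intros E. subst z. simpl in Y. unfold h in Y. destruct Hsg as [[? ?]|[? ?]]; subst sg; nra. }
  apply (identity_segment F reg_zeta (x, h) (x, y) r D); auto.
  - intros tau Ht z Hz0.
    assert (X := Rabs_Re_le _ _ _ Hz0). assert (Y := Rabs_Im_le _ _ _ Hz0). simpl in X, Y.
    replace (x + (tau * (x + - x) - 0 * (y + - h))) with x in X by ring.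
    replace (h + (tau * (y + - h) + 0 * (x + - x))) with (y + (1 - tau) * sg) in Y by (unfold h; ring).
    split.
    + apply Rabs_def2 in X. lra.
    + intros E. subst z. simpl in X, Y. destruct Hd2 as [Q|Q].
      * rewrite Rabs_minus_sym in X. lra.
      * assert (Rabs y <= Rabs (0 - (y + (1 - tau) * sg))); [|lra].
        rewrite Rminus_0_l, Rabs_Ropp.
        destruct Hsg as [[? ?]|[? ?]]; subst sg; unfold Rabs; repeat destruct Rcase_abs; nra.
  - replace ((x, y) - (x, y))%C with (RtoC 0) by ring. rewrite Cmod_0. auto.
Qed.

Lemma zeta_growth zeta s : is_riemann_zeta zeta -> 1 / 8 <= Re s -> 1 <= Im s ->
  Cmod (zeta s) <= 20 * (1 + Cmod s) ^ 2.
Proof.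
  intros Hzeta Hs Hi.
  assert (N1 : s <> 1) by (intros E; subst; simpl in Hi; lra).
  assert (E := reg_zeta_eq zeta s Hzeta ltac:(lra) N1). apply (f_equal Cmod) in E. rewrite Cmod_mult in E.
  assert (B := reg_zeta_bound s Hs).
  assert (P : 1 <= Cmod (s - 1)%C).
  { assert (X := im_le_Cmod (s - 1)%C). rewrite Im_minus in X. simpl (Im 1) in X.
    rewrite Rabs_pos_eq in X by lra. lra. }
  assert (Q := Cmod_ge_0 (zeta s)). nra.
Qed.

(** * The Euler product *)

(* The [k]-rough integers; sieving out the multiples of one more prime multiplies
   their Dirichlet series by [1 - p^(-s)]. *)
Definition rough (k m : nat) : Prop := forall d, (2 <= d <= k)%nat -> ~ Nat.divide d m.

Definition chi (k m : nat) : C := if excluded_middle_informative (rough k m) then 1 else 0.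

Definition rterm (k : nat) (s : C) (n : nat) : C := (chi k (S n) * dirichlet_term s n)%C.

Lemma Cmod_chi_le k m : Cmod (chi k m) <= 1.
Proof. unfold chi. destruct excluded_middle_informative; rewrite ?Cmod_1, ?Cmod_0; lra. Qed.

Lemma chi_true k m : rough k m -> chi k m = 1.
Proof. unfold chi. destruct excluded_middle_informative; tauto. Qed.

Lemma chi_false k m : ~ rough k m -> chi k m = 0.
Proof. unfold chi. destruct excluded_middle_informative; tauto. Qed.

Lemma chi_iff k m k' m' : (rough k m <-> rough k' m') -> chi k m = chi k' m'.
Proof. intros H. unfold chi. do 2 destruct excluded_middle_informative; tauto. Qed.

Lemma Cmod_rterm k s n : Cmod (rterm k s n) <= npow (Re s) (S n).
Proof.
  unfold rterm. rewrite Cmod_mult, Cmod_dirichlet. assert (P := npow_pos (Re s) (S n)).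
  assert (Q := Cmod_chi_le k (S n)). nra.
Qed.

Definition rough_sum (k : nat) (s : C) : C := Csum (rterm k s).

Lemma rough_sum_Cser k s : 1 < Re s -> Cser (rterm k s) (rough_sum k s).
Proof.
  intros Hs.
  destruct (Cser_dom (rterm k s) (fun n => npow (Re s) (S n)) (1 + / (Re s - 1))) as [l [Hl _]].
  - intros n. apply Cmod_rterm.
  - intros n. assert (X := npow_sum (Re s - 1) n ltac:(lra)).
    replace (1 + (Re s - 1)) with (Re s) in X by ring. exact X.
  - apply (Csum_correct _ l Hl).
Qed.

Lemma rough_sum_1 zeta s : is_riemann_zeta zeta -> 1 < Re s -> rough_sum 1 s = zeta s.
Proof.
  intros Hz Hs. apply Csum_eq. apply Cser_ext with (dirichlet_term s); [|apply zeta_Cser; auto].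
  intros n. unfold rterm. rewrite chi_true; [ring|]. intros d Hd. lia.
Qed.

(** A [k]-rough integer other than 1 exceeds [k], so beyond the leading term only a tail of the
    Dirichlet series is left. *)
Lemma rough_sum_near_1 k s eta : (1 <= k)%nat -> 0 < eta -> 1 + eta <= Re s ->
  Cmod (rough_sum k s - 1)%C <= npow eta k / eta.
Proof.
  intros Hk He Hs. apply (Cser_le_tail (rterm k s) _ _ _ k); [apply rough_sum_Cser; lra|].
  intros n Hn.
  assert (E : csum (rterm k s) k = 1).
  { destruct k as [|k]; [lia|]. rewrite csum_shift.
    rewrite csum_zero.
    - unfold rterm at 1. rewrite dirichlet_0, chi_true; [ring|].
      intros d Hd H. apply Nat.divide_1_r in H. lia.
    - intros j Hj. unfold rterm. rewrite chi_false; [ring|].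
      intros H. apply (H (S (S j))); [lia|apply Nat.divide_refl]. }
  replace n with (k + (n - k))%nat by lia. rewrite csum_add, E.
  match goal with |- Cmod ?x <= _ => replace x with (csum (fun j => rterm k s (k + j)%nat) (n - k)) by ring end.
  eapply Rle_trans; [apply Cmod_csum|]. eapply Rle_trans; [|apply (npow_tail eta k (n - k) He Hk)].
  apply rsum_le. intros j _. eapply Rle_trans; [apply Cmod_rterm|]. apply npow_le. lra.
Qed.

Lemma rough_sum_bound k s eta : (1 <= k)%nat -> 0 < eta -> 1 + eta <= Re s -> Cmod (rough_sum k s) <= 1 + / eta.
Proof.
  intros Hk He Hs. assert (X := rough_sum_near_1 k s eta Hk He Hs).
  assert (Y : npow eta k <= 1).
  { rewrite <- exp_0. apply exp_le. assert (0 <= ln (INR k)); [|nra].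
    rewrite <- ln_1. apply ln_le; [lra|]. apply (le_INR 1); auto. }
  assert (Z : npow eta k / eta <= / eta).
  { rewrite <- (Rmult_1_l (/ eta)). apply Rmult_le_compat_r; auto. left; apply Rinv_0_lt_compat; auto. }
  replace (rough_sum k s) with ((rough_sum k s - 1) + 1)%C by ring.
  eapply Rle_trans; [apply Cmod_triangle|]. rewrite Cmod_1. lra.
Qed.

Lemma rough_sum_composite k s : ~ rough k (S k) -> rough_sum (S k) s = rough_sum k s.
Proof.
  intros H. unfold rough_sum. f_equal. apply functional_extensionality. intros n. unfold rterm. f_equal.
  apply chi_iff. split; intros R d Hd; [apply R; lia|].
  destruct (Nat.eq_dec d (S k)) as [->|]; [|apply R; lia].
  intros D. apply H. intros e He De. apply (R e He). eapply Nat.divide_trans; eauto.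
Qed.

(** The hypothesis says that [S k] is prime: the gcd of it with d <= k is a divisor of at most k,
    hence 1, and Gauss's lemma removes the factor [S k]. *)
Lemma rough_mult k j : rough k (S k) -> (rough k (S k * j) <-> rough k j).
Proof.
  intros P. split; intros R d Hd D.
  - apply (R d Hd). apply Nat.divide_mul_r; auto.
  - apply (R d Hd). apply (Nat.gauss _ (S k)); auto.
    set (g := Nat.gcd d (S k)).
    assert (G1 : Nat.divide g d) by apply Nat.gcd_divide_l.
    assert (G2 : Nat.divide g (S k)) by apply Nat.gcd_divide_r.
    assert (G3 : (g <= d)%nat) by (apply Nat.divide_pos_le; auto; lia).
    assert (g <> 0)%nat by (intros E; rewrite E in G1; apply Nat.divide_0_l in G1; lia).
    destruct (Nat.eq_dec g 1); auto. exfalso. apply (P g); auto. lia.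
Qed.

Lemma dirichlet_mult s p j : (1 <= p)%nat -> (1 <= j)%nat ->
  dirichlet_term s (pred (p * j)) = (rcpow (INR p) (- s) * dirichlet_term s (pred j))%C.
Proof.
  intros Hp Hj. unfold dirichlet_term, rcpow. rewrite <- Cexp_plus. f_equal.
  replace (S (pred (p * j))) with (p * j)%nat by nia. replace (S (pred j)) with j by lia.
  rewrite mult_INR, ln_mult by (apply lt_0_INR; lia). rewrite RtoC_plus. ring.
Qed.

Lemma rough_sum_prime k s : (1 <= k)%nat -> rough k (S k) -> 1 < Re s ->
  rough_sum (S k) s = ((1 - rcpow (INR (S k)) (- s)) * rough_sum k s)%C.
Proof.
  intros Hk P Hs. set (p := S k). set (x := rcpow (INR p) (- s)).
  (* [D] keeps the [k]-rough multiples of p. Its partial sums are compared with those of the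
     original series along the lengths p M. *)
  set (D := fun n => (rterm k s n - rterm (S k) s n)%C).
  assert (D0 : forall n, ~ Nat.divide p (S n) -> D n = 0).
  { intros n N. unfold D, rterm. rewrite (chi_iff (S k) (S n) k (S n)); [ring|].
    split; intros R d Hd; [apply R; lia|].
    destruct (Nat.eq_dec d p) as [->|]; auto. apply R. unfold p in *. lia. }
  (* Terms are indexed from 0 and p = k + 1, so the index p M + k stands for the integer p (M +
     1). *)
  assert (D1 : forall M, D (p * M + k)%nat = (x * rterm k s M)%C).
  { intros M. unfold D, rterm.
    assert (ES : S (p * M + k) = (p * S M)%nat) by (unfold p; lia).
    rewrite ES. rewrite (chi_false (S k)).
    2:{ intros R. apply (R p); [unfold p; lia|]. exists (S M). lia. }
    rewrite (chi_iff k (p * S M) k (S M)) by (apply rough_mult; auto).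
    replace (p * M + k)%nat with (pred (p * S M)) by lia.
    rewrite dirichlet_mult by (unfold p; lia). fold x. simpl pred. ring. }
  assert (Fin : forall M, csum D (p * M) = (x * csum (rterm k s) M)%C).
  { induction M as [|M IH].
    - rewrite Nat.mul_0_r. simpl. ring.
    - replace (p * S M)%nat with (p * M + p)%nat by lia. rewrite csum_add, IH.
      change (csum (fun j => D (p * M + j)%nat) p) with (csum (fun j => D (p * M + j)%nat) (S k)). cbn [csum]. rewrite D1.
      rewrite (csum_zero (fun j => D (p * M + j)%nat)).
      + ring.
      + intros j Hj. apply D0. intros [q Hq]. unfold p in *. destruct (Nat.le_gt_cases q M); nia. }
  assert (S1 := Cser_minus _ _ _ _ (rough_sum_Cser k s Hs) (rough_sum_Cser (S k) s Hs)).
  assert (S2 := Cser_scal x _ _ (rough_sum_Cser k s Hs)).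
  assert (E : (rough_sum k s - rough_sum (S k) s)%C = (x * rough_sum k s)%C).
  { destruct (classic ((rough_sum k s - rough_sum (S k) s)%C = (x * rough_sum k s)%C)) as [|N]; auto. exfalso.
    set (u := (rough_sum k s - rough_sum (S k) s)%C) in *. set (v := (x * rough_sum k s)%C) in *.
    assert (Pu : 0 < Cmod (u - v)%C) by (apply Cmod_gt_0, Cminus_neq0; auto).
    destruct (S1 (Cmod (u - v)%C / 2)) as [n1 H1]; [lra|].
    destruct (S2 (Cmod (u - v)%C / 2)) as [n2 H2]; [lra|].
    specialize (H1 (p * (n1 + n2))%nat ltac:(unfold p; nia)). specialize (H2 (n1 + n2)%nat ltac:(lia)).
    change (csum (fun n => rterm k s n - rterm (S k) s n)%C (p * (n1 + n2))) with (csum D (p * (n1 + n2))) in H1.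
    rewrite Fin in H1. rewrite csum_scal in H2.
    assert (T := Cmod_dist_triangle u (x * csum (rterm k s) (n1 + n2)) v).
    rewrite (Cmod_minus_sym u (x * _)%C) in T. lra. }
  replace (rough_sum p s) with (rough_sum k s - (rough_sum k s - rough_sum (S k) s))%C by (unfold p; ring). rewrite E. ring.
Qed.

(** * Approximation by Dirichlet polynomials with nonnegative coefficients *)

(** A generalised Dirichlet polynomial, the sum of lam exp (- mu s) over the pairs (lam, mu). Only
    the signs of lam and mu will matter, so mu need not be recorded as the logarithm of an
    integer. *)
Fixpoint dpoly (l : list (R * R)) (s : C) : C :=
  match l with nil => 0 | (lam, mu) :: l' => (lam * Cexp (- s * mu) + dpoly l' s)%C end.

Definition dpoly_nonneg (l : list (R * R)) := forall q, In q l -> 0 <= fst q /\ 0 <= snd q.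

Lemma dpoly_app l1 l2 s : dpoly (l1 ++ l2) s = (dpoly l1 s + dpoly l2 s)%C.
Proof. induction l1 as [|[a b] l IH]; simpl; [|rewrite IH]; ring. Qed.

(** The first N terms of - log (1 - exp (- s L)), the logarithm of an Euler factor when exp L is a
    prime. *)
Fixpoint logpoly (L : R) (N : nat) : list (R * R) :=
  match N with O => nil | S n => (/ INR (S n), INR (S n) * L) :: logpoly L n end.

Lemma Cexp_INR n z : Cexp (INR n * z)%C = (Cexp z ^ n)%C.
Proof.
  induction n as [|n IH].
  - simpl (INR 0). rewrite Cmult_0_l, Cexp_0. reflexivity.
  - rewrite S_INR, RtoC_plus, Cpow_S, <- IH, <- Cexp_plus. f_equal. ring.
Qed.

Lemma logpoly_eq L N s :
  dpoly (logpoly L N) s = (- csum (fun n => PSint (fun n => - / 1 ^ S n) n * Cexp (- s * L) ^ n) (S N))%C.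
Proof.
  set (f := fun n => (PSint (fun n => - / 1 ^ S n) n * Cexp (- s * L) ^ n)%C).
  induction N as [|N IH].
  - unfold f. simpl. ring.
  - change (csum f (S (S N))) with (csum f (S N) + f (S N))%C. cbn [logpoly dpoly]. rewrite IH.
    assert (E : f (S N) = (- / INR (S N) * Cexp (INR (S N) * (- s * L)))%C).
    { unfold f. rewrite Cexp_INR. unfold PSint. rewrite Cpow_1_l. field. apply INR_S_neq0. }
    rewrite E, RtoC_mult, RtoC_inv by (apply not_0_INR; lia).
    replace (INR (S N) * (- s * L))%C with (- s * (INR (S N) * L))%C by ring. ring.
Qed.

Lemma logpoly_pos L N : 0 <= L -> dpoly_nonneg (logpoly L N).
Proof.
  intros HL. induction N as [|N IH]; intros q Hq; [destruct Hq|].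
  destruct Hq as [<-|Hq]; [|apply IH; auto].
  assert (0 < INR (S N)) by (apply lt_0_INR; lia). unfold fst, snd. split.
  - left. apply Rinv_0_lt_compat; auto.
  - apply Rmult_le_pos; lra.
Qed.

Lemma logpoly_approx eps : 0 < eps -> exists N, forall (L : R) (s : C), Cmod (Cexp (- s * L)%C) <= 1 / 2 ->
  Cmod (Cexp (- dpoly (logpoly L N) s) - (1 - Cexp (- s * L)))%C <= eps.
Proof.
  intros He.
  (* The tail of the logarithm is at most 2 (1/2)^N. Below 1/4 for (1/2)^N, the bound [Cexp_minus_1]
     applies; its factor 3 and |1 - x| <= 3/2 then give 9 (1/2)^N in all. *)
  destruct (pow_lt_1_zero (/ 2) ltac:(rewrite Rabs_pos_eq; lra) (Rmin (1 / 4) (eps / 9))) as [N HN].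
  { apply Rmin_pos; lra. }
  exists N. intros L s Hx. set (x := Cexp (- s * L)%C) in *. assert (Px := Cmod_ge_0 x).
  rewrite logpoly_eq. fold x. set (a := PSint (fun n => - / 1 ^ S n)%C).
  assert (LS : logser (fun z => 1 - z / 1)%C 1 a).
  { apply logser_linear; try lra; [|rewrite Cmod_1; lra]. intros E. apply RtoC_inj in E. lra. }
  destruct LS as [_ LS]. destruct (LS x ltac:(lra)) as [P E]. cbv beta in E.
  replace (1 - 0 / 1)%C with (RtoC 1) in E by field. rewrite Cmult_1_l in E.
  replace (1 - x / 1)%C with (1 - x)%C in E by field.
  assert (Ba : forall n, Cmod (a n) * 1 ^ n <= 1).
  { intros n. rewrite pow1, Rmult_1_r. destruct n as [|n].
    - simpl. rewrite Cmod_0. lra.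
    - unfold a. rewrite Cmod_PSint_linear; [|intros E1; apply RtoC_inj in E1; lra|lia].
      rewrite Cmod_1, pow1, Rinv_1, Rmult_1_r. rewrite <- Rinv_1. apply Rinv_le_contravar; [lra|].
      apply (le_INR 1). lia. }
  destruct (PS_conv a x 1 1 ltac:(lra) Ba ltac:(lra)) as [l [Hl Hn]].
  assert (El := Cser_unique _ _ _ P Hl). rewrite <- El in Hn. specialize (Hn (S N)).
  replace (Cmod x / 1) with (Cmod x) in Hn by field.
  set (sN := csum (fun n => a n * x ^ n)%C (S N)) in *.
  assert (T : 1 / (1 - Cmod x) - 1 * rsum (fun k => Cmod x ^ k) (S N) <= 2 * (/ 2) ^ N).
  { assert (E2 : forall m, rsum (fun k => Cmod x ^ k) m = (1 - Cmod x ^ m) / (1 - Cmod x)).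
    { induction m; cbn [rsum]; [|rewrite IHm]; simpl; field; lra. }
    rewrite E2. replace (1 / (1 - Cmod x) - 1 * ((1 - Cmod x ^ S N) / (1 - Cmod x)))
      with (Cmod x ^ S N / (1 - Cmod x)) by (field; lra).
    assert (P2 : Cmod x ^ S N <= (/ 2) ^ S N) by (apply pow_incr; lra).
    apply Rmult_le_reg_r with (1 - Cmod x); [lra|]. unfold Rdiv. rewrite Rmult_assoc, Rinv_l by lra.
    assert (P3 : 0 < (/ 2) ^ N) by (apply pow_lt; lra). simpl in P2. simpl. nra. }
  specialize (HN N (le_n N)). rewrite Rabs_pos_eq in HN by (apply pow_le; lra).
  assert (H1 := Rlt_le_trans _ _ _ HN (Rmin_l _ _)). assert (H2 := Rlt_le_trans _ _ _ HN (Rmin_r _ _)).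
  replace (- - sN)%C with (PSf a x + (sN - PSf a x))%C by ring.
  rewrite Cexp_plus, <- E.
  replace ((1 - x) * Cexp (sN - PSf a x) - (1 - x))%C with ((1 - x) * (Cexp (sN - PSf a x) - 1))%C by ring.
  rewrite Cmod_mult. rewrite Cmod_minus_sym in Hn.
  assert (Q := Cexp_minus_1 (sN - PSf a x)%C ltac:(lra)).
  assert (Q1 : Cmod (1 - x)%C <= 3 / 2).
  { eapply Rle_trans; [apply Cmod_triangle_minus|]. rewrite Cmod_1. lra. }
  assert (Q2 := Cmod_ge_0 (1 - x)%C). assert (Q3 := Cmod_ge_0 (Cexp (sN - PSf a x) - 1)%C).
  apply Rle_trans with (3 / 2 * (3 * (2 * (/ 2) ^ N))); [|lra].
  apply Rmult_le_compat; lra.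
Qed.

(** Induction on k: nothing changes at a composite number, and at a prime the polynomial is extended
    by a truncated logarithm of its Euler factor. The error stays uniform in Re s >= 1 + eta since
    [rough_sum] is bounded there. *)
Lemma zeta_approx_rough zeta eta k : is_riemann_zeta zeta -> 0 < eta -> (1 <= k)%nat -> forall eps, 0 < eps ->
  exists l, dpoly_nonneg l /\ forall s, 1 + eta <= Re s ->
    Cmod (zeta s * Cexp (- dpoly l s) - rough_sum k s)%C <= eps.
Proof.
  intros Hzeta He Hk. induction Hk as [|k Hk IH]; intros eps Heps.
  - exists nil. split; [intros q []|]. intros s Hs. rewrite (rough_sum_1 zeta) by (auto; lra). simpl.
    replace (- 0)%C with (RtoC 0) by ring. rewrite Cexp_0.
    replace (zeta s * 1 - zeta s)%C with (RtoC 0) by ring. rewrite Cmod_0. lra.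
  - destruct (classic (rough k (S k))) as [P|N].
    2:{ destruct (IH eps Heps) as [l [Hl H]]. exists l. split; auto. intros s Hs.
        rewrite rough_sum_composite; auto. }
    destruct (IH (eps / 4)) as [l [Hl H]]; [lra|].
    assert (Pe : 0 < / eta) by (apply Rinv_0_lt_compat; auto).
    destruct (logpoly_approx (Rmin (1 / 2) (eps / 2 / (1 + / eta)))) as [N HN].
    { apply Rmin_pos; [lra|]. apply Rdiv_lt_0_compat; lra. }
    set (L := ln (INR (S k))).
    assert (HL : ln 2 <= L) by (apply ln_le; [lra|apply (le_INR 2); lia]).
    assert (L2 := ln_lt_2).
    exists (l ++ logpoly L N). split.
    { intros q Hq. apply in_app_or in Hq. destruct Hq as [Hq|Hq]; [apply Hl; auto|].
      apply (logpoly_pos L N); auto. lra. }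
    intros s Hs. rewrite rough_sum_prime by (auto; lra). fold L.
    change (rcpow (INR (S k)) (- s)) with (Cexp (- s * L)).
    assert (Hx : Cmod (Cexp (- s * L)%C) <= 1 / 2).
    { rewrite Cmod_Cexp, Re_mult_real, Re_opp.
      apply Rle_trans with (exp (- ln 2)).
      - apply exp_le. nra.
      - rewrite exp_Ropp, exp_ln by lra. lra. }
    specialize (HN L s Hx). specialize (H s Hs).
    set (x := Cexp (- s * L)%C) in *. set (Q := dpoly (logpoly L N) s) in *.
    assert (B1 := Rle_trans _ _ _ HN (Rmin_l _ _)). assert (B2 := Rle_trans _ _ _ HN (Rmin_r _ _)).
    rewrite dpoly_app. fold Q.
    replace (- (dpoly l s + Q))%C with (- dpoly l s + - Q)%C by ring. rewrite Cexp_plus.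
    replace (zeta s * (Cexp (- dpoly l s) * Cexp (- Q)) - (1 - x) * rough_sum k s)%C
      with ((zeta s * Cexp (- dpoly l s) - rough_sum k s) * Cexp (- Q) + rough_sum k s * (Cexp (- Q) - (1 - x)))%C by ring.
    eapply Rle_trans; [apply Cmod_triangle|]. rewrite !Cmod_mult.
    assert (BQ : Cmod (Cexp (- Q)) <= 2).
    { replace (Cexp (- Q)) with ((Cexp (- Q) - (1 - x)) + (1 - x))%C by ring.
      eapply Rle_trans; [apply Cmod_triangle|].
      assert (Q1 := Cmod_triangle_minus 1 x). rewrite Cmod_1 in Q1. lra. }
    assert (BA := rough_sum_bound k s eta Hk He Hs).
    assert (X1 : Cmod (zeta s * Cexp (- dpoly l s) - rough_sum k s)%C * Cmod (Cexp (- Q)) <= eps / 4 * 2)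
      by (apply Rmult_le_compat; auto using Cmod_ge_0).
    assert (X2 : Cmod (rough_sum k s) * Cmod (Cexp (- Q) - (1 - x))%C <= (1 + / eta) * (eps / 2 / (1 + / eta)))
      by (apply Rmult_le_compat; auto using Cmod_ge_0).
    replace ((1 + / eta) * (eps / 2 / (1 + / eta))) with (eps / 2) in X2 by (field; lra).
    lra.
Qed.

(** The Euler product in multiplicative form: for large k the [k]-rough series is close to 1,
    uniformly in the half-plane. *)
Theorem zeta_approx zeta eta eps : is_riemann_zeta zeta -> 0 < eta -> 0 < eps ->
  exists l, dpoly_nonneg l /\ forall s, 1 + eta <= Re s -> Cmod (zeta s * Cexp (- dpoly l s) - 1)%C <= eps.
Proof.
  intros Hzeta He Hp.
  destruct (npow_tail_lim eta (eps / 2 * eta) He) as [k [Hk Hlim]]; [nra|].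
  destruct (zeta_approx_rough zeta eta k Hzeta He Hk (eps / 2)) as [l [Hl H]]; [lra|].
  exists l. split; auto. intros s Hs. specialize (H s Hs). specialize (Hlim k (le_n k)).
  assert (X := rough_sum_near_1 k s eta Hk He Hs).
  assert (Y : npow eta k / eta <= eps / 2).
  { apply Rmult_le_reg_r with eta; auto. unfold Rdiv at 1. rewrite Rmult_assoc, Rinv_l; lra. }
  eapply Rle_trans; [apply (Cmod_dist_triangle _ (rough_sum k s))|]. lra.
Qed.

(** * Taylor coefficients of Dirichlet polynomials and of log zeta *)

(** The coefficients follow from the differential equation f' = b f by comparing power series. *)
Lemma Cexp_PS (b z : C) : PS (fun n => b ^ n / INR (fact n))%C z (Cexp (b * z)).
Proof.
  set (f := fun z => Cexp (b * z)).
  assert (D : forall z, Cderiv f z (b * f z)%C).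
  { intros w. eapply Cderiv_eq; [apply Cderiv_exp_comp, Cderiv_scal, Cderiv_id|]. unfold f. ring. }
  set (r := Cmod z + 1). assert (Pz := Cmod_ge_0 z).
  assert (H : holo (fun z => Cmod z < r + 1) f) by (intros w _; eexists; apply D).
  assert (P : forall w, Cmod w < r -> PS (ccoef f r) w (f w))
    by (intros; apply (cauchy_ps f (r + 1)); auto; unfold r; lra).
  assert (Rec : forall n, PSd (ccoef f r) n = (b * ccoef f r n)%C).
  { apply (PS_unique _ _ (fun w => b * f w)%C r); [unfold r; lra| |].
    - intros w Hw. destruct (PS_disc_deriv (ccoef f r) r f ltac:(unfold r; lra) P w Hw) as [D1 P1].
      rewrite (Cderiv_unique f w (b * f w)%C (PSf (PSd (ccoef f r)) w)); auto.
    - intros w Hw. apply Cser_ext with (fun n => b * (ccoef f r n * w ^ n))%C; [intros; ring|].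
      apply Cser_scal, P; auto. }
  assert (E : forall n, ccoef f r n = (b ^ n / INR (fact n))%C).
  { induction n as [|n IH].
    - assert (X := Cser_unique _ _ _ (P 0 ltac:(rewrite Cmod_0; unfold r; lra)) (PS_at_0 _)).
      rewrite <- X. unfold f. rewrite Cmult_0_r, Cexp_0. simpl. field.
    - specialize (Rec n). unfold PSd in Rec. rewrite IH in Rec.
      assert (N1 := INR_S_neq0 n).
      assert (N2 : RtoC (INR (fact n)) <> 0).
      { apply RtoC_neq0, INR_fact_neq_0. }
      replace (ccoef f r (S n)) with (/ INR (S n) * (INR (S n) * ccoef f r (S n)))%C by (field; auto).
      rewrite Rec, fact_simpl, mult_INR, RtoC_mult, Cpow_S. field. auto. }
  apply Cser_ext with (fun n => ccoef f r n * z ^ n)%C.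
  - intros n. rewrite E. reflexivity.
  - apply P. unfold r. lra.
Qed.

Fixpoint dpoly_coef (l : list (R * R)) (s : C) (n : nat) : C :=
  match l with nil => 0
  | (lam, mu) :: l' => (lam * Cexp (- s * mu) * ((- mu) ^ n / INR (fact n)) + dpoly_coef l' s n)%C end.

Lemma dpoly_PS l s z : PS (dpoly_coef l s) z (dpoly l (s + z)%C).
Proof.
  induction l as [|[lam mu] l IH].
  - change (dpoly nil (s + z)%C) with (RtoC 0). apply Cser_zero. intros n. simpl. ring.
  - cbn [dpoly dpoly_coef].
    apply Cser_ext with (fun n => (lam * Cexp (- s * mu)) * ((- mu) ^ n / INR (fact n) * z ^ n)
        + dpoly_coef l s n * z ^ n)%C; [intros n; cbn [dpoly_coef]; ring|].
    apply Cser_plus; [|exact IH].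
    eapply Cser_eq; [apply Cser_scal, Cexp_PS|].
    rewrite <- Cmult_assoc, <- Cexp_plus. do 2 f_equal. ring.
Qed.

(** The Taylor coefficient at the real point [c] with its sign (-1)^n removed. *)
Fixpoint dpoly_abs_coef (l : list (R * R)) (c : R) (n : nat) : R :=
  match l with nil => 0
  | (lam, mu) :: l' => lam * exp (- c * mu) * (mu ^ n / INR (fact n)) + dpoly_abs_coef l' c n end.

Lemma dpoly_coef_real l c n : Cmod (dpoly_coef l (RtoC c) n) = Rabs (dpoly_abs_coef l c n).
Proof.
  assert (E : dpoly_coef l (RtoC c) n = (RtoC ((-1) ^ n) * RtoC (dpoly_abs_coef l c n))%C).
  { induction l as [|[lam mu] l IH]; cbn [dpoly_coef dpoly_abs_coef]; [ring|]. rewrite IH.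
    replace (- c * mu)%C with (RtoC (- c * mu)) by (rewrite RtoC_mult, RtoC_opp; reflexivity).
    rewrite Cexp_RtoC, RtoC_plus, !RtoC_mult.
    replace (- mu)%C with (RtoC (-1) * RtoC mu)%C by ring.
    rewrite Cpow_mult_l, <- !RtoC_pow. rewrite RtoC_div by apply INR_fact_neq_0. unfold Cdiv. ring. }
  rewrite E, Cmod_mult, !Cmod_R, <- RPow_abs, Rabs_left by lra.
  replace (- -1) with 1 by ring. rewrite pow1. ring.
Qed.

Lemma dpoly_coef_le l c t n : dpoly_nonneg l -> Cmod (dpoly_coef l (c, t) n) <= dpoly_abs_coef l c n.
Proof.
  induction l as [|[lam mu] l IH]; intros H; cbn [dpoly_coef dpoly_abs_coef]; [rewrite Cmod_0; lra|].
  eapply Rle_trans; [apply Cmod_triangle|].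
  assert (X := IH (fun q Hq => H q (or_intror Hq))).
  destruct (H (lam, mu) (or_introl eq_refl)) as [H1 H2]. simpl in H1, H2.
  apply Rplus_le_compat; auto. right.
  rewrite !Cmod_mult, Cmod_div, Cmod_pow, Cmod_opp, !Cmod_R, Cmod_Cexp, Re_mult_real, Re_opp.
  - rewrite !Rabs_pos_eq; auto. apply pos_INR.
  - apply RtoC_neq0, INR_fact_neq_0.
Qed.

(** At a real point all summands share the sign (-1)^n, so the triangle inequality is an equality
    there; a vertical shift only rotates the summands. *)
Lemma dpoly_coef_mono l c t n : dpoly_nonneg l -> Cmod (dpoly_coef l (c, t) n) <= Cmod (dpoly_coef l (RtoC c) n).
Proof.
  intros H. rewrite dpoly_coef_real. eapply Rle_trans; [apply dpoly_coef_le; auto|]. apply Rle_abs.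
Qed.

(** The quotient of zeta by exp of the polynomial is within eps of 1, so the coefficients of its
    logarithm are O(eps) by [logser_exists]; uniqueness of logarithms identifies the rest. *)
Lemma zeta_log_near zeta s0 r a eps l n : is_riemann_zeta zeta -> 0 < r -> 0 < eps <= 1 / 4 ->
  (forall z, Cmod z < r -> 1 < Re (s0 + z)%C) ->
  (forall z, Cmod z < r -> Cmod (zeta (s0 + z)%C * Cexp (- dpoly l (s0 + z)%C) - 1)%C <= eps) ->
  logser (fun z => zeta (s0 + z)%C) r a -> (1 <= n)%nat ->
  Cmod (a n - dpoly_coef l s0 n)%C <= 16 * eps / (r / 2) ^ n.
Proof.
  intros Hzeta Hr He Hre Hl La Hn.
  set (G := fun z => (zeta (s0 + z) * Cexp (- dpoly l (s0 + z)))%C) in *.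
  assert (Gb : forall z, Cmod z < r -> Cmod (G z) <= 1 + eps /\ 1 - eps <= Cmod (G z)).
  { intros z Hz. specialize (Hl z Hz). split.
    - replace (G z) with ((G z - 1) + 1)%C by ring. eapply Rle_trans; [apply Cmod_triangle|].
      rewrite Cmod_1. unfold G. lra.
    - assert (X := Cmod_ge_minus 1 (1 - G z)%C). replace (1 - (1 - G z))%C with (G z) in X by ring.
      rewrite Cmod_1, Cmod_minus_sym in X. unfold G in *. lra. }
  assert (DPr : forall z, Cmod z < r -> PS (dpoly_coef l s0) z (dpoly l (s0 + z)%C)) by (intros; apply dpoly_PS).
  assert (HG : holo (fun z => Cmod z < r) G).
  { intros z Hz. destruct (zeta_holo zeta Hzeta (s0 + z)%C) as [m Hm].
    - intros E. specialize (Hre z Hz). rewrite E in Hre. simpl in Hre. lra.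
    - eexists. apply Cderiv_mult; [apply Cderiv_shift; exact Hm|].
      apply Cderiv_exp_comp. apply (Cderiv_ext (fun z => (-(1)) * dpoly l (s0 + z))%C); [intros; ring|].
      apply Cderiv_scal. apply (PS_disc_deriv (dpoly_coef l s0) r _ Hr DPr z Hz). }
  destruct (logser_exists G r (r / 2) (1 + eps)) as [g [Lg Bg]]; auto; [lra| | |].
  { intros z Hz E. destruct (Gb z Hz) as [_ X]. rewrite E, Cmod_0 in X. lra. }
  { intros z Hz. apply Gb; auto. }
  assert (C0 : Cmod 0 < r) by (rewrite Cmod_0; auto).
  assert (Le := logser_exp (dpoly_coef l s0) (fun z => dpoly l (s0 + z)%C) (r / 2)
    (fun z Hz => dpoly_PS l s0 z) ltac:(lra)).
  assert (Lm := logser_mult _ _ _ _ _ Lg Le).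
  assert (Lz : logser (fun z => zeta (s0 + z)%C) (r / 2)
     (fun n => g n + match n with O => 0 | S _ => dpoly_coef l s0 n end)%C).
  { eapply logser_ext; [lra| |exact Lm]. intros z Hz. unfold G. cbv beta.
    rewrite <- Cmult_assoc, <- Cexp_plus.
    replace (- dpoly l (s0 + z) + dpoly l (s0 + z))%C with (RtoC 0) by ring. rewrite Cexp_0. ring. }
  assert (Z0 : zeta (s0 + 0)%C <> 0).
  { intros E. destruct (Gb 0 C0) as [_ X]. unfold G in X. rewrite E, Cmult_0_l, Cmod_0 in X. lra. }
  assert (La2 : logser (fun z => zeta (s0 + z)%C) (r / 2) a) by (apply (logser_le _ r); auto; lra).
  rewrite (logser_unique (fun z => zeta (s0 + z)%C) (r / 2) a _ ltac:(lra) Z0 La2 Lz n).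
  destruct n as [|n]; [lia|].
  replace (g (S n) + dpoly_coef l s0 (S n) - dpoly_coef l s0 (S n))%C with (g (S n)) by ring.
  specialize (Bg (S n)). assert (Pn : 0 < (r / 2) ^ S n) by (apply pow_lt; lra).
  destruct (Gb 0 C0) as [_ X0].
  (* (1 + eps) / (1 - eps) <= 1 + 4 eps holds because eps <= 1/4; with the 4 of [logser_exists] this
     makes 16. *)
  assert (LL : ln ((1 + eps) / Cmod (G 0)) <= 4 * eps).
  { rewrite <- (ln_exp (4 * eps)). apply ln_le; [apply Rdiv_lt_0_compat; lra|].
    eapply Rle_trans; [|apply exp_ineq1_le]. apply Rmult_le_reg_r with (Cmod (G 0)); [lra|].
    unfold Rdiv. rewrite Rmult_assoc, Rinv_l by lra. nra. }
  set (X := (r / 2) ^ S n) in *. apply Rmult_le_reg_r with X; auto.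
  replace (16 * eps / X * X) with (16 * eps) by (field; lra). lra.
Qed.

(** For fixed n the error in [zeta_log_near] tends to 0 with eps, so the inequality for nonnegative
    Dirichlet polynomials passes to log zeta. *)
Theorem log_coef_positivity zeta c t r a b n : is_riemann_zeta zeta -> 0 < r < c - 1 ->
  logser (fun z => zeta ((c, t) + z)%C) r a -> logser (fun z => zeta (RtoC c + z)%C) r b ->
  (1 <= n)%nat -> Cmod (a n) <= Cmod (b n).
Proof.
  intros Hzeta Hr La Lb Hn. apply le_epsilon. intros e He.
  assert (Pn : 0 < (r / 2) ^ n) by (apply pow_lt; lra).
  set (eps := Rmin (1 / 4) (e / 32 * (r / 2) ^ n)).
  assert (He1 : 0 < eps <= 1 / 4).
  { split; [apply Rmin_pos; [lra|nra]|apply Rmin_l]. }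
  destruct (zeta_approx zeta (c - 1 - r) eps Hzeta ltac:(lra) (proj1 He1)) as [l [Hl H]].
  assert (Re1 : forall t z, Cmod z < r -> 1 + (c - 1 - r) <= Re ((c, t) + z)%C).
  { intros u z Hz. rewrite Re_plus. simpl. assert (X := re_le_Cmod z). apply Rabs_le_between in X. lra. }
  assert (Re0 : forall t z, Cmod z < r -> 1 < Re ((c, t) + z)%C)
    by (intros u z Hz; specialize (Re1 u z Hz); lra).
  assert (Xa := zeta_log_near zeta (c, t) r a eps l n Hzeta ltac:(lra) He1
    (Re0 t) (fun z Hz => H _ (Re1 t z Hz)) La Hn).
  assert (Xb := zeta_log_near zeta (RtoC c) r b eps l n Hzeta ltac:(lra) He1
    (Re0 0) (fun z Hz => H _ (Re1 0 z Hz)) Lb Hn).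
  assert (M := dpoly_coef_mono l c t n Hl).
  assert (E2 : 16 * eps / (r / 2) ^ n <= e / 2).
  { assert (X := Rmin_r (1 / 4) (e / 32 * (r / 2) ^ n)). fold eps in X.
    set (Y := (r / 2) ^ n) in *. apply Rmult_le_reg_r with Y; auto.
    replace (16 * eps / Y * Y) with (16 * eps) by (field; lra). lra. }
  assert (A1 : Cmod (a n) <= Cmod (a n - dpoly_coef l (c, t) n)%C + Cmod (dpoly_coef l (c, t) n)).
  { replace (a n) with ((a n - dpoly_coef l (c, t) n) + dpoly_coef l (c, t) n)%C at 1 by ring. apply Cmod_triangle. }
  assert (A2 : Cmod (dpoly_coef l (RtoC c) n) <= Cmod (b n - dpoly_coef l (RtoC c) n)%C + Cmod (b n)).
  { replace (dpoly_coef l (RtoC c) n) with (- (b n - dpoly_coef l (RtoC c) n) + b n)%C at 1 by ring.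
    eapply Rle_trans; [apply Cmod_triangle|]. rewrite Cmod_opp. lra. }
  lra.
Qed.

(** * Zero-free region *)

Lemma zeta_neq0_right zeta s : is_riemann_zeta zeta -> 1 < Re s -> zeta s <> 0.
Proof.
  intros Hzeta Hs E.
  destruct (zeta_approx zeta (Re s - 1) (1 / 2) Hzeta ltac:(lra) ltac:(lra)) as [l [_ H]].
  specialize (H s ltac:(lra)). rewrite E in H.
  replace (0 * Cexp (- dpoly l s) - 1)%C with (- (1))%C in H by ring. rewrite Cmod_opp, Cmod_1 in H. lra.
Qed.

(** Each pair contributes a nonnegative multiple of 3 + 4 cos x + cos 2x = 2 (1 + cos x)^2. *)
Lemma dpoly_341 l x t : dpoly_nonneg l -> 0 <= 3 * Re (dpoly l (x, 0)) + 4 * Re (dpoly l (x, t)) + Re (dpoly l (x, 2 * t)).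
Proof.
  induction l as [|[lam mu] l IH]; intros H; [simpl; lra|].
  assert (X := IH (fun q Hq => H q (or_intror Hq))).
  destruct (H (lam, mu) (or_introl eq_refl)) as [H1 H2]. unfold fst, snd in H1, H2.
  cbn [dpoly]. rewrite !Re_plus.
  assert (E : forall u, Re (lam * Cexp (- (x, u) * mu))%C = lam * exp (- x * mu) * cos (u * mu)).
  { intros u. rewrite Re_mult. unfold Cexp. rewrite Re_mult_real, Im_mult_real, Re_opp, Im_opp. simpl.
    replace (- u * mu) with (- (u * mu)) by ring. rewrite cos_neg. ring. }
  rewrite !E. replace (0 * mu) with 0 by ring. rewrite cos_0.
  replace (2 * t * mu) with (2 * (t * mu)) by ring. rewrite cos_2a_cos.
  set (k := lam * exp (- x * mu)). assert (Hk : 0 <= k) by (apply Rmult_le_pos; auto; left; apply exp_pos).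
  set (cc := cos (t * mu)).
  assert (0 <= k * (2 * (1 + cc) ^ 2)) by (apply Rmult_le_pos; auto; assert (Y := pow2_ge_0 (1 + cc)); lra).
  lra.
Qed.

Lemma zeta_341 zeta x t : is_riemann_zeta zeta -> 1 < x ->
  1 / 2 <= Cmod (zeta (x, 0)) ^ 3 * Cmod (zeta (x, t)) ^ 4 * Cmod (zeta (x, 2 * t)).
Proof.
  intros Hzeta Hx.
  destruct (zeta_approx zeta (x - 1) (1 / 16) Hzeta ltac:(lra) ltac:(lra)) as [l [Hl H]].
  assert (B : forall u, 15 / 16 * exp (Re (dpoly l (x, u))) <= Cmod (zeta (x, u))).
  { intros u. specialize (H (x, u) ltac:(simpl; lra)).
    assert (X := Cmod_ge_minus 1 (1 - zeta (x, u) * Cexp (- dpoly l (x, u)))%C).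
    replace (1 - (1 - zeta (x, u) * Cexp (- dpoly l (x, u))))%C with (zeta (x, u) * Cexp (- dpoly l (x, u)))%C in X by ring.
    rewrite Cmod_1, Cmod_minus_sym, Cmod_mult, Cmod_Cexp, Re_opp in X.
    assert (P := exp_pos (Re (dpoly l (x, u)))). rewrite exp_Ropp in X.
    assert (Y : 15 / 16 <= Cmod (zeta (x, u)) * / exp (Re (dpoly l (x, u)))) by lra.
    apply (Rmult_le_compat_r (exp (Re (dpoly l (x, u))))) in Y; [|lra].
    rewrite Rmult_assoc, Rinv_l in Y; lra. }
  assert (Q := dpoly_341 l x t Hl).
  set (p := Re (dpoly l (x, 0))) in *. set (q := Re (dpoly l (x, t))) in *. set (w := Re (dpoly l (x, 2 * t))) in *.
  assert (E1 : 1 <= exp p ^ 3 * exp q ^ 4 * exp w).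
  { replace (exp p ^ 3 * exp q ^ 4 * exp w) with (exp (3 * p + 4 * q + w)).
    - eapply Rle_trans; [|apply exp_ineq1_le]. lra.
    - rewrite !exp_plus. replace (3 * p) with (p + (p + p)) by ring.
      replace (4 * q) with ((q + q) + (q + q)) by ring. rewrite !exp_plus. ring. }
  apply Rle_trans with ((15 / 16 * exp p) ^ 3 * (15 / 16 * exp q) ^ 4 * (15 / 16 * exp w)).
  - rewrite !Rpow_mult_distr.
    replace ((15 / 16) ^ 3 * exp p ^ 3 * ((15 / 16) ^ 4 * exp q ^ 4) * (15 / 16 * exp w))
      with ((15 / 16) ^ 8 * (exp p ^ 3 * exp q ^ 4 * exp w)) by ring. lra.
  - assert (Pp := exp_pos p). assert (Pq := exp_pos q). assert (Pw := exp_pos w).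
    apply Rmult_le_compat; [|lra| |apply B].
    + apply Rmult_le_pos; apply pow_le; lra.
    + apply Rmult_le_compat; try (apply pow_le; lra); apply pow_incr; (split; [lra|apply B]).
Qed.

(** At 1 + d a simple pole cubed against a zero to the fourth power would leave O(d), contradicting
    the lower bound 1/2 of [zeta_341]. *)
Lemma zeta_neq0_line1 zeta t : is_riemann_zeta zeta -> t <> 0 -> zeta (1, t) <> 0.
Proof.
  intros Hzeta Ht E.
  assert (N1 : (1, t) <> RtoC 1) by (intros X; injection X; auto).
  assert (N2 : (1, 2 * t) <> RtoC 1) by (intros X; injection X; lra).
  destruct (zeta_holo zeta Hzeta _ N1) as [l1 D1]. destruct (zeta_holo zeta Hzeta _ N2) as [l2 D2].
  destruct (Cderiv_lip _ _ _ D1) as [d1 [Hd1 L1]].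
  destruct (Cderiv_cont _ _ _ D2 1 Rlt_0_1) as [d2 [Hd2 L2]].
  set (K := Cmod l1 + 1) in *. set (K2 := Cmod (zeta (1, 2 * t)) + 1).
  assert (HK : 0 < K) by (unfold K; assert (X := Cmod_ge_0 l1); lra).
  assert (HK2 : 0 < K2) by (unfold K2; assert (X := Cmod_ge_0 (zeta (1, 2 * t))); lra).
  set (B := 180 ^ 3 * K ^ 4 * K2).
  assert (HB : 0 < B).
  { unfold B. apply Rmult_lt_0_compat; auto. apply Rmult_lt_0_compat; apply pow_lt; lra. }
  set (d := Rmin (Rmin 1 (/ (4 * B))) (Rmin d1 d2) / 2).
  assert (Hm : 0 < Rmin (Rmin 1 (/ (4 * B))) (Rmin d1 d2)).
  { repeat apply Rmin_pos; auto; try lra. apply Rinv_0_lt_compat; lra. }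
  assert (A1 := Rmin_l (Rmin 1 (/ (4 * B))) (Rmin d1 d2)).
  assert (A2 := Rmin_r (Rmin 1 (/ (4 * B))) (Rmin d1 d2)).
  assert (A3 := Rmin_l 1 (/ (4 * B))). assert (A4 := Rmin_r 1 (/ (4 * B))).
  assert (A5 := Rmin_l d1 d2). assert (A6 := Rmin_r d1 d2).
  assert (Hd : 0 < d /\ d < 1 /\ d < / (4 * B) /\ d < d1 /\ d < d2) by (unfold d; lra).
  clear A1 A2 A3 A4 A5 A6 Hm. clearbody d. destruct Hd as (H0 & H1 & H2 & H3 & H4).
  (* 180 = 20 (1 + 2)^2, from [reg_zeta_bound] with |s| <= 2. *)
  assert (Z0 : Cmod (zeta (1 + d, 0)) <= 180 / d).
  { assert (Eq := reg_zeta_eq_right zeta (1 + d, 0) Hzeta ltac:(simpl; lra)).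
    apply (f_equal Cmod) in Eq. rewrite Cmod_mult in Eq.
    change (1 + d, 0) with (RtoC (1 + d)) in *.
    replace (RtoC (1 + d) - 1)%C with (RtoC d) in Eq by (rewrite RtoC_plus; ring).
    assert (Bd := reg_zeta_bound (RtoC (1 + d)) ltac:(simpl; lra)).
    rewrite !Cmod_R, !Rabs_pos_eq in * by lra.
    apply Rmult_le_reg_r with d; auto. unfold Rdiv. rewrite Rmult_assoc, Rinv_l by lra. nra. }
  assert (Z1 : Cmod (zeta (1 + d, t)) <= K * d).
  { specialize (L1 (1 + d, t)). rewrite Cmod_horiz in L1.
    replace (1 + d - 1) with d in L1 by ring. rewrite (Rabs_pos_eq d) in L1 by lra.
    specialize (L1 H3). rewrite E in L1.
    set (u := zeta (1 + d, t)) in *. replace (u - 0)%C with u in L1 by ring. auto. }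
  assert (Z2 : Cmod (zeta (1 + d, 2 * t)) <= K2).
  { specialize (L2 (1 + d, 2 * t)). rewrite Cmod_horiz in L2.
    replace (1 + d - 1) with d in L2 by ring. rewrite (Rabs_pos_eq d) in L2 by lra.
    specialize (L2 H4).
    set (u := zeta (1 + d, 2 * t)) in *. set (v := zeta (1, 2 * t)) in *.
    replace u with (v + (u - v))%C by ring.
    eapply Rle_trans; [apply Cmod_triangle|]. unfold K2; lra. }
  assert (Q := zeta_341 zeta (1 + d) t Hzeta ltac:(lra)).
  assert (U : Cmod (zeta (1 + d, 0)) ^ 3 * Cmod (zeta (1 + d, t)) ^ 4 * Cmod (zeta (1 + d, 2 * t))
     <= (180 / d) ^ 3 * (K * d) ^ 4 * K2).
  { apply Rmult_le_compat; auto using Cmod_ge_0.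
    - apply Rmult_le_pos; apply pow_le, Cmod_ge_0.
    - apply Rmult_le_compat; try (apply pow_le, Cmod_ge_0); apply pow_incr; split; auto using Cmod_ge_0. }
  replace ((180 / d) ^ 3 * (K * d) ^ 4 * K2) with (B * d) in U by (unfold B; field; lra).
  assert (B * d <= 1 / 4); [|lra].
  apply Rle_trans with (B * / (4 * B)); [apply Rmult_le_compat_l; lra|]. right. field. lra.
Qed.

Lemma zeta_neq0 zeta s : is_riemann_zeta zeta -> riemann_hypothesis zeta -> 1 / 2 < Re s -> s <> 1 ->
  zeta s <> 0.
Proof.
  intros Hzeta RH Hs N E.
  destruct (Rtotal_order (Re s) 1) as [L|[L|L]].
  - assert (X := RH s ltac:(lra) E). lra.
  - destruct s as [x y]. simpl in L. subst x. apply (zeta_neq0_line1 zeta y Hzeta); auto.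
    intros ->. apply N. reflexivity.
  - apply (zeta_neq0_right zeta s Hzeta); auto.
Qed.

Lemma zeta_real_center zeta c R1 : is_riemann_zeta zeta -> riemann_hypothesis zeta -> 4 <= c ->
  c - 1 < R1 < c - 1 / 2 ->
  exists b, logser (fun z => zeta (RtoC c + z)%C) (c - 1) b /\
    forall n, (1 <= n)%nat ->
      Cmod (b n) <= / INR n * / (c - 1) ^ n + 4 * ln (20 * (1 + 2 * c) ^ 2) / R1 ^ n.
Proof.
  intros Hzeta RH Hc HR1.
  assert (ReB : forall z, Cmod z < c - 1 / 2 -> 1 / 2 < Re (RtoC c + z)%C).
  { intros z Hz. rewrite Re_plus. simpl. assert (X := re_le_Cmod z). apply Rabs_le_between in X. lra. }
  set (M := 20 * (1 + 2 * c) ^ 2).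
  assert (H0 : 1 <= Cmod (reg_zeta (RtoC c + 0)%C)).
  { replace (RtoC c + 0)%C with (RtoC c) by ring.
    rewrite <- (reg_zeta_eq_right zeta) by (simpl; auto; lra).
    rewrite Cmod_mult. replace (RtoC c - 1)%C with (RtoC (c - 1)) by (rewrite RtoC_minus; reflexivity).
    rewrite Cmod_R, Rabs_pos_eq by lra.
    assert (X := zeta_near_1 zeta (RtoC c) Hzeta ltac:(simpl; lra)). simpl Re in X.
    assert (I : / (c - 1) <= / 3) by (apply Rinv_le_contravar; lra).
    assert (Y := Cmod_ge_minus 1 (1 - zeta (RtoC c))%C).
    replace (1 - (1 - zeta (RtoC c)))%C with (zeta (RtoC c)) in Y by ring.
    rewrite Cmod_1, Cmod_minus_sym in Y. nra. }
  destruct (logser_exists (fun z => reg_zeta (RtoC c + z)%C) (c - 1 / 2) R1 M) as [h [Lh Bh]].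
  - lra.
  - intros z Hz. destruct (reg_zeta_holo (RtoC c + z)%C) as [l Hl]; [specialize (ReB z Hz); lra|].
    exists l. apply Cderiv_shift; auto.
  - intros z Hz. specialize (ReB z Hz).
    destruct (classic ((RtoC c + z)%C = 1)) as [E|N].
    + rewrite E, reg_zeta_1. intros X. apply RtoC_inj in X. lra.
    + rewrite <- (reg_zeta_eq zeta) by (auto; lra). apply Cmult_neq_0; [apply zeta_neq0; auto|apply Cminus_neq0; auto].
  - intros z Hz. specialize (ReB z Hz). eapply Rle_trans; [apply reg_zeta_bound; lra|].
    unfold M. apply Rmult_le_compat_l; [lra|]. apply pow_incr.
    assert (X := Cmod_ge_0 (RtoC c + z)%C). split; [lra|].
    assert (Y := Cmod_triangle (RtoC c) z). rewrite Cmod_R, Rabs_pos_eq in Y by lra. lra.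
  (* The pole in coordinates centred at [c]: dividing by s - 1 contributes - log (1 - z/w), whose
     coefficients have modulus 1 / (n (c - 1)^n). *)
  - set (w := RtoC (- (c - 1))).
    assert (w0 : w <> 0) by (apply RtoC_neq0; lra).
    assert (Mw : Cmod w = c - 1) by (unfold w; rewrite Cmod_R, Rabs_Ropp, Rabs_pos_eq; lra).
    assert (LL := logser_linear w (c - 1) w0 ltac:(lra) ltac:(lra)).
    exists (fun n => h n + - PSint (fun n => - / w ^ S n) n)%C. split.
    + apply (logser_ext (fun z => / RtoC (c - 1) * (reg_zeta (RtoC c + z) * / (1 - z / w)))%C); [lra| |].
      * intros z Hz0.
        assert (N : (RtoC c + z)%C <> 1).
        { intros E. assert (X : z = w).
          { unfold w. rewrite RtoC_opp, RtoC_minus. replace z with ((RtoC c + z) - RtoC c)%C by ring. rewrite E. ring. }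
          rewrite X, Mw in Hz0. lra. }
        assert (P := ReB z ltac:(lra)).
        rewrite <- (reg_zeta_eq zeta) by (auto; lra).
        assert (N' := Cminus_neq0 _ _ N).
        assert (Nc : RtoC (c - 1) <> 0) by (apply RtoC_neq0; lra).
        assert (Ew : (1 - z / w)%C = ((RtoC c + z - 1) / RtoC (c - 1))%C).
        { unfold w in *. rewrite RtoC_opp. rewrite RtoC_minus in *. field. auto. }
        rewrite Ew. field. auto.
      * apply logser_scal. apply (logser_mult (fun z => reg_zeta (RtoC c + z)%C)).
        -- apply (logser_le _ R1); [lra|exact Lh].
        -- apply (logser_inv (fun z => 1 - z / w)%C); auto.
           intros E. replace (1 - 0 / w)%C with (RtoC 1) in E by (field; auto). apply RtoC_inj in E. lra.
    + intros n Hn. eapply Rle_trans; [apply Cmod_triangle|]. rewrite Cmod_opp.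
      rewrite Cmod_PSint_linear, Mw by auto. specialize (Bh n).
      assert (PR : 0 < R1 ^ n) by (apply pow_lt; lra).
      assert (LM : ln (M / Cmod (reg_zeta (RtoC c + 0)%C)) <= ln M).
      { assert (PM : 0 < M) by (unfold M; nra).
        apply ln_le; [apply Rdiv_lt_0_compat; lra|].
        rewrite <- (Rmult_1_r M) at 2. apply Rmult_le_compat_l; [lra|].
        rewrite <- Rinv_1. apply Rinv_le_contravar; lra. }
      assert (Cmod (h n) <= 4 * ln M / R1 ^ n); [|lra].
      apply Rmult_le_reg_r with (R1 ^ n); auto. unfold Rdiv at 1.
      rewrite Rmult_assoc, Rinv_l, Rmult_1_r by lra. lra.
Qed.

(** * The contribution of the zeros *)

(* In coordinates centred at [c + i t], [- (c - 3)] is the point [3 + i t] and [w] a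
   zero on the critical line. *)
Lemma blaschke_gain c w : 4 <= c -> Re w = - (c - 1 / 2) -> Cmod w <= c - 3 / 8 ->
  / 27 * / (1 + Im w ^ 2) <= 1 - Cmod (blaschke (c - 1 / 4) w (RtoC (- (c - 3)))) ^ 2.
Proof.
  intros Hc Hre Hw.
  assert (W2 : Cmod w ^ 2 = (c - 1 / 2) ^ 2 + Im w ^ 2).
  { rewrite Cmod2_alt, Hre. ring. }
  destruct w as [u y]. simpl in Hre. subst u. change (Im (- (c - 1 / 2), y)) with y in *.
  set (w := (- (c - 1 / 2), y)) in *. set (z := RtoC (- (c - 3))).
  set (r := c - 1 / 4).
  assert (Py : 0 <= y ^ 2) by apply pow2_ge_0.
  assert (Hw2 : Cmod w ^ 2 <= (c - 3 / 8) ^ 2) by (apply pow_incr; split; [apply Cmod_ge_0|auto]).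
  set (den := Cmod (r * r - Cconj w * z)%C ^ 2).
  assert (Eden : den = (r ^ 2 - (c - 1 / 2) * (c - 3)) ^ 2 + (c - 3) ^ 2 * y ^ 2).
  { unfold den. rewrite Cmod2_alt. unfold w, z. simpl. ring. }
  assert (Enum : Cmod (r * (z - w))%C ^ 2 = r ^ 2 * ((c - 1 / 2 - (c - 3)) ^ 2 + y ^ 2)).
  { rewrite Cmod2_alt. unfold w, z. simpl. ring. }
  assert (Dn : (r * r - Cconj w * z)%C <> 0).
  { apply blaschke_denom; unfold r; [lra|]. unfold z. rewrite Cmod_R, Rabs_Ropp, Rabs_pos_eq; lra. }
  assert (Pden : 0 < den) by (unfold den; apply pow_lt, Cmod_gt_0; auto).
  assert (EB : Cmod (blaschke r w z) ^ 2 = Cmod (r * (z - w))%C ^ 2 / den).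
  { unfold blaschke. rewrite Cmod_div by auto. unfold Rdiv. rewrite Rpow_mult_distr, pow_inv. reflexivity. }
  rewrite EB, Enum.
  (* The identity |r^2 - conj w z|^2 - r^2 |z - w|^2 = (r^2 - |z|^2) (r^2 - |w|^2). *)
  assert (Diff : den - r ^ 2 * ((c - 1 / 2 - (c - 3)) ^ 2 + y ^ 2)
     = (r ^ 2 - (c - 3) ^ 2) * (r ^ 2 - (c - 1 / 2) ^ 2 - y ^ 2)) by (rewrite Eden; ring).
  assert (D1 : 11 / 4 * c <= r ^ 2 - (c - 3) ^ 2) by (unfold r; nra).
  (* The gap 1/8 between the radii c - 1/4 and c - 3/8 makes both factors of order c. The quotient
     of the resulting 11/32 c^2 by 9 c^2 (1 + y^2) exceeds 1 / (27 (1 + y^2)). *)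
  assert (D2 : c / 8 <= r ^ 2 - (c - 1 / 2) ^ 2 - y ^ 2) by (unfold r; nra).
  assert (D3 : 11 / 32 * c ^ 2 <= den - r ^ 2 * ((c - 1 / 2 - (c - 3)) ^ 2 + y ^ 2)).
  { rewrite Diff. replace (11 / 32 * c ^ 2) with (11 / 4 * c * (c / 8)) by field.
    apply Rmult_le_compat; lra. }
  assert (D4 : den <= 9 * c ^ 2 * (1 + y ^ 2)).
  { rewrite Eden.
    assert (A1 : 0 <= r ^ 2 - (c - 1 / 2) * (c - 3) <= 3 * c) by (unfold r; split; nra).
    assert (A2 : (r ^ 2 - (c - 1 / 2) * (c - 3)) ^ 2 <= (3 * c) ^ 2) by (apply pow_incr; auto).
    assert (A3 : (c - 3) ^ 2 <= c ^ 2) by (apply pow_incr; lra).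
    nra. }
  replace (1 - r ^ 2 * ((c - 1 / 2 - (c - 3)) ^ 2 + y ^ 2) / den)
    with ((den - r ^ 2 * ((c - 1 / 2 - (c - 3)) ^ 2 + y ^ 2)) / den) by (field; lra).
  apply Rmult_le_reg_r with den; auto. unfold Rdiv. rewrite (Rmult_assoc _ (/ den)), Rinv_l, Rmult_1_r by lra.
  eapply Rle_trans; [|exact D3].
  apply Rle_trans with (/ 27 * / (1 + y ^ 2) * (9 * c ^ 2 * (1 + y ^ 2))).
  - apply Rmult_le_compat_l; auto. left. apply Rmult_lt_0_compat; [lra|apply Rinv_0_lt_compat; lra].
  - replace (/ 27 * / (1 + y ^ 2) * (9 * c ^ 2 * (1 + y ^ 2))) with (c ^ 2 / 3) by (field; lra). nra.
Qed.

Lemma blaschke_prod_exp r l z : Cmod (blaschke_prod r l z) ^ 2 <= exp (- lsum (fun w => 1 - Cmod (blaschke r w z) ^ 2) l).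
Proof.
  induction l as [|w l IH]; cbn [blaschke_prod lsum].
  - rewrite Cmod_1, Ropp_0, exp_0. lra.
  - rewrite Cmod_mult, Rpow_mult_distr, Ropp_plus_distr, exp_plus.
    apply Rmult_le_compat; try apply pow2_ge_0; auto.
    assert (X := exp_ineq1_le (- (1 - Cmod (blaschke r w z) ^ 2))). lra.
Qed.

(** Here [v] is the distance from the centre to a zero at height [y]. By Bernoulli, v^(2m) = R^(2m)
    (1 + y^2/R^2)^m >= R^(2m) (1 + m y^2/R^2), and m >= R^2 turns the last factor into at least 1 +
    y^2. *)
Lemma inv_pow_le R y n m : 0 < R -> R ^ 2 <= INR m -> (2 * m <= n)%nat ->
  forall v, 0 < v -> v ^ 2 = R ^ 2 + y ^ 2 -> / v ^ n <= / R ^ n * / (1 + y ^ 2).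
Proof.
  intros HR Hm Hn v Hv Ev.
  assert (Py := pow2_ge_0 y).
  assert (PR : 0 < R ^ n) by (apply pow_lt; auto). assert (Pv : 0 < v ^ n) by (apply pow_lt; auto).
  rewrite <- Rinv_mult. apply Rinv_le_contravar; [apply Rmult_lt_0_compat; lra|].
  assert (HvR : R <= v) by nra.
  replace n with (2 * m + (n - 2 * m))%nat by lia. rewrite !pow_add, !pow_mult, Ev.
  assert (P2 : 0 < R ^ 2) by nra.
  replace (R ^ 2 + y ^ 2) with (R ^ 2 * (1 + y ^ 2 / R ^ 2)) by (field; lra).
  rewrite Rpow_mult_distr.
  assert (U : 0 <= y ^ 2 / R ^ 2) by (apply Rdiv_le_0_compat; auto).
  assert (Bern : 1 + INR m * (y ^ 2 / R ^ 2) <= (1 + y ^ 2 / R ^ 2) ^ m).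
  { destruct U as [U|U]; [apply poly; auto|]. rewrite <- U, Rmult_0_r, !Rplus_0_r, pow1. lra. }
  assert (Y : y ^ 2 <= INR m * (y ^ 2 / R ^ 2)).
  { replace (y ^ 2) with (R ^ 2 * (y ^ 2 / R ^ 2)) at 1 by (field; lra). apply Rmult_le_compat_r; auto. }
  assert (P3 : 0 < (R ^ 2) ^ m) by (apply pow_lt; auto).
  assert (P4 : R ^ (n - 2 * m) <= v ^ (n - 2 * m)) by (apply pow_incr; lra).
  assert (P5 : 0 < R ^ (n - 2 * m)) by (apply pow_lt; auto).
  replace ((R ^ 2) ^ m * R ^ (n - 2 * m) * (1 + y ^ 2)) with ((R ^ 2) ^ m * (1 + y ^ 2) * R ^ (n - 2 * m)) by ring.
  apply Rmult_le_compat; try lra.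
  - apply Rmult_le_pos; lra.
  - apply Rmult_le_compat_l; lra.
Qed.

(** * Taylor coefficients of the logarithm of zeta *)

Theorem zeta_log_coefs zeta del c : is_riemann_zeta zeta -> riemann_hypothesis zeta ->
  0 < del <= 1 / 2 -> 4 <= c ->
  exists a, logser (fun z => zeta ((c, exp (exp c)) + z)%C) (c - 1 / 2) a /\
    (forall n, (1 <= n)%nat -> Cmod (a n) <=
       / INR n * / (c - 1) ^ n + 4 * ln (20 * (1 + 2 * c) ^ 2) / (c - 1 / 2 - del / 2) ^ n) /\
    (forall n, 2 * c ^ 2 + 1 <= INR n -> Cmod (a n) <=
       432 * exp c / INR n * / (c - 1 / 2) ^ n + 16 * exp c / (c - 7 / 16) ^ n).
Proof.
  intros Hzeta RH Hdel Hc.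
  set (L := exp c). set (t := exp L).
  assert (HL1 : c + 1 <= L) by (unfold L; assert (X := exp_ineq1_le c); lra).
  assert (HL : 16 <= L).
  { unfold L. replace c with (c / 4 + c / 4 + (c / 4 + c / 4)) by field. rewrite !exp_plus.
    assert (X := exp_ineq1_le (c / 4)). assert (Y : 2 * 2 <= exp (c / 4) * exp (c / 4)) by (apply Rmult_le_compat; lra).
    apply Rle_trans with ((2 * 2) * (2 * 2)); [lra|]. apply Rmult_le_compat; lra. }
  assert (Ht1 : L + 1 <= t) by (unfold t; assert (X := exp_ineq1_le L); lra).
  assert (Ht : 625 <= t).
  { unfold t. replace L with (L / 4 + L / 4 + (L / 4 + L / 4)) by field. rewrite !exp_plus.
    assert (X := exp_ineq1_le (L / 4)). assert (Y : 5 * 5 <= exp (L / 4) * exp (L / 4)) by (apply Rmult_le_compat; lra).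
    apply Rle_trans with ((5 * 5) * (5 * 5)); [lra|]. apply Rmult_le_compat; lra. }
  assert (lnt : ln t = L) by (unfold t; apply ln_exp).
  set (F := fun z => zeta ((c, t) + z)%C).
  assert (ReB : forall z x, Cmod z <= x -> c - x <= Re ((c, t) + z)%C).
  { intros z x Hz. rewrite Re_plus. change (Re (c, t)) with c. assert (X := re_le_Cmod z).
    apply Rabs_le_between in X. lra. }
  assert (ImB : forall z, Cmod z <= c -> 1 <= Im ((c, t) + z)%C).
  { intros z Hz. rewrite Im_plus. change (Im (c, t)) with t. assert (X := im_le_Cmod z).
    apply Rabs_le_between in X. lra. }
  assert (N1 : forall z, Cmod z <= c -> ((c, t) + z)%C <> 1).
  { intros z Hz E. specialize (ImB z Hz). rewrite E in ImB. simpl in ImB. lra. }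
  assert (HF : holo (fun z => Cmod z < c - 1 / 8) F).
  { intros z Hz. destruct (zeta_holo zeta Hzeta ((c, t) + z)%C) as [l Hl]; [apply N1; lra|].
    exists l. apply Cderiv_shift; auto. }
  assert (HM : forall z, Cmod z <= c - 1 / 4 -> Cmod (F z) <= t ^ 3).
  { intros z Hz. eapply Rle_trans; [apply (zeta_growth zeta ((c, t) + z)%C Hzeta)|].
    - specialize (ReB z _ Hz). lra.
    - apply ImB; lra.
    - assert (X : Cmod ((c, t) + z)%C <= 3 * t).
      { eapply Rle_trans; [apply Cmod_triangle|].
        assert (Y := Cmod_le_ReIm (c, t)). simpl in Y. rewrite !Rabs_pos_eq in Y by lra. lra. }
      assert (P := Cmod_ge_0 ((c, t) + z)%C).
      apply Rle_trans with (20 * (1 + 3 * t) ^ 2); [|nra].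
      apply Rmult_le_compat_l; [lra|]. apply pow_incr; lra. }
  assert (Half : forall s, 3 <= Re s -> 1 / 2 <= Cmod (zeta s)).
  { intros s Hs. assert (X := zeta_near_1 zeta s Hzeta ltac:(lra)).
    assert (Y := Cmod_ge_minus 1 (1 - zeta s)%C).
    replace (1 - (1 - zeta s))%C with (zeta s) in Y by ring.
    rewrite Cmod_1, Cmod_minus_sym in Y.
    assert (/ (Re s - 1) <= / 2) by (apply Rinv_le_contravar; lra). lra. }
  assert (F0 : 1 / 2 <= Cmod (F 0)).
  { unfold F. apply Half. rewrite Re_plus. simpl. lra. }
  (* The disc of radius c - 3/8 stays in Re s >= 3/8, so every zero found in it lies on the critical
     line. *)
  assert (Zline : forall w, Cmod w <= c - 3 / 8 -> F w = 0 -> Re w = - (c - 1 / 2)).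
  { intros w Hw E. unfold F in E. assert (P := ReB w _ Hw).
    assert (Q : Re ((c, t) + w)%C <= 1 / 2).
    { apply Rnot_lt_le. intros X. apply (zeta_neq0 zeta ((c, t) + w)%C); auto. apply N1; lra. }
    assert (X := RH ((c, t) + w)%C ltac:(lra) E). rewrite Re_plus in X. simpl in X. lra. }
  assert (Zmod : forall w, Cmod w <= c - 3 / 8 -> F w = 0 ->
     Cmod w ^ 2 = (c - 1 / 2) ^ 2 + Im w ^ 2).
  { intros w Hw E. rewrite Cmod2_alt, (Zline w Hw E). ring. }
  assert (Zge : forall w, Cmod w <= c - 3 / 8 -> F w = 0 -> c - 1 / 2 <= Cmod w).
  { intros w Hw E. assert (X := Zmod w Hw E). assert (Y := pow2_ge_0 (Im w)). assert (P := Cmod_ge_0 w). nra. }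
  (* The critical line is at distance c - 1/2. The radii exceed this by fixed amounts 1/16, 1/8,
     1/4, 3/8, so the cofactor expands past the zeros while Re s stays positive. *)
  destruct (log_coef_zeros F (c - 1 / 8) (c - 1 / 4) (c - 3 / 8) (c - 7 / 16) (c - 1 / 2) (t ^ 3))
    as (l & a & Hl & La & Ba & Bl1); auto; try lra.
  { apply Cmod_neq0. lra. }
  exists a. split; [exact La|]. split.
  - destruct (zeta_real_center zeta c (c - 1 / 2 - del / 2) Hzeta RH Hc ltac:(lra)) as [b [Lb Bb]].
    intros n Hn. eapply Rle_trans; [|apply (Bb n Hn)].
    apply (log_coef_positivity zeta c t ((c - 1) / 2) a b n Hzeta); auto; [lra| |].
    + apply (logser_le _ (c - 1 / 2)); auto. lra.
    + apply (logser_le _ (c - 1)); auto. lra.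
  - set (Z := lsum (fun w => / (1 + Im w ^ 2)) l).
    assert (PM : 0 < t ^ 3) by (apply pow_lt; lra).
    (* A form of Jensen's inequality at 3 + i t, where |zeta| >= 1/2: since |F| <= t^3 |B| for the
       Blaschke product B, the sum S of the gains satisfies exp S <= 4 t^6 <= t^8. Each gain is at
       least 1 / (27 (1 + y^2)), and 216 = 27 times 8. *)
    assert (HZ : Z <= 216 * L).
    { set (z := RtoC (- (c - 3))).
      assert (Mz : Cmod z = c - 3) by (unfold z; rewrite Cmod_R, Rabs_Ropp, Rabs_pos_eq; lra).
      assert (Fz : 1 / 2 <= Cmod (F z)).
      { unfold F. apply Half. rewrite Re_plus. unfold z. simpl. lra. }
      assert (Bz := Bl1 z ltac:(lra)).
      assert (E := blaschke_prod_exp (c - 1 / 4) l z).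
      set (S := lsum (fun w => 1 - Cmod (blaschke (c - 1 / 4) w z) ^ 2) l) in *.
      assert (PB := Cmod_ge_0 (blaschke_prod (c - 1 / 4) l z)).
      assert (Q : exp S <= 4 * (t ^ 3) ^ 2).
      { assert (Q1 : (1 / 2) ^ 2 <= (t ^ 3 * Cmod (blaschke_prod (c - 1 / 4) l z)) ^ 2) by (apply pow_incr; lra).
        rewrite Rpow_mult_distr in Q1. rewrite exp_Ropp in E. assert (PS := exp_pos S).
        assert (Q2 : (1 / 2) ^ 2 <= (t ^ 3) ^ 2 * / exp S).
        { eapply Rle_trans; [exact Q1|]. apply Rmult_le_compat_l; [apply pow2_ge_0|auto]. }
        apply (Rmult_le_compat_r (exp S)) in Q2; [|lra].
        rewrite Rmult_assoc, Rinv_l in Q2 by lra. lra. }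
      assert (Q3 : S <= 8 * L).
      { rewrite <- (ln_exp S), <- lnt. replace 8 with (INR 8) by (simpl; ring).
        rewrite <- ln_pow by lra. apply ln_le; [apply exp_pos|].
        eapply Rle_trans; [exact Q|]. replace (t ^ 8) with (t ^ 2 * (t ^ 3) ^ 2) by ring.
        apply Rmult_le_compat_r; [apply pow2_ge_0|]. nra. }
      assert (Q4 : / 27 * Z <= S).
      { unfold Z, S. rewrite <- lsum_scal. apply lsum_le. intros w Hw. destruct (Hl w Hw) as [W1 W2].
        apply blaschke_gain; auto. }
      lra. }
    intros n Hn.
    assert (Hn1 : (1 <= n)%nat).
    { destruct n; [simpl in Hn; nra|lia]. }
    eapply Rle_trans; [apply (Ba n Hn1)|].
    assert (Pn : 0 < INR n) by (apply lt_0_INR; lia).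
    apply Rplus_le_compat.
    + assert (S1 : lsum (fun w => / Cmod w ^ n) l <= / (c - 1 / 2) ^ n * Z).
      { unfold Z. rewrite <- lsum_scal. apply lsum_le. intros w Hw. destruct (Hl w Hw) as [W1 W2].
        (* m is half of n rounded down; the extra 1 in [2 * c ^ 2 + 1] secures m >= c^2 for odd n
           too. *)
        destruct (Nat.Even_or_Odd n) as [[m Em]|[m Em]];
        (apply (inv_pow_le (c - 1 / 2) (Im w) n m); [lra| |lia| |apply Zmod; auto];
         [|assert (X := Zge w W1 W2); lra]);
        rewrite Em in Hn; rewrite ?plus_INR, mult_INR in Hn; simpl in Hn; nra. }
      assert (PR : 0 < / (c - 1 / 2) ^ n) by (apply Rinv_0_lt_compat, pow_lt; lra).
      apply Rle_trans with (2 / INR n * (/ (c - 1 / 2) ^ n * (216 * L))).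
      * apply Rmult_le_compat_l; [apply Rdiv_le_0_compat; lra|].
        eapply Rle_trans; [exact S1|]. apply Rmult_le_compat_l; lra.
      * right. unfold Rdiv. ring.
    + apply Rmult_le_compat_r; [left; apply Rinv_0_lt_compat, pow_lt; lra|].
      assert (LN : ln (t ^ 3 / Cmod (F 0)) <= 4 * L); [|lra].
      rewrite <- lnt. replace 4 with (INR 4) by (simpl; ring). rewrite <- ln_pow by lra.
      apply ln_le; [apply Rdiv_lt_0_compat; lra|].
      apply Rmult_le_reg_r with (Cmod (F 0)); [lra|]. unfold Rdiv. rewrite Rmult_assoc, Rinv_l, Rmult_1_r by lra.
      replace (t ^ 4) with (t ^ 3 * t) by ring. rewrite Rmult_assoc.
      rewrite <- (Rmult_1_r (t ^ 3)) at 1. apply Rmult_le_compat_l; nra.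
Qed.

(** * Summation *)

Lemma pow_exp_le x y n : 0 <= x <= exp y -> x ^ n <= exp (INR n * y).
Proof.
  intros H. apply Rle_trans with (exp y ^ n); [apply pow_incr; auto|].
  right. clear H. induction n as [|n IH]; [simpl; rewrite Rmult_0_l, exp_0; auto|].
  rewrite S_INR, <- tech_pow_Rmult, IH, <- exp_plus. f_equal. ring.
Qed.

Lemma rsum_split f N m : (forall n, 0 <= f n) -> rsum f m <= rsum f N + rsum (fun k => f (N + k)%nat) m.
Proof.
  intros H. rewrite <- rsum_add. apply rsum_mono; auto. lia.
Qed.

Lemma exp_cubic x : 0 <= x -> x ^ 3 <= 27 * exp x.
Proof.
  intros H. replace x with (x / 3 + (x / 3 + x / 3)) at 2 by field. rewrite !exp_plus.
  assert (X := exp_ineq1_le (x / 3)). set (e := exp (x / 3)) in *.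
  replace (x ^ 3) with (27 * ((x / 3) * ((x / 3) * (x / 3)))) by field.
  apply Rmult_le_compat_l; [lra|].
  assert (Y : x / 3 * (x / 3) <= e * e) by (apply Rmult_le_compat; lra).
  apply Rmult_le_compat; try lra. nra.
Qed.

Lemma exp_half_le : exp (1 / 2) <= 2.
Proof.
  assert (X := exp_ineq1_le (- (1 / 2))). rewrite exp_Ropp in X.
  assert (P := exp_pos (1 / 2)). apply (Rmult_le_compat_r (exp (1 / 2))) in X; [|lra].
  rewrite Rinv_l in X; lra.
Qed.

(* The cut-off [N ~ 2 c^2] balances the bound from the Euler product, effective
   for small [n], against the one from the zeros; [exp (- (2 sg - 1) c)] is then
   the common size of [L^-1 ((c - sg) / (c - 1))^N] and [((c - sg) / (c - 1 / 2))^N]. *)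
Lemma log_series_bound (u : nat -> R) c sg del nu : 4 <= c -> 0 < del <= 1 / 2 -> 0 < nu ->
  1 / 2 + del <= sg -> sg <= 1 - nu -> u O = 0 -> (forall n, 0 <= u n) ->
  (forall n, (1 <= n)%nat -> u n <=
     / INR n * / (c - 1) ^ n + 4 * ln (20 * (1 + 2 * c) ^ 2) / (c - 1 / 2 - del / 2) ^ n) ->
  (forall n, 2 * c ^ 2 + 1 <= INR n -> u n <=
     432 * exp c / INR n * / (c - 1 / 2) ^ n + 16 * exp c / (c - 7 / 16) ^ n) ->
  forall m, rsum (fun n => u n * (c - sg) ^ n) m <=
    (16 / nu + 270 / nu ^ 3 + 2160 / (del * nu ^ 3) + 216 / del + 884736) * (exp ((2 - 2 * sg) * c) / c).
Proof.
  intros Hc Hdel Hnu Hsg Hsg2 U0 Upos H1 H2 m.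
  set (r := c - sg). assert (Hr : c - 1 < r < c - 1 / 2) by (unfold r; lra).
  set (X := exp ((2 - 2 * sg) * c)). assert (PX : 0 < X) by apply exp_pos.
  (* [E] is the square root of [X]. Any term O(c^2 E) is acceptable, since c^3 is O(E); this is
     where sg <= 1 - nu enters. *)
  set (E := exp ((1 - sg) * c)). assert (PE : 0 < E) by apply exp_pos.
  assert (EX : E <= X) by (apply exp_le; nra).
  assert (C3 : c ^ 3 <= 27 / nu ^ 3 * E).
  { assert (Y := exp_cubic (nu * c) ltac:(nra)).
    assert (Y2 : exp (nu * c) <= E) by (apply exp_le; nra).
    assert (P3 : 0 < nu ^ 3) by (apply pow_lt; auto).
    apply Rmult_le_reg_l with (nu ^ 3); auto.
    replace (nu ^ 3 * (27 / nu ^ 3 * E)) with (27 * E) by (field; lra).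
    replace (nu ^ 3 * c ^ 3) with ((nu * c) ^ 3) by ring. lra. }
  assert (P3 : 0 < nu ^ 3) by (apply pow_lt; auto).
  assert (C2 : c ^ 2 <= 27 / nu ^ 3 * (E / c)).
  { apply Rmult_le_reg_r with c; [lra|].
    replace (27 / nu ^ 3 * (E / c) * c) with (27 / nu ^ 3 * E) by (field; lra).
    replace (c ^ 2 * c) with (c ^ 3) by ring. auto. }
  assert (EXc : E / c <= X / c).
  { apply Rmult_le_compat_r; auto. left; apply Rinv_0_lt_compat; lra. }
  destruct (nfloor1_ex (2 * c ^ 2) ltac:(nra)) as [N0 HN0].
  (* The second bound starts at 2 c^2 + 1, so it is available from the index N + 1 on; the first S N
     terms, index N included, use the first bound. *)
  set (N := S N0). assert (HN : 2 * c ^ 2 <= INR N <= 2 * c ^ 2 + 1) by (unfold N; rewrite S_INR; lra).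
  assert (PN : 0 < INR N) by nra.
  set (q := r / (c - 1)).
  assert (Eq : q - 1 = (1 - sg) / (c - 1)) by (unfold q, r; field; lra).
  assert (Hq1 : 0 < q - 1) by (rewrite Eq; apply Rdiv_lt_0_compat; lra).
  assert (Hqe : q <= exp ((1 - sg) / (c - 1))).
  { assert (Y := exp_ineq1_le ((1 - sg) / (c - 1))). lra. }
  assert (qpow : forall n k, INR n <= k * (c - 1) -> q ^ n <= exp ((1 - sg) * k)).
  { intros n k Hk. eapply Rle_trans; [apply (pow_exp_le q ((1 - sg) / (c - 1))); lra|].
    apply exp_le. apply Rmult_le_reg_r with (c - 1); [lra|].
    replace (INR n * ((1 - sg) / (c - 1)) * (c - 1)) with ((1 - sg) * INR n) by (field; lra). nra. }
  (* Below N/2 the factor 1 / n is given up: q^n is only O(E) there, and O(c^2) such terms are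
     affordable. From N/2 on, 1 / n <= 2 / N is kept. *)
  set (Q := 2 * 2 * E).
  assert (Xlow : forall n, (2 * n < N)%nat -> q ^ n <= Q).
  { intros n Hn. assert (I : 2 * INR n <= 2 * c ^ 2 + 1).
    { apply Rle_trans with (INR N); [|lra]. replace (2 * INR n) with (INR (2 * n)) by (rewrite mult_INR; simpl; ring).
      apply le_INR. lia. }
    eapply Rle_trans; [apply (qpow n (c + 2)); nra|].
    unfold Q, E. replace ((1 - sg) * (c + 2)) with ((1 - sg) + (1 - sg) + (1 - sg) * c) by ring.
    rewrite !exp_plus. assert (Y : exp (1 - sg) <= 2) by (eapply Rle_trans; [apply exp_le|apply exp_half_le]; lra).
    assert (P := exp_pos (1 - sg)). apply Rmult_le_compat_r; [left; apply exp_pos|]. nra. }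
  assert (Xtop : q ^ S N <= 16 * X).
  { eapply Rle_trans; [apply (qpow (S N) (2 * c + 4)); rewrite S_INR; nra|].
    (* Rounding in N and the replacement of c by c - 1 cost the 4 in 2 c + 4, hence a factor exp (1
       - sg)^4 <= 16. *)
    unfold X. replace ((1 - sg) * (2 * c + 4)) with (((1 - sg) + (1 - sg)) + ((1 - sg) + (1 - sg)) + (2 - 2 * sg) * c) by ring.
    rewrite !exp_plus. assert (Y : exp (1 - sg) <= 2) by (eapply Rle_trans; [apply exp_le|apply exp_half_le]; lra).
    assert (P := exp_pos (1 - sg)). apply Rmult_le_compat_r; [left; apply exp_pos|].
    assert (Y2 : exp (1 - sg) * exp (1 - sg) <= 2 * 2) by (apply Rmult_le_compat; lra).
    replace 16 with ((2 * 2) * (2 * 2)) by ring. apply Rmult_le_compat; nra. }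
  set (A := 4 * ln (20 * (1 + 2 * c) ^ 2)) in *.
  assert (HA : 0 <= A <= 40 * c).
  { unfold A. rewrite ln_mult, ln_pow by (try apply pow_lt; lra). simpl (INR 2).
    assert (L1 : ln 20 <= 19).
    { rewrite <- (ln_exp 19). apply ln_le; [lra|]. assert (Y := exp_ineq1_le 19). lra. }
    assert (L2 : ln (1 + 2 * c) <= 2 * c).
    { apply Rle_trans with (ln (exp (2 * c))); [|rewrite ln_exp; lra].
      apply ln_le; [lra|]. apply exp_ineq1_le. }
    assert (L3 : 0 <= ln 20) by (rewrite <- ln_1; apply ln_le; lra).
    assert (L4 : 0 <= ln (1 + 2 * c)) by (rewrite <- ln_1; apply ln_le; lra).
    lra. }
  set (R4 := c - 1 / 2 - del / 2) in *.
  set (th1 := r / R4). set (th2 := r / (c - 1 / 2)). set (th3 := r / (c - 7 / 16)).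
  assert (HR4 : r < R4) by (unfold r, R4; lra).
  assert (frac : forall R, r < R -> R <= c -> 0 <= r / R < 1 /\ (R - r) / c <= 1 - r / R).
  { intros R HR1 HR2. split; [split|].
    - apply Rdiv_le_0_compat; lra.
    - apply Rmult_lt_reg_r with R; [lra|]. unfold Rdiv. rewrite Rmult_assoc, Rinv_l; lra.
    - replace (1 - r / R) with ((R - r) / R) by (field; lra).
      apply Rmult_le_compat_l; [lra|]. apply Rinv_le_contravar; lra. }
  destruct (frac R4 HR4 ltac:(unfold R4; lra)) as [T1a T1b]. fold th1 in T1a, T1b.
  destruct (frac (c - 1 / 2) ltac:(lra) ltac:(lra)) as [T2a T2b]. fold th2 in T2a, T2b.
  destruct (frac (c - 7 / 16) ltac:(lra) ltac:(lra)) as [T3a T3b]. fold th3 in T3a, T3b.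
  assert (rpow : forall R n, 0 < R -> / R ^ n * r ^ n = (r / R) ^ n).
  { intros R n HR. unfold Rdiv. rewrite Rpow_mult_distr, pow_inv. ring. }
  assert (Pr : forall n, 0 < r ^ n) by (intros; apply pow_lt; lra).
  assert (Low : rsum (fun n => u n * r ^ n) (S N) <= 2 / INR N * (q ^ S N / (q - 1)) + INR (S N) * Q + A * / (1 - th1)).
  { apply Rle_trans with (rsum (fun n => (2 / INR N * q ^ n + Q) + A * th1 ^ n) (S N)).
    - apply rsum_le. intros n Hn.
      assert (B1 : 0 <= 2 / INR N * q ^ n) by (apply Rmult_le_pos; [apply Rdiv_le_0_compat; lra|apply pow_le; lra]).
      assert (B2 : 0 <= A * th1 ^ n) by (apply Rmult_le_pos; [lra|apply pow_le; lra]).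
      assert (B3 : 0 < Q) by (unfold Q; lra).
      destruct n as [|n0]; [rewrite U0; lra|]. set (n := S n0) in *.
      assert (Pn : 1 <= INR n) by (apply (le_INR 1); unfold n; lia).
      specialize (H1 n ltac:(unfold n; lia)).
      apply Rle_trans with ((/ INR n * / (c - 1) ^ n + A / R4 ^ n) * r ^ n).
      { apply Rmult_le_compat_r; auto. left; auto. }
      replace ((/ INR n * / (c - 1) ^ n + A / R4 ^ n) * r ^ n)
        with (/ INR n * (/ (c - 1) ^ n * r ^ n) + A * (/ R4 ^ n * r ^ n)) by (unfold Rdiv; ring).
      rewrite !rpow by lra. fold q th1. apply Rplus_le_compat_r.
      assert (Pq : 0 < q ^ n) by (apply pow_lt; lra).
      destruct (Nat.lt_ge_cases (2 * n) N) as [C|C].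
      + specialize (Xlow n C). assert (/ INR n <= 1) by (rewrite <- Rinv_1; apply Rinv_le_contravar; lra). nra.
      + assert (I : INR N <= 2 * INR n).
        { replace (2 * INR n) with (INR (2 * n)) by (rewrite mult_INR; simpl; ring). apply le_INR; auto. }
        assert (/ INR n <= 2 / INR N).
        { replace (2 / INR N) with (/ (INR N / 2)) by (field; lra). apply Rinv_le_contravar; lra. }
        nra.
    - rewrite !rsum_plus, !rsum_scal, rsum_const. apply Rplus_le_compat.
      + apply Rplus_le_compat_r. apply Rmult_le_compat_l; [apply Rdiv_le_0_compat; lra|].
        assert (G : forall k, rsum (fun n => q ^ n) k = (q ^ k - 1) / (q - 1)).
        { induction k; cbn [rsum]; [|rewrite IHk]; simpl; field; lra. }
        rewrite G. apply Rmult_le_compat_r; [left; apply Rinv_0_lt_compat; auto|]. lra.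
      + apply Rmult_le_compat_l; [lra|]. apply rsum_geom; auto. }
  set (L := exp c) in *. assert (PL : 0 < L) by apply exp_pos.
  assert (High : rsum (fun k => u (S N + k)%nat * r ^ (S N + k)) m <=
     432 * L / INR N * th2 ^ N * / (1 - th2) + 16 * L * th3 ^ N * / (1 - th3)).
  { apply Rle_trans with (rsum (fun k => 432 * L / INR N * th2 ^ N * th2 ^ k + 16 * L * th3 ^ N * th3 ^ k) m).
    - apply rsum_le. intros k _. set (n := (S N + k)%nat).
      assert (I : INR N + 1 <= INR n) by (rewrite <- S_INR; apply le_INR; unfold n; lia).
      specialize (H2 n ltac:(lra)).
      apply Rle_trans with ((432 * L / INR n * / (c - 1 / 2) ^ n + 16 * L / (c - 7 / 16) ^ n) * r ^ n).
      { apply Rmult_le_compat_r; auto. left; auto. }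
      replace ((432 * L / INR n * / (c - 1 / 2) ^ n + 16 * L / (c - 7 / 16) ^ n) * r ^ n)
        with (432 * L / INR n * (/ (c - 1 / 2) ^ n * r ^ n) + 16 * L * (/ (c - 7 / 16) ^ n * r ^ n)) by (unfold Rdiv; ring).
      rewrite !rpow by lra. fold th2 th3.
      assert (PW : forall th, 0 <= th < 1 -> th ^ n <= th ^ N * th ^ k).
      { intros th Hth. rewrite <- pow_add. unfold n. rewrite plus_Sn_m, <- tech_pow_Rmult.
        assert (0 <= th ^ (N + k)) by (apply pow_le; lra). nra. }
      apply Rplus_le_compat.
      + rewrite Rmult_assoc. apply Rmult_le_compat; auto.
        * apply Rdiv_le_0_compat; lra.
        * apply pow_le; lra.
        * unfold Rdiv. apply Rmult_le_compat_l; [lra|]. apply Rinv_le_contravar; lra.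
      + rewrite (Rmult_assoc (16 * L)). apply Rmult_le_compat_l; [lra|]. auto.
    - rewrite rsum_plus, !rsum_scal. apply Rplus_le_compat; (apply Rmult_le_compat_l; [|apply rsum_geom; auto]).
      + apply Rmult_le_pos; [apply Rdiv_le_0_compat; lra|apply pow_le; lra].
      + apply Rmult_le_pos; [lra|apply pow_le; lra]. }
  (* r / R = 1 - k / R <= exp (- k / R), and N >= 2 c^2 together with R <= c makes the exponent at
     most - 2 c k. *)
  assert (thpow : forall R k, r < R -> R <= c -> 0 <= k -> k = R - r -> L * (r / R) ^ N <= exp (c - 2 * c * k)).
  { intros R k HR1 HR2 Hk Ek. unfold L. unfold Rminus at 1. rewrite exp_plus.
    apply Rmult_le_compat_l; [left; apply exp_pos|].
    eapply Rle_trans; [apply (pow_exp_le _ (- (k / R)))|].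
    - destruct (frac R HR1 HR2) as [[F1 _] _]. split; auto.
      assert (Y := exp_ineq1_le (- (k / R))). assert (r / R = 1 + - (k / R)) by (rewrite Ek; field; lra). lra.
    - apply exp_le. apply Rmult_le_reg_r with R; [lra|].
      replace (INR N * - (k / R) * R) with (- (INR N * k)) by (field; lra).
      assert (K1 : 2 * c * k * R <= 2 * c * k * c) by (apply Rmult_le_compat_l; nra).
      assert (K2 : 2 * c ^ 2 * k <= INR N * k) by (apply Rmult_le_compat_r; lra). lra. }
  assert (HX2 : L * th2 ^ N <= X).
  { eapply Rle_trans; [apply (thpow (c - 1 / 2) (sg - 1 / 2)); try lra; unfold r; ring|].
    right. unfold X. f_equal. field. }
  (* The radius c - 7/16 is 1/16 beyond the critical line, which gains exp (- 2 c / 16); this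
     compensates for the missing 1 / n. *)
  assert (HX3 : L * th3 ^ N <= X * exp (- (c / 8))).
  { eapply Rle_trans; [apply (thpow (c - 7 / 16) (sg - 7 / 16)); try lra; unfold r; ring|].
    right. unfold X. rewrite <- exp_plus. f_equal. field. }
  assert (inv1 : / (1 - th1) <= 2 * c / del).
  { assert (Y : del / 2 / c <= 1 - th1).
    { eapply Rle_trans; [|exact T1b]. apply Rmult_le_compat_r; [left; apply Rinv_0_lt_compat; lra|].
      unfold R4, r. lra. }
    replace (2 * c / del) with (/ (del / 2 / c)) by (field; lra).
    apply Rinv_le_contravar; auto. repeat apply Rdiv_lt_0_compat; lra. }
  assert (inv2 : / (1 - th2) <= c / del).
  { assert (Y : del / c <= 1 - th2).
    { eapply Rle_trans; [|exact T2b]. apply Rmult_le_compat_r; [left; apply Rinv_0_lt_compat; lra|].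
      unfold r. lra. }
    replace (c / del) with (/ (del / c)) by (field; lra).
    apply Rinv_le_contravar; auto. apply Rdiv_lt_0_compat; lra. }
  assert (inv3 : / (1 - th3) <= 16 * c).
  { assert (Y : / 16 / c <= 1 - th3).
    { eapply Rle_trans; [|exact T3b]. apply Rmult_le_compat_r; [left; apply Rinv_0_lt_compat; lra|].
      unfold r. lra. }
    replace (16 * c) with (/ (/ 16 / c)) by (field; lra).
    apply Rinv_le_contravar; auto. apply Rdiv_lt_0_compat; lra. }
  assert (PXc : 0 < X / c) by (apply Rdiv_lt_0_compat; lra).
  assert (invN : / INR N <= / (2 * c ^ 2)) by (apply Rinv_le_contravar; nra).
  assert (PiN : 0 < / INR N) by (apply Rinv_0_lt_compat; auto).
  (* The leading part: 1 / N is about 1 / (2 c^2) and 1 / (q - 1) is O(c), which leaves the factor 1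
     / c. *)
  assert (B1 : 2 / INR N * (q ^ S N / (q - 1)) <= 16 / nu * (X / c)).
  { assert (Y : / (q - 1) <= c / nu).
    { rewrite Eq. replace (/ ((1 - sg) / (c - 1))) with ((c - 1) / (1 - sg)) by (field; lra).
      apply Rmult_le_compat; try lra; [left; apply Rinv_0_lt_compat; lra|apply Rinv_le_contravar; lra]. }
    assert (Pq : 0 < q ^ S N) by (apply pow_lt; lra).
    assert (PI1 : 0 < / (q - 1)) by (apply Rinv_0_lt_compat; auto).
    apply Rle_trans with (2 * / (2 * c ^ 2) * (16 * X * (c / nu))).
    - unfold Rdiv at 1 2. apply Rmult_le_compat; try nra.
    - right. field. lra. }
  assert (XE : X = E * E) by (unfold X, E; rewrite <- exp_plus; f_equal; ring).
  assert (B2 : INR (S N) * Q <= 270 / nu ^ 3 * (X / c)).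
  { apply Rle_trans with (10 * E * c ^ 2).
    - rewrite S_INR. unfold Q. replace ((INR N + 1) * (2 * 2 * E)) with (4 * (INR N + 1) * E) by ring.
      replace (10 * E * c ^ 2) with (10 * c ^ 2 * E) by ring. apply Rmult_le_compat_r; [lra|]. nra.
    - apply Rle_trans with (10 * E * (27 / nu ^ 3 * (E / c))).
      + apply Rmult_le_compat_l; lra.
      + right. rewrite XE. field. lra. }
  assert (B3 : A * / (1 - th1) <= 2160 / (del * nu ^ 3) * (X / c)).
  { apply Rle_trans with (40 * c * (2 * c / del)).
    - apply Rmult_le_compat; try lra. left; apply Rinv_0_lt_compat; lra.
    - replace (40 * c * (2 * c / del)) with (80 / del * c ^ 2) by (field; lra).
      apply Rle_trans with (80 / del * (27 / nu ^ 3 * (X / c))).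
      + apply Rmult_le_compat_l; [left; apply Rdiv_lt_0_compat; lra|].
        eapply Rle_trans; [exact C2|]. apply Rmult_le_compat_l; auto.
        left; apply Rdiv_lt_0_compat; lra.
      + right. field. lra. }
  assert (B4 : 432 * L / INR N * th2 ^ N * / (1 - th2) <= 216 / del * (X / c)).
  { replace (432 * L / INR N * th2 ^ N * / (1 - th2))
      with (432 * / INR N * ((L * th2 ^ N) * / (1 - th2))) by (unfold Rdiv; ring).
    apply Rle_trans with (432 * / (2 * c ^ 2) * (X * (c / del))).
    - apply Rmult_le_compat; try lra.
      + apply Rmult_le_pos; [apply Rmult_le_pos; [lra|apply pow_le; lra]|left; apply Rinv_0_lt_compat; lra].
      + apply Rmult_le_compat; auto.
        * apply Rmult_le_pos; [lra|apply pow_le; lra].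
        * left; apply Rinv_0_lt_compat; lra.
    - right. field. lra. }
  assert (B5 : 16 * L * th3 ^ N * / (1 - th3) <= 884736 * (X / c)).
  { set (e := exp (c / 8)). assert (Pe : 0 < e) by apply exp_pos.
    assert (Ye := exp_cubic (c / 8) ltac:(lra)). fold e in Ye.
    (* [exp_cubic] gives c^3 <= 27 times 8^3 e, and c >= 4 removes one power. Finally 884736 = 256
       times 3456. *)
    assert (Y : c ^ 2 <= 3456 * e) by nra.
    rewrite exp_Ropp in HX3. fold e in HX3.
    apply Rle_trans with (16 * (X * / e) * (16 * c)).
    - apply Rmult_le_compat; try lra.
      + apply Rmult_le_pos; [lra|apply pow_le; lra].
      + left; apply Rinv_0_lt_compat; lra.
    - apply Rmult_le_reg_r with (c * e); [nra|].
      replace (16 * (X * / e) * (16 * c) * (c * e)) with (X * (256 * c ^ 2)) by (field; lra).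
      replace (884736 * (X / c) * (c * e)) with (X * (884736 * e)) by (field; lra).
      apply Rmult_le_compat_l; lra. }
  eapply Rle_trans; [apply (rsum_split _ (S N))|].
  - intros n. apply Rmult_le_pos; auto. left; auto.
  - lra.
Qed.

Theorem theorem3 :
  forall zeta : C -> C,
    is_riemann_zeta zeta ->
    riemann_hypothesis zeta ->
    forall sigma1 sigma2 : R,
      1 / 2 < sigma1 -> sigma1 < sigma2 -> sigma2 < 1 ->
      exists K T : R,
        forall rho : C,
          critical_point zeta rho ->
          sigma1 < Re rho < sigma2 ->
          T < Im rho ->
          ln (Cmod (zeta rho)) >=
            - K * (Rpower (ln (Im rho)) (2 - 2 * Re rho) / ln (ln (Im rho))).
Proof.
  intros zeta Hzeta RH sigma1 sigma2 H1 H12 H2.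
  set (del := sigma1 - 1 / 2). set (nu := 1 - sigma2).
  assert (Hdel : 0 < del <= 1 / 2) by (unfold del; lra). assert (Hnu : 0 < nu) by (unfold nu; lra).
  set (K := 16 / nu + 270 / nu ^ 3 + 2160 / (del * nu ^ 3) + 216 / del + 884736).
  (* The threshold makes c = log log t exceed 4. The second summand of the constant pays for log
     |zeta(c + i t)| >= -1 at the centre, since 1 <= 27 / nu^3 (X / c). *)
  exists (K + 27 / nu ^ 3), (exp (exp 4)).
  intros [sg t] _ Hsg Ht. simpl in Hsg, Ht.
  change (Re (sg, t)) with sg. change (Im (sg, t)) with t.
  set (c := ln (ln t)).
  assert (Pe4 := exp_pos 4). assert (Pee4 := exp_pos (exp 4)).
  assert (Ht1 : exp 4 < ln t) by (rewrite <- (ln_exp (exp 4)); apply ln_increasing; auto).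
  assert (Hc : 4 < c) by (unfold c; rewrite <- (ln_exp 4); apply ln_increasing; auto).
  assert (Et : t = exp (exp c)) by (unfold c; rewrite !exp_ln by lra; reflexivity).
  set (X := exp ((2 - 2 * sg) * c)).
  assert (EX : Rpower (ln t) (2 - 2 * sg) = X) by reflexivity. rewrite EX.
  destruct (zeta_log_coefs zeta del c Hzeta RH Hdel ltac:(lra)) as (a & [a0 La] & A1 & A2).
  rewrite <- Et in La.
  assert (LB := log_series_bound (fun n => Cmod (a n)) c sg del nu ltac:(lra) Hdel Hnu
    ltac:(unfold del; lra) ltac:(unfold nu; lra) (eq_trans (f_equal Cmod a0) Cmod_0)
    (fun n => Cmod_ge_0 (a n)) A1 A2).
  cbv beta in LB. fold K X in LB.
  (* The horizontal displacement from the centre c + i t to the point itself; its modulus is below c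
     - 1/2 since sg > 1/2. *)
  set (z := RtoC (- (c - sg))).
  assert (Mz : Cmod z = c - sg) by (unfold z; rewrite Cmod_R, Rabs_Ropp, Rabs_pos_eq; lra).
  destruct (La z ltac:(rewrite Mz; lra)) as [P E].
  replace ((c, t) + z)%C with (sg, t) in E by (apply C_eq; unfold z; simpl; ring).
  replace ((c, t) + 0)%C with (c, t) in E by (apply C_eq; simpl; ring).
  assert (Bnd : Cmod (PSf a z) <= K * (X / c)).
  { apply (Cser_norm_le _ _ _ P). intros n. eapply Rle_trans; [apply Cmod_csum|].
    eapply Rle_trans; [|apply (LB n)]. apply rsum_le. intros k _.
    rewrite Cmod_mult, Cmod_pow, Mz. lra. }
  assert (Z0 : 1 / 2 <= Cmod (zeta (c, t))).
  { assert (Y := zeta_near_1 zeta (c, t) Hzeta ltac:(simpl; lra)). simpl Re in Y.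
    assert (I : / (c - 1) <= / 2) by (apply Rinv_le_contravar; lra).
    assert (W := Cmod_ge_minus 1 (1 - zeta (c, t))%C).
    replace (1 - (1 - zeta (c, t)))%C with (zeta (c, t)) in W by ring.
    rewrite Cmod_1, Cmod_minus_sym in W. lra. }
  rewrite E, Cmod_mult, Cmod_Cexp, ln_mult, ln_exp by (try apply exp_pos; lra).
  assert (Rl := re_le_Cmod (PSf a z)). apply Rabs_le_between in Rl.
  assert (l0 : - 1 <= ln (Cmod (zeta (c, t)))).
  { apply Rle_trans with (ln (/ 2)); [|apply ln_le; lra].
    rewrite ln_Rinv by lra. assert (Y : ln 2 <= 1); [|lra].
    rewrite <- (ln_exp 1). apply ln_le; [lra|]. assert (W := exp_ineq1_le 1). lra. }
  assert (One : 1 <= 27 / nu ^ 3 * (X / c)).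
  { assert (P3 : 0 < nu ^ 3) by (apply pow_lt; auto).
    assert (Y := exp_cubic (nu * c) ltac:(nra)).
    assert (Y2 : exp (nu * c) <= X) by (apply exp_le; unfold nu in *; nra).
    apply Rmult_le_reg_r with (nu ^ 3 * c); [nra|].
    replace (27 / nu ^ 3 * (X / c) * (nu ^ 3 * c)) with (27 * X) by (field; lra).
    apply Rle_trans with ((nu * c) ^ 3); [|lra].
    replace ((nu * c) ^ 3) with (nu ^ 3 * c * c ^ 2) by ring.
    assert (Pw : 0 < nu ^ 3 * c) by (apply Rmult_lt_0_compat; lra).
    assert (1 <= c ^ 2) by nra. set (w := nu ^ 3 * c) in *. nra. }
  lra.
Qed.
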